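(* Consider cost tensors $C\in(\mathbb{R}^n)^{\otimes k}$ that have low-rank plus sparse structure of constant rank $r$ and $\mathrm{poly}(n,k)$ sparsity $s$. For any $\varepsilon>0$: - The $\mathtt{MWU}$ algorithm computes an $\varepsilon$-approximate solution to $\mathsf{MOT}_C$ in $\mathrm{poly}(n,k,C_{\max}/\varepsilon)$ time. - The $\mathtt{SINKHORN}$ algorithm computes an $\varepsilon$-approximate solution to $\mathsf{MOT}_C$ in $\mathrm{poly}(n,k,C_{\max}/\varepsilon)$ time. Moreover, $\mathtt{MWU}$ outputs a polynomially sparse tensor, whereas $\mathtt{SINKHORN}$ outputs a fully dense tensor through an implicit representation of the form $P=(\otimes_{i=1}^kd_i)\odot\exp[-\eta C]+\otimes_{i=1}^kv_i$ given by vectors $d_i,v_i\in\mathbb{R}^n_{\ge0}$.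
   Context: Conventions: $[n]=\{1,\dots,n\}$; $\Delta_n$ is the probability simplex; $\vec{j}=(j_1,\dots,j_k)\in[n]^k$; $C_{\max}=\max_{\vec{j}}|C_{\vec{j}}|$; $m(P)=\sum_{\vec{j}}P_{\vec{j}}$; $[m_i(P)]_j=\sum_{\vec{j}:\,j_i=j}P_{\vec{j}}$; $\delta_{\vec{j}}$ is the tensor with value $1$ at $\vec{j}$ and $0$ elsewhere; $\odot$ is the entrywise product, $\otimes$ the Kronecker product, $\exp[\cdot]$ is entrywise. Inputs have bit complexity at most $\mathrm{poly}(n,k)$; runtimes count arithmetic operations and include implementing the oracles used by the algorithms. $\mathsf{MOT}_C$: given $\mu\in(\Delta_n)^k$, solve $\min\langle P,C\rangle$ over $\mathcal{M}(\mu_1,\dots,\mu_k)=\{P\in(\mathbb{R}_{\ge0}^n)^{\otimes k}: m_i(P)=\mu_i\ \forall i\}$. An $\varepsilon$-approximate solution is a feasible $P$ with cost at most $\varepsilon$ above optimal. Low-rank plus sparse structure: $C=R+S$ where $R$ is a rank-$r$ tensor (i.e. $R=\sum_{\ell=1}^r\bigotimes_{i=1}^ku_{i,\ell}$ with $u_{i,\ell}\in\mathbb{R}^n$ and $r$ minimal) and $S$ has at most $s$ non-zero entries. Standing assumptions: $S$ is input through its non-zero entries, $R$ through a rank-$r$ factorization, and the entries of both $R$ and $S$ are of size $O(C_{\max})$. $\mathtt{MWU}$ (costs in $[1,2]$): with $\Phi(P)=\log\big(e^{\langle C,P\rangle/\lambda}+\sum_{i,j}e^{[m_i(P)]_j/[\mu_i]_j}\big)$,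 the bottleneck oracle either returns ''null'', certifying $\min_{\vec{j}}\frac{\partial}{\partial h}\Phi(P+h\delta_{\vec{j}})|_{h=0}>1$, or returns $\vec{j}$ with this derivative at most $1+\varepsilon$. Step 1: $P\leftarrow0$, $\eta\leftarrow2\log(nk+1)/\varepsilon$; while $m(P)<\eta$: call the oracle; on ''null'' return ''infeasible'', else $P\leftarrow P+\delta_{\vec{j}}\,\varepsilon\min(\lambda/C_{\vec{j}},\min_i[\mu_i]_{j_i})$; then $P\leftarrow P/(\eta(1+\varepsilon)^4)$. Step 2: while $m(P)<1$: choose $j_i\in\arg\max_j([\mu_i]_j-[m_i(P)]_j)$ for each $i$, $\alpha\leftarrow\min_i([\mu_i]_{j_i}-[m_i(P)]_{j_i})$, $P\leftarrow P+\alpha\delta_{\vec{j}}$. This is wrapped in a binary search over $\lambda$; a general cost is first replaced by $(C+3C_{\max})/(2C_{\max})$ with accuracy rescaled accordingly. $\mathtt{SINKHORN}$: let $\mathsf{MARG}_C(d,\eta,i)=m_i((\otimes_{i'}d_{i'})\odot\exp[-\eta C])$. Set $d_i\leftarrow\mathbf{1}$, $\eta\leftarrow(2k\log n)/\varepsilon$; for $\mathrm{poly}(n,k,C_{\max}/\varepsilon)$ iterations choose $i$ (round-robin, greedily or randomly) and set $d_i\leftarrow d_i\odot(\mu_i/\mathsf{MARG}_C(d,\eta,i))$. Then for $i=1,\dots,k$ set $d_i\leftarrow d_i\odot\min[\mathbf{1},\mu_i/\mathsf{MARG}_C(d,\eta,i)]$; set $v_i\leftarrow\mu_i-\mathsf{MARG}_C(d,\eta,i)$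 for all $i$, and $v_1\leftarrow v_1/\|v_1\|_1^{k-1}$. Return $d_1,\dots,d_k,v_1,\dots,v_k$. Here $\mathtt{SINKHORN}$ is run with an approximating cost tensor $\tilde{C}$ with $\|C-\tilde{C}\|_{\max}\le\varepsilon/2$ in place of $C$ (also in the implicit representation) and accuracy adjusted by a constant factor, its solution being an $\varepsilon$-approximate solution for $\mathsf{MOT}_C$.
   Formalization: ''Fully dense'' is taken to mean positive at every multi-index whose marginals are all positive, since all other entries vanish in any feasible tensor; 0/0 terms from zero marginal entries and the rescaling when C=0 are given the natural conventions, and C_max is supplied as an input number. *)

(* Defs.v *)
From HB Require Import structures.
From mathcomp Require Import all_boot all_order all_algebra.
From mathcomp Require Import all_classical all_reals all_analysis.

Set Implicit Arguments.
Unset Strict Implicit.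
Unset Printing Implicit Defensive.

Import Order.TTheory GRing.Theory Num.Theory.
Import numFieldNormedType.Exports.

Local Open Scope ring_scope.

(* Throughout, [x / 0 = 0] as in MathComp, and the indices 1..n, 1..k are the
   ordinals 0..n-1, 0..k-1. *)

(** * Machine model

  A uniform real-number machine.  Natural numbers serve for addressing and
  loop control only; they have addition and truncated subtraction but no
  unit-cost multiplication, so they cannot be used to pack information.  The
  real unit-cost operations are + - * / exp ln and comparison; there is no
  rounding of a real to a natural number and no real constant in programs.
  Arrays are addressed by lists (of length fixed by the program text) of scalar
  variables, so [A[x, y]] is a location of a two-dimensional array. *)

Inductive nexp : Type :=
| NCst of nat
| NVar of nat                    (* scalar variable *)
| NGet of nat & seq nat          (* array cell, addressed by scalar variables *)
| NAdd of nexp & nexp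
| NSub of nexp & nexp.

Inductive rexp : Type :=
| RNat of nexp
| RGet of nat & seq nat
| RAdd of rexp & rexp
| RSub of rexp & rexp
| RMul of rexp & rexp
| RDiv of rexp & rexp
| RExp of rexp
| RLn of rexp.

Inductive bexp : Type :=
| BNatLe of nexp & nexp
| BRealLe of rexp & rexp
| BNot of bexp
| BAnd of bexp & bexp.

Inductive com : Type :=
| CSkip
| CSetVar of nat & nexp
| CSetNat of nat & seq nat & nexp
| CSetReal of nat & seq nat & rexp
| CSeq of com & com
| CIf of bexp & com & com
| CWhile of bexp & com.

Fixpoint ncost (e : nexp) : nat :=
  match e with
  | NCst _ | NVar _ | NGet _ _ => 1
  | NAdd e1 e2 | NSub e1 e2 => (ncost e1 + ncost e2).+1
  end.

Fixpoint rcost (e : rexp) : nat :=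
  match e with
  | RNat e1 => (ncost e1).+1
  | RGet _ _ => 1
  | RAdd e1 e2 | RSub e1 e2 | RMul e1 e2 | RDiv e1 e2 =>
      (rcost e1 + rcost e2).+1
  | RExp e1 | RLn e1 => (rcost e1).+1
  end.

Fixpoint bcost (b : bexp) : nat :=
  match b with
  | BNatLe e1 e2 => (ncost e1 + ncost e2).+1
  | BRealLe e1 e2 => (rcost e1 + rcost e2).+1
  | BNot b1 => (bcost b1).+1
  | BAnd b1 b2 => (bcost b1 + bcost b2).+1
  end.

Section Machine.
Variable R : realType.

Record store : Type := Store {
  nvar : nat -> nat;
  narr : nat -> seq nat -> nat;
  rarr : nat -> seq nat -> R }.

Definition set_nvar (st : store) (x m : nat) : store :=
  Store (fun y => if y == x then m else nvar st y) (narr st) (rarr st).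

Definition set_narr (st : store) (a : nat) (l : seq nat) (m : nat) : store :=
  Store (nvar st)
    (fun b l' => if (b == a) && (l' == l) then m else narr st b l') (rarr st).

Definition set_rarr (st : store) (a : nat) (l : seq nat) (x : R) : store :=
  Store (nvar st) (narr st)
    (fun b l' => if (b == a) && (l' == l) then x else rarr st b l').

Definition address (st : store) (xs : seq nat) : seq nat := map (nvar st) xs.

Fixpoint neval (st : store) (e : nexp) : nat :=
  match e with
  | NCst m => m
  | NVar x => nvar st x
  | NGet a xs => narr st a (address st xs)
  | NAdd e1 e2 => (neval st e1 + neval st e2)%N
  | NSub e1 e2 => (neval st e1 - neval st e2)%N
  end.

Fixpoint reval (st : store) (e : rexp) : R :=
  match e with
  | RNat e1 => (neval st e1)%:R
  | RGet a xs => rarr st a (address st xs)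
  | RAdd e1 e2 => reval st e1 + reval st e2
  | RSub e1 e2 => reval st e1 - reval st e2
  | RMul e1 e2 => reval st e1 * reval st e2
  | RDiv e1 e2 => reval st e1 / reval st e2
  | RExp e1 => expR (reval st e1)
  | RLn e1 => ln (reval st e1)
  end.

Fixpoint beval (st : store) (b : bexp) : bool :=
  match b with
  | BNatLe e1 e2 => (neval st e1 <= neval st e2)%N
  | BRealLe e1 e2 => reval st e1 <= reval st e2
  | BNot b1 => ~~ beval st b1
  | BAnd b1 b2 => beval st b1 && beval st b2
  end.

(* [exec p st t st'] : from [st], the program [p] halts in [st'] after [t]
   operations. *)
Inductive exec : com -> store -> nat -> store -> Prop :=
| ExecSkip st : exec CSkip st 1 st
| ExecSetVar x e st :
    exec (CSetVar x e) st (ncost e).+1 (set_nvar st x (neval st e))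
| ExecSetNat a xs e st :
    exec (CSetNat a xs e) st (ncost e).+1
      (set_narr st a (address st xs) (neval st e))
| ExecSetReal a xs e st :
    exec (CSetReal a xs e) st (rcost e).+1
      (set_rarr st a (address st xs) (reval st e))
| ExecSeq c1 c2 st st1 st2 t1 t2 :
    exec c1 st t1 st1 -> exec c2 st1 t2 st2 ->
    exec (CSeq c1 c2) st (t1 + t2)%N st2
| ExecIf b c1 c2 st st' t :
    exec (if beval st b then c1 else c2) st t st' ->
    exec (CIf b c1 c2) st (bcost b + t)%N st'
| ExecWhileStop b c st :
    ~~ beval st b -> exec (CWhile b c) st (bcost b) st
| ExecWhileStep b c st st1 st2 t1 t2 :
    beval st b -> exec c st t1 st1 -> exec (CWhile b c) st1 t2 st2 ->
    exec (CWhile b c) st (bcost b + t1 + t2)%N st2.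

End Machine.

(** * Tensors and multimarginal optimal transport *)

Definition midx (n k : nat) : finType := {ffun 'I_k -> 'I_n}.

Definition tensor (R : realType) (n k : nat) : Type := midx n k -> R.

Section Tensors.
Variables (R : realType) (n k : nat).
Implicit Types (P C : tensor R n k) (mu : 'I_k -> 'I_n -> R).

Definition mass P : R := \sum_jj P jj.

Definition marg P (i : 'I_k) (j : 'I_n) : R :=
  \sum_(jj : midx n k | jj i == j) P jj.

Definition inner C P : R := \sum_jj C jj * P jj.

Definition tmax C : R := \big[Num.max/0]_(jj : midx n k) `|C jj|.

(* P + a delta_jj *)
Definition add_delta P (a : R) (jj : midx n k) : tensor R n k :=
  fun jj' => P jj' + a * (jj' == jj)%:R.

Definition nnz P : nat := #|[set jj | P jj != 0]|.

Definition in_simplex (p : 'I_n -> R) : Prop :=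
  (forall j, 0 <= p j) /\ \sum_j p j = 1.

Definition feasible mu P : Prop :=
  (forall jj, 0 <= P jj) /\ (forall i j, marg P i j = mu i j).

Definition mot_approx C mu (eps : R) P : Prop :=
  feasible mu P /\
  (forall Q, feasible mu Q -> inner C P <= inner C Q + eps).

Definition sum_rank1 (r : nat) (u : 'I_k -> 'I_r -> 'I_n -> R) : tensor R n k :=
  fun jj => \sum_(l < r) \prod_(i < k) u i l (jj i).

Definition has_rank (C : tensor R n k) (r : nat) : Prop :=
  (exists u : 'I_k -> 'I_r -> 'I_n -> R, C =1 sum_rank1 u) /\
  (forall r' (u : 'I_k -> 'I_r' -> 'I_n -> R), C =1 sum_rank1 u -> (r <= r')%N).

End Tensors.

(** * MWU *)

Section MWU.
Variables (R : realType) (n k : nat).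
Variables (C : tensor R n k) (mu : 'I_k -> 'I_n -> R) (eps : R).
Implicit Types (P : tensor R n k) (lam : R).

(* Entries with [mu i j = 0] never receive mass: the corresponding quotients
   0/0 are left out of the potential, and the multi-indices through them, whose
   directional derivative is +oo, are never bottlenecks. *)
Definition potential lam P : R :=
  ln (expR (inner C P / lam)
      + \sum_(i < k) \sum_(j < n | 0 < mu i j) expR (marg P i j / mu i j)).

Definition in_support (jj : midx n k) : Prop := forall i, 0 < mu i (jj i).

Definition dpotential lam P (jj : midx n k) : R :=
  derive1 (fun h : R => potential lam (add_delta P h jj)) 0.

Definition oracle_null lam P : Prop :=
  forall jj, in_support jj -> 1 < dpotential lam P jj.

Definition oracle_answer lam P (jj : midx n k) : Prop :=
  in_support jj /\ dpotential lam P jj <= 1 + eps.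

Definition mwu_eta : R := 2 * ln (n * k + 1)%:R / eps.

(* eps * min (lam / C_jj, min_i mu_i(jj_i)) *)
Definition mwu_stepsize lam (jj : midx n k) : R :=
  eps * \big[Num.min/(lam / C jj)]_(i < k) mu i (jj i).

(* [mwu_step1 lam P N out] : from the iterate [P], Step 1 returns [out]
   ([None] for "infeasible") after [N] oracle calls.  The oracle is any one
   meeting its specification, hence a relation. *)
Inductive mwu_step1 lam : tensor R n k -> nat -> option (tensor R n k) -> Prop :=
| MwuDone P : mwu_eta <= mass P ->
    mwu_step1 lam P 0 (Some (fun jj => P jj / (mwu_eta * (1 + eps) ^+ 4)))
| MwuNull P : mass P < mwu_eta -> oracle_null lam P ->
    mwu_step1 lam P 1 None
| MwuStep P jj N out : mass P < mwu_eta -> oracle_answer lam P jj ->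
    mwu_step1 lam (add_delta P (mwu_stepsize lam jj) jj) N out ->
    mwu_step1 lam P N.+1 out.

Definition deficit P (i : 'I_k) (j : 'I_n) : R := mu i j - marg P i j.

Inductive mwu_step2 : tensor R n k -> nat -> tensor R n k -> Prop :=
| FillDone P : 1 <= mass P -> mwu_step2 P 0 P
| FillStep P (jj : midx n k) (a : R) N out : mass P < 1 ->
    (forall i j, deficit P i j <= deficit P i (jj i)) ->
    (exists i, a = deficit P i (jj i)) ->
    (forall i, a <= deficit P i (jj i)) ->
    mwu_step2 (add_delta P a jj) N out ->
    mwu_step2 P N.+1 out.

(* [P] is the output of Step 1 for the current upper bound [hi]. *)
Inductive mwu_search : R -> R -> tensor R n k -> nat -> tensor R n k -> Prop :=
| SearchDone lo hi P : hi - lo <= eps -> mwu_search lo hi P 0 P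
| SearchFeasible lo hi P P' N N' out : eps < hi - lo ->
    mwu_step1 ((lo + hi) / 2) (fun=> 0) N (Some P') ->
    mwu_search lo ((lo + hi) / 2) P' N' out ->
    mwu_search lo hi P (N + N')%N out
| SearchInfeasible lo hi P N N' out : eps < hi - lo ->
    mwu_step1 ((lo + hi) / 2) (fun=> 0) N None ->
    mwu_search ((lo + hi) / 2) hi P N' out ->
    mwu_search lo hi P (N + N')%N out.

(* MWU for costs in [1, 2], so that the optimal value is in [1, 2] as well;
   [N] counts all iterations. *)
Definition mwu_unit (N : nat) (out : tensor R n k) : Prop :=
  exists N0 N1 N2 P0 P1,
    [/\ mwu_step1 2 (fun=> 0) N0 (Some P0),
        mwu_search 1 2 P0 N1 P1,
        mwu_step2 P1 N2 out
      & N = (N0 + N1 + N2)%N].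

End MWU.

(* If C = 0, any positive number may play the role of C_max; the normalized cost
   is then 3/2 whichever is chosen. *)
Definition normalized_cost (R : realType) n k (C : tensor R n k) : tensor R n k :=
  let c := if tmax C == 0 then 1 else tmax C in
  fun jj => (C jj + 3 * c) / (2 * c).

Definition normalized_eps (R : realType) n k (C : tensor R n k) (eps : R) : R :=
  if tmax C == 0 then 1 / 10
  else Num.min (1 / 10) (eps / (20 * tmax C)).

Definition mwu (R : realType) n k (C : tensor R n k) (mu : 'I_k -> 'I_n -> R)
    (eps : R) (N : nat) (out : tensor R n k) : Prop :=
  mwu_unit (normalized_cost C) mu (normalized_eps C eps) N out.

(** * SINKHORN *)

Inductive update_rule : Type := RoundRobin | Greedy | Random.

Section Sinkhorn.
Variables (R : realType) (n k : nat).
Variables (C : tensor R n k) (mu : 'I_k -> 'I_n -> R).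
Implicit Types (d v : 'I_k -> 'I_n -> R) (eta : R) (s tape : seq 'I_k).

Definition sinkhorn_eta (eps : R) : R := 2 * k%:R * ln n%:R / eps.

Definition scaled d eta : tensor R n k :=
  fun jj => \prod_(i < k) d i (jj i) * expR (- eta * C jj).

Definition MARG d eta : 'I_k -> 'I_n -> R := marg (scaled d eta).

Definition sinkhorn_update eta d (i : 'I_k) : 'I_k -> 'I_n -> R :=
  fun i' j => if i' == i then d i j * (mu i j / MARG d eta i j) else d i' j.

Definition sinkhorn_iter eta s : 'I_k -> 'I_n -> R :=
  foldl (sinkhorn_update eta) (fun _ _ => 1) s.

Definition violation eta d (i : 'I_k) : R :=
  \sum_j `|mu i j - MARG d eta i j|.

(* [s] is a legitimate sequence of updated indices; [tape] is the sequence of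
   random indices, used by the random rule only. *)
Definition follows_rule (rule : update_rule) eta tape s : Prop :=
  match rule with
  | RoundRobin => map val s = [seq (t %% k)%N | t <- iota 0 (size s)]
  | Greedy => forall s1 i s2, s = s1 ++ i :: s2 ->
      forall i', violation eta (sinkhorn_iter eta s1) i'
                 <= violation eta (sinkhorn_iter eta s1) i
  | Random => prefix s tape
  end.

Definition round_update eta d (i : 'I_k) : 'I_k -> 'I_n -> R :=
  fun i' j =>
    if i' == i then d i j * Num.min 1 (mu i j / MARG d eta i j) else d i' j.

Definition rounded eta d : 'I_k -> 'I_n -> R :=
  foldl (round_update eta) d (enum 'I_k).

Definition residual eta d : 'I_k -> 'I_n -> R :=
  let v := fun i j => mu i j - MARG d eta i j in
  fun i j => if val i == 0%N then v i j / (\sum_j' `|v i j'|) ^+ k.-1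
             else v i j.

(* [d], [v] are what SINKHORN, run with cost [C] and accuracy [eps], returns
   after [T] iterations. *)
Definition sinkhorn (rule : update_rule) tape (eps : R) (T : nat) d v : Prop :=
  let eta := sinkhorn_eta eps in
  exists s, [/\ size s = T, follows_rule rule eta tape s,
                d = rounded eta (sinkhorn_iter eta s) & v = residual eta d].

(* (d_1 (x) ... (x) d_k) . exp[-eta C] + v_1 (x) ... (x) v_k *)
Definition implicit_tensor eta d v : tensor R n k :=
  fun jj => scaled d eta jj + \prod_(i < k) v i (jj i).

End Sinkhorn.

(** * Instances with low-rank plus sparse cost *)

Record instance (R : realType) (r : nat) : Type := Instance {
  side : nat;
  nmarg : nat;
  target : 'I_nmarg -> 'I_side -> R;
  factor : 'I_nmarg -> 'I_r -> 'I_side -> R;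
  spars : nat;
  spos : 'I_spars -> midx side nmarg;
  sval : 'I_spars -> R }.

Arguments target {R r} _ _ _.
Arguments factor {R r} _ _ _ _.
Arguments spos {R r} _ _.
Arguments sval {R r} _ _.

Section Instances.
Variables (R : realType) (r : nat).
Implicit Types I : instance R r.

Definition low_rank_part I : tensor R (side I) (nmarg I) := sum_rank1 (factor I).
Arguments low_rank_part : clear implicits.

Definition sparse_part I : tensor R (side I) (nmarg I) :=
  fun jj => \sum_(t < spars I | spos I t == jj) sval I t.
Arguments sparse_part : clear implicits.

Definition cost I : tensor R (side I) (nmarg I) :=
  fun jj => low_rank_part I jj + sparse_part I jj.
Arguments cost : clear implicits.

Definition Cmax I : R := tmax (cost I).

Definition bit_complexity_le (B : nat) (x : R) : Prop :=
  exists (p : int) (q : nat),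
    [/\ (`|p| < 2 ^ B)%N, (0 < q < 2 ^ B)%N & x = p%:~R / q%:R].

(* [K] is the constant in "the entries of R and S are of size O(C_max)";
   a * (n + k) ^ b bounds both the sparsity and the bit complexity. *)
Definition valid (K : R) (a b : nat) I : Prop :=
  let B := (a * (side I + nmarg I) ^ b)%N in
  (0 < nmarg I)%N /\
  (forall i, in_simplex (target I i)) /\
  has_rank (low_rank_part I) r /\
  injective (spos I) /\
  (forall t, sval I t != 0) /\
  (spars I <= B)%N /\
  (forall jj, `|low_rank_part I jj| <= K * Cmax I) /\
  (forall jj, `|sparse_part I jj| <= K * Cmax I) /\
  (forall i j, bit_complexity_le B (target I i j)) /\
  (forall i l j, bit_complexity_le B (factor I i l j)) /\
  (forall t, bit_complexity_le B (sval I t)).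

(* Input layout; all other locations are unconstrained. *)
Definition loaded I (eps : R) (tape : seq 'I_(nmarg I)) (st : store R) : Prop :=
  nvar st 0 = side I /\ nvar st 1 = nmarg I /\ nvar st 2 = spars I /\
  (forall t i, narr st 0 [:: val t; val i] = spos I t i :> nat) /\
  (forall t, (t < size tape)%N ->
     narr st 1 [:: t] = nth 0%N (map val tape) t) /\
  (forall i j, rarr st 0 [:: val i; val j] = target I i j) /\
  (forall i l j, rarr st 1 [:: val i; val l; val j] = factor I i l j) /\
  (forall t, rarr st 2 [:: val t] = sval I t) /\
  rarr st 3 [::] = Cmax I /\ rarr st 4 [::] = eps.
Arguments loaded : clear implicits.

(* A query multi-index, stored in addition to the input. *)
Definition queried n k (jj : midx n k) (st : store R) : Prop :=
  forall i, narr st 2 [:: val i] = jj i :> nat.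

(* A sparse tensor is output as a list of [N] pairs (multi-index, value), read
   as the sum of the corresponding multiples of delta tensors. *)
Definition outputs_sparse n k (P : tensor R n k) (N : nat) (st : store R) : Prop :=
  nvar st 0 = N /\
  forall jj : midx n k,
    P jj = \sum_(t < N | [forall i, narr st 0 [:: val t; val i] == jj i])
             rarr st 0 [:: val t].

Definition outputs_vectors n k (d v : 'I_k -> 'I_n -> R) (st : store R) : Prop :=
  forall i j, rarr st 0 [:: val i; val j] = d i j /\
              rarr st 1 [:: val i; val j] = v i j.

Definition poly_bound (c e : nat) (x : R) : R := c%:R * (1 + x) ^+ e.

Definition size_param I (eps : R) : R :=
  (side I)%:R + (nmarg I)%:R + Cmax I / eps.

(* Within [B] operations, [p] computes an eps-approximate solution of MOT_C which
   is the output of a run of MWU, together with its polynomial sparsity. *)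
Definition mwu_succeeds (p : com) I (eps B : R) : Prop :=
  forall st, loaded I eps [::] st ->
  exists t st' P N M,
    [/\ exec p st t st', t%:R <= B, outputs_sparse P M st' &
        [/\ mwu (cost I) (target I) eps N P, N%:R <= B,
            mot_approx (cost I) (target I) eps P, M%:R <= B
          & (nnz P)%:R <= B]].

(* SINKHORN is run with the cost [Ct] and accuracy eps/2.  Its output is dense:
   an entry is positive as soon as the marginals permit it. *)
Definition sinkhorn_succeeds (rule : update_rule) (p : com) I (eps : R)
    (Ct : tensor R (side I) (nmarg I)) (tape : seq 'I_(nmarg I)) (B : R) : Prop :=
  forall st, loaded I eps tape st ->
  exists t st' T d v,
    let P := implicit_tensor Ct (sinkhorn_eta (side I) (nmarg I) (eps / 2)) d v in
    [/\ exec p st t st', t%:R <= B, outputs_vectors d v st' &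
        [/\ sinkhorn Ct (target I) rule tape (eps / 2) T d v, T%:R <= B,
            forall i j, 0 <= d i j /\ 0 <= v i j,
            mot_approx (cost I) (target I) eps P
          & forall jj, in_support (target I) jj -> 0 < P jj]].

(* The entries of [Ct], hence those of the implicitly represented tensor, can be
   computed by [q] within [B] operations. *)
Definition evaluates (q : com) I (eps : R) (Ct : tensor R (side I) (nmarg I))
    (B : R) : Prop :=
  forall jj st, loaded I eps [::] st -> queried jj st ->
  exists t st', [/\ exec q st t st', t%:R <= B & rarr st' 0 [::] = Ct jj].

End Instances.

Arguments low_rank_part {R r} I _.
Arguments sparse_part {R r} I _.
Arguments cost {R r} I _.
Arguments loaded {R r} I _ _ _.

(* Main.v *)
Require Import Defs.
From HB Require Import structures.
From mathcomp Require Import all_boot all_order all_algebra.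
From mathcomp Require Import all_classical all_reals all_analysis.
From mathcomp Require Import zify ring lra.

Set Implicit Arguments.
Unset Strict Implicit.
Unset Printing Implicit Defensive.

Import Order.TTheory GRing.Theory Num.Theory.
Import numFieldNormedType.Exports.

Local Open Scope ring_scope.

(** Both algorithms see the cost [C = R + S] only through marginals of tensors
  [(d_1 (x) ... (x) d_k) . G] where [G] is entrywise close to [exp (- th * C)] for
  some [th].  The structure of [C] makes such marginals computable for
  [G = (1 - th * R / m) ^ m . exp (- th * S)].  The power is within a factor
  [exp (1 / 8)] of the exponential once [m] is quadratic in a bound of [th * R]
  ([gibbs_bounds]), and that bound is polynomial in the size parameter in every
  use.  Since the rank [r] is constant, the multinomial theorem expands the power
  into polynomially many products of functions of one coordinate, whose sums over
  all multi-indices factor; the sparse part changes at most [s] entries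
  ([xval_MARGX]).

  SINKHORN.  The kernel [G] is exactly [exp (- eta * Ct)] for a cost [Ct] within
  [eps / 8] of [C] ([gibbs_surrogate], [surrogate_close]), and the algorithm is run
  on [Ct] without any error.  An update raises the dual objective by a relative
  entropy, hence by at least a quarter of the squared violation that
  it repairs ([dual_incr]), while the dual objective stays in an interval of length
  [k ln n + 2 eta max |Ct|] ([dual_first], [dual_le]).  A large total violation
  forces one large update within a sweep for the greedy and round robin rules
  ([greedy_progress], [round_robin_progress], [deterministic_convergence]) and a large average update for the random rule
  ([random_convergence]).  So a small violation is reached in polynomially many
  updates.  Rounding then moves the tensor by at most twice the violation
  ([rounding_close]), and a tensor in scaling form is optimal for its own marginals
  up to [k ln n / eta] ([gibbs_optimal]); together this is [run_accuracy].

  MWU.  The derivative of the potential in direction [jj] is a multiple of [C_jj]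
  plus a sum of functions of the single coordinates of [jj].  Therefore
  [exp (- H * derivative)] is again of the form above, and the coordinates of a
  bottleneck are chosen one after the other, each maximising the marginal of what
  is left.  This loses at most a factor [n] per coordinate, that is [k ln n / H] in
  the derivative ([oracle_best], [oracle_slope]).  A null answer refutes the bound
  [lam] by averaging ([null_infeasible]).  Otherwise every step raises one of the at
  most [n * k + 1] exponents by the normalised accuracy [e], while the potential,
  an upper bound of all of them, grows only with the mass ([potential_step]); this
  bounds the number of steps ([mwu_count]) and makes the rescaled tensor a plan that misses at most
  [4 e] of mass and costs at most [lam] ([mwu_done]).  Step 2 supplies the missing
  mass with at most one new entry per marginal entry ([fill_step]) at a cost of at
  most 2 per unit, so that the final error is [9 e] in normalised units, which
  [normalized_mot] translates back.  The length of the list of chosen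
  multi-indices bounds the sparsity.

  The running times are read off the program texts: the programs are written in a
  structured language where one number bounds the turns of each loop, compilation
  turns this into a bound on machine operations ([exec_prog_com]) that is
  polynomial in that number ([poly_growth_ptime]), and the number is polynomial in
  the size parameter ([fuel_bounds]). *)

(** * Structured programs and their compilation *)

Inductive binop := OAdd | OSub | OMul | ODiv | OMin.

(** Real expressions extended by bounded sums, products and minima, so that a
  formula such as an expanded marginal is a single expression.  [XBig o E0 v b E]
  iterates [o] over the values of [E] for [v] below [b], starting from [E0]. *)
Inductive xexp : Type :=
| XNat of nexp
| XGet of nat & seq nexp
| XBin of binop & xexp & xexp
| XExp of xexp
| XLn of xexp
| XIfN of nexp & nexp & xexp & xexp
| XIfR of xexp & xexp & xexp & xexp
| XBig of binop & xexp & nat & nexp & xexp.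

Inductive prog : Type :=
| PSkip
| PNat of nat & nexp
| PNatA of nat & seq nat & nexp
| PReal of nat & seq nat & xexp
| PSeq of prog & prog
| PIf of xexp & xexp & prog & prog
| PWhile of nexp & nexp & prog.

Definition PFor (v : nat) (b : nexp) (c : prog) : prog :=
  PSeq (PNat v (NCst 0))
       (PWhile (NAdd (NVar v) (NCst 1)) b
          (PSeq c (PNat v (NAdd (NVar v) (NCst 1))))).

Section Semantics.
Variable R : realType.
Implicit Types (st : store R) (Q : store R -> Prop).

Definition opR (o : binop) : R -> R -> R :=
  match o with
  | OAdd => +%R
  | OSub => fun x y => x - y
  | OMul => *%R
  | ODiv => fun x y => x / y
  | OMin => Num.min
  end.

Fixpoint xeval st (E : xexp) : R :=
  match E with
  | XNat e => (neval st e)%:R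
  | XGet a es => rarr st a (map (neval st) es)
  | XBin o E1 E2 => opR o (xeval st E1) (xeval st E2)
  | XExp E1 => expR (xeval st E1)
  | XLn E1 => ln (xeval st E1)
  | XIfN e1 e2 E1 E2 =>
      if (neval st e1 <= neval st e2)%N then xeval st E1 else xeval st E2
  | XIfR E1 E2 E3 E4 =>
      if xeval st E1 <= xeval st E2 then xeval st E3 else xeval st E4
  | XBig o E0 v b E1 =>
      \big[opR o/xeval st E0]_(0 <= p < neval st b) xeval (set_nvar st v p) E1
  end.

(** The length of every iteration met in the evaluation is at most [N]; this is
  what bounds the running time of the compiled expression. *)
Fixpoint xbnd (N : nat) st (E : xexp) : Prop :=
  match E with
  | XNat _ | XGet _ _ => True
  | XBin _ E1 E2 => xbnd N st E1 /\ xbnd N st E2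
  | XExp E1 | XLn E1 => xbnd N st E1
  | XIfN e1 e2 E1 E2 => xbnd N st E1 /\ xbnd N st E2
  | XIfR E1 E2 E3 E4 =>
      [/\ xbnd N st E1, xbnd N st E2, xbnd N st E3 & xbnd N st E4]
  | XBig o E0 v b E1 =>
      [/\ xbnd N st E0, (neval st b <= N)%N &
          forall p, (p < neval st b)%N -> xbnd N (set_nvar st v p) E1]
  end.

Fixpoint wloop (body : (store R -> Prop) -> store R -> Prop) e1 e2 Q
    (f : nat) st : Prop :=
  if (neval st e1 <= neval st e2)%N then
    if f is f'.+1 then body (wloop body e1 e2 Q f') st else False
  else Q st.

(** A weakest precondition for total correctness in which [N] bounds the number
  of turns of every single loop.  One bound for all loops makes the running time
  a function of [N] and the program text, and [N] is only chosen at the end. *)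
Fixpoint wp (N : nat) (c : prog) (Q : store R -> Prop) (st : store R) : Prop :=
  match c with
  | PSkip => Q st
  | PNat x e => Q (set_nvar st x (neval st e))
  | PNatA a xs e => Q (set_narr st a (address st xs) (neval st e))
  | PReal a xs E =>
      xbnd N st E /\ Q (set_rarr st a (address st xs) (xeval st E))
  | PSeq c1 c2 => wp N c1 (wp N c2 Q) st
  | PIf E1 E2 c1 c2 =>
      [/\ xbnd N st E1, xbnd N st E2 &
          if xeval st E1 <= xeval st E2 then wp N c1 Q st else wp N c2 Q st]
  | PWhile e1 e2 c1 => wloop (wp N c1) e1 e2 Q N st
  end.

Lemma wp_mono N c Q Q' st :
  (forall st', Q st' -> Q' st') -> wp N c Q st -> wp N c Q' st.
Proof.
elim: c Q Q' st => [|x e|a xs e|a xs E|c1 IH1 c2 IH2|E1 E2 c1 IH1 c2 IH2|e1 e2 c IH]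
  Q Q' st QQ' /=.
- exact: QQ'.
- exact: QQ'.
- exact: QQ'.
- by case=> ? /QQ'.
- by apply: IH1 => st'; apply: IH2.
- by case=> ? ?; case: ifP => _ H; split=> //; [apply: IH1 H | apply: IH2 H].
- elim: {2 4}N st => [|f IHf] st /=; case: ifP => // _; try exact: QQ'.
  by apply: IH => st'; exact: IHf.
Qed.

Lemma wp_while N e1 e2 c (Inv : nat -> store R -> Prop) Q st :
  Inv 0%N st ->
  (forall t st', Inv t st' -> (neval st' e1 <= neval st' e2)%N ->
     (t < N)%N /\ wp N c (Inv t.+1) st') ->
  (forall t st', Inv t st' -> (t <= N)%N -> (neval st' e1 <= neval st' e2)%N = false ->
     Q st') ->
  wp N (PWhile e1 e2 c) Q st.
Proof.
move=> I0 Istep Iend /=.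
have: Inv (N - N)%N st by rewrite subnn.
have: (N <= N)%N by [].
elim: {1 4 6}N st {I0} => [|f IHf] st fN It /=; case: ifP => b.
- by case: (Istep _ _ It b); rewrite subn0 ltnn.
- by apply: Iend It _ _ => //; lia.
- case: (Istep _ _ It b) => _; apply: wp_mono => st'.
  have -> : (N - f.+1).+1 = (N - f)%N by lia.
  by apply: IHf; lia.
- by apply: Iend It _ _ => //; lia.
Qed.

(** ** Frame property *)

Fixpoint pmodn (c : prog) : seq nat :=
  match c with
  | PNat x _ => [:: x]
  | PSeq c1 c2 | PIf _ _ c1 c2 => pmodn c1 ++ pmodn c2
  | PWhile _ _ c1 => pmodn c1
  | _ => [::]
  end.
Fixpoint pmoda (c : prog) : seq nat :=
  match c with
  | PNatA a _ _ => [:: a]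
  | PSeq c1 c2 | PIf _ _ c1 c2 => pmoda c1 ++ pmoda c2
  | PWhile _ _ c1 => pmoda c1
  | _ => [::]
  end.
Fixpoint pmodr (c : prog) : seq nat :=
  match c with
  | PReal a _ _ => [:: a]
  | PSeq c1 c2 | PIf _ _ c1 c2 => pmodr c1 ++ pmodr c2
  | PWhile _ _ c1 => pmodr c1
  | _ => [::]
  end.

Definition same (xs bs rs : seq nat) st st' : Prop :=
  [/\ forall x, x \notin xs -> nvar st' x = nvar st x,
      forall a, a \notin bs -> narr st' a =1 narr st a
    & forall a, a \notin rs -> rarr st' a =1 rarr st a].

Lemma same_refl xs bs rs st : same xs bs rs st st.
Proof. by []. Qed.

Lemma same_trans xs bs rs st1 st2 st3 :
  same xs bs rs st1 st2 -> same xs bs rs st2 st3 -> same xs bs rs st1 st3.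
Proof.
move=> [n1 a1 r1] [n2 a2 r2]; split=> x xP.
- by rewrite n2 ?n1.
- by move=> l; rewrite a2 ?a1.
- by move=> l; rewrite r2 ?r1.
Qed.

Lemma same_sub xs bs rs xs' bs' rs' st st' :
  {subset xs <= xs'} -> {subset bs <= bs'} -> {subset rs <= rs'} ->
  same xs bs rs st st' -> same xs' bs' rs' st st'.
Proof.
move=> sx sb sr [n1 a1 r1]; split=> x xP.
- by apply: n1; apply: contra xP; exact: sx.
- by apply: a1; apply: contra xP; exact: sb.
- by apply: r1; apply: contra xP; exact: sr.
Qed.

Lemma same_incl xs bs rs xs' bs' rs' st st' :
  [&& all (mem xs') xs, all (mem bs') bs & all (mem rs') rs] ->
  same xs bs rs st st' -> same xs' bs' rs' st st'.
Proof. by case/and3P=> /allP h1 /allP h2 /allP h3; apply: same_sub. Qed.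

Lemma same_comp xs bs rs xs1 bs1 rs1 xs2 bs2 rs2 st1 st2 st3 :
  same xs1 bs1 rs1 st1 st2 -> same xs2 bs2 rs2 st2 st3 ->
  [&& all (mem xs) (xs1 ++ xs2), all (mem bs) (bs1 ++ bs2) & all (mem rs) (rs1 ++ rs2)] ->
  same xs bs rs st1 st3.
Proof.
rewrite !all_cat => s1 s2 /and3P[/andP[x1 x2] /andP[b1 b2] /andP[r1 r2]].
by apply: same_trans (same_incl _ s1) (same_incl _ s2); apply/and3P.
Qed.

Lemma wp_frame N c Q st : wp N c Q st ->
  wp N c (fun st' => Q st' /\ same (pmodn c) (pmoda c) (pmodr c) st st') st.
Proof.
elim: c Q st => [|x e|a xs e|a xs E|c1 IH1 c2 IH2|E1 E2 c1 IH1 c2 IH2|e1 e2 c IH]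
  Q st /=.
- by [].
- move=> q; split=> //; split=> //= y; rewrite inE => /negPf yx.
  by rewrite yx.
- by move=> q; split=> //; split=> //= b; rewrite inE => /negPf yx l; rewrite yx.
- case=> bE q; split=> //; split=> //; split=> //= b.
  by rewrite inE => /negPf yx l; rewrite yx.
- move=> H; apply: wp_mono (IH1 _ _ H) => st1 [/IH2 H2 s1].
  apply: wp_mono H2 => st2 [q s2]; split=> //.
  apply: same_trans (same_sub _ _ _ s1) (same_sub _ _ _ s2) => z zP;
    by rewrite mem_cat zP ?orbT.
- case=> b1 b2 H; split=> //; move: H; case: ifP => _ H.
    apply: wp_mono (IH1 _ _ H) => st1 [q s1]; split=> //.
    by apply: (same_sub _ _ _ s1) => z zP; rewrite mem_cat zP.
  apply: wp_mono (IH2 _ _ H) => st1 [q s1]; split=> //.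
  by apply: (same_sub _ _ _ s1) => z zP; rewrite mem_cat zP orbT.
- move: (same_refl (pmodn c) (pmoda c) (pmodr c) st).
  move: {1 4}st => s0.
  elim: {2 4}N st => [|f IHf] st ss /=; case: ifP => // _ H.
  apply: wp_mono (IH _ _ H) => st1 [L s1].
  by apply: IHf => //; apply: same_trans ss s1.
Qed.

Lemma wp_conj N c Q Q' st : 
  wp N c Q st ->
  (forall st', same (pmodn c) (pmoda c) (pmodr c) st st' -> Q st' -> Q' st') ->
  wp N c Q' st.
Proof.
move=> /wp_frame H QQ'; apply: wp_mono H => st' [q s]; exact: QQ'.
Qed.

Lemma wp_for N v b c (B : nat) (Inv : nat -> store R -> Prop) Q st :
  v \notin pmodn c -> (B <= N)%N ->
  (forall st', same (v :: pmodn c) (pmoda c) (pmodr c) st st' -> neval st' b = B) ->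
  Inv 0%N (set_nvar st v 0) ->
  (forall p st', (p < B)%N -> nvar st' v = p ->
     same (v :: pmodn c) (pmoda c) (pmodr c) st st' ->
     Inv p st' -> wp N c (fun st'' => Inv p.+1 (set_nvar st'' v p.+1)) st') ->
  (forall st', same (v :: pmodn c) (pmoda c) (pmodr c) st st' ->
     nvar st' v = B -> Inv B st' -> Q st') ->
  wp N (PFor v b c) Q st.
Proof.
move=> vc BN bB I0 Istep Iend.
rewrite /PFor; change (wp N (PWhile (NAdd (NVar v) (NCst 1)) b
  (PSeq c (PNat v (NAdd (NVar v) (NCst 1))))) Q (set_nvar st v 0)).
pose J t st' := [/\ (t <= B)%N, nvar st' v = t,
   same (v :: pmodn c) (pmoda c) (pmodr c) st st' & Inv t st'].
apply: (wp_while (Inv := J)).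
- split=> //=; first by rewrite eqxx.
  by split=> //= y; rewrite inE => /norP[/negPf -> _].
- move=> t st' [tB tv ss It] /=; rewrite tv (bB _ ss) addn1 => tB'.
  split; first exact: leq_trans BN.
  have:= Istep _ _ tB' tv ss It => /wp_frame.
  apply: wp_mono => st'' [It' [s1 s2 s3]]; split=> //=.
  + by rewrite eqxx s1 // tv addn1.
  + apply: same_trans ss _; split=> [y|a|a] //=; last 2 first.
    * exact: s2.
    * exact: s3.
    by rewrite inE => /norP[/negPf -> yc]; exact: s1.
  + by rewrite s1 // tv addn1.
- move=> t st' [tB tv ss It] tN; rewrite /= tv (bB _ ss) addn1 => Bt.
  have tE : t = B by lia.
  by apply: Iend => //; rewrite -?tE.
Qed.

End Semantics.

(** ** Compilation *)
Section Compile.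
Variable (R : realType) (T : nat).
Implicit Types (st : store R) (E : xexp) (d : nat).

(** The program mentions locations below [T] only; those from [T] on are left to
  the temporaries of the compiler. *)
Fixpoint nok (e : nexp) : bool :=
  match e with
  | NCst _ => true
  | NVar x => (x < T)%N
  | NGet a xs => (a < T)%N && all (fun x => x < T)%N xs
  | NAdd e1 e2 | NSub e1 e2 => nok e1 && nok e2
  end.

Fixpoint xok (E : xexp) : bool :=
  match E with
  | XNat e => nok e
  | XGet a es => (a < T)%N && all nok es
  | XBin _ E1 E2 => xok E1 && xok E2
  | XExp E1 | XLn E1 => xok E1
  | XIfN e1 e2 E1 E2 => [&& nok e1, nok e2, xok E1 & xok E2]
  | XIfR E1 E2 E3 E4 => [&& xok E1, xok E2, xok E3 & xok E4]
  | XBig _ E0 v b E1 => [&& xok E0, (v < T)%N, nok b & xok E1]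
  end.

Fixpoint pok (c : prog) : bool :=
  match c with
  | PSkip => true
  | PNat x e => (x < T)%N && nok e
  | PNatA a xs e => [&& (a < T)%N, all (fun x => x < T)%N xs & nok e]
  | PReal a xs E => [&& (a < T)%N, all (fun x => x < T)%N xs & xok E]
  | PSeq c1 c2 => pok c1 && pok c2
  | PIf E1 E2 c1 c2 => [&& xok E1, xok E2, pok c1 & pok c2]
  | PWhile e1 e2 c1 => [&& nok e1, nok e2 & pok c1]
  end.

Definition agree d st st' : Prop :=
  [/\ forall x, (x < T + d)%N -> nvar st' x = nvar st x,
      forall a, (a < T + d)%N -> narr st' a =1 narr st a
    & forall a, (a < T + d)%N -> rarr st' a =1 rarr st a].

Lemma agree_refl d st : agree d st st.
Proof. by []. Qed.

Lemma agree_trans d st1 st2 st3 :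
  agree d st1 st2 -> agree d st2 st3 -> agree d st1 st3.
Proof.
move=> [n1 a1 r1] [n2 a2 r2]; split=> x xP.
- by rewrite n2 ?n1.
- by move=> l; rewrite a2 ?a1.
- by move=> l; rewrite r2 ?r1.
Qed.

Lemma agree_le d d' st st' : (d <= d')%N -> agree d' st st' -> agree d st st'.
Proof.
move=> dd [n1 a1 r1]; split=> x xP; [apply: n1 | apply: a1 | apply: r1];
  by apply: leq_trans xP _; rewrite leq_add2l.
Qed.

Lemma agree_set_nvar d st st' v p :
  agree d st st' -> agree d (set_nvar st v p) (set_nvar st' v p).
Proof.
by move=> [n1 a1 r1]; split=> //= x xP; case: ifP => // _; exact: n1.
Qed.

Lemma agree_tmpn d d' st p : (d <= d')%N -> agree d st (set_nvar st (T + d') p).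
Proof. by move=> dd; split=> //= x xP; case: eqP => // xE; lia. Qed.

Lemma agree_tmpr d d' st p : (d <= d')%N -> agree d st (set_rarr st (T + d') [::] p).
Proof. by move=> dd; split=> //= x xP l; case: eqP => //= xE; lia. Qed.

Lemma address_agree st st' xs :
  agree 0 st st' -> all (fun x => x < T)%N xs -> address st' xs = address st xs.
Proof.
move=> [n1 _ _] /allP xsT; apply/eq_in_map => x /xsT xT.
by apply: n1; rewrite addn0.
Qed.

Lemma neval_agree st st' e : agree 0 st st' -> nok e -> neval st' e = neval st e.
Proof.
move=> ag; have [n1 a1 r1] := ag; elim: e => //= [x xT|a xs|e1 IH1 e2 IH2|e1 IH1 e2 IH2].
- by apply: n1; rewrite addn0.
- by case/andP=> aT xsT; rewrite (address_agree ag) // a1 // addn0.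
- by case/andP => /IH1-> /IH2->.
- by case/andP => /IH1-> /IH2->.
Qed.

Lemma map_neval_agree st st' es :
  agree 0 st st' -> all nok es -> map (neval st') es = map (neval st) es.
Proof.
move=> ag; elim: es => //= e es IH /andP[eT esT].
by rewrite IH // (neval_agree ag).
Qed.

Lemma xeval_agree st st' E : agree 0 st st' -> xok E -> xeval st' E = xeval st E.
Proof.
elim: E st st' => [e|a es|o E1 IH1 E2 IH2|E1 IH1|E1 IH1|e1 e2 E1 IH1 E2 IH2
  |E1 IH1 E2 IH2 E3 IH3 E4 IH4|o E0 IH0 v b E1 IH1] st st' ag /=.
- by move=> eT; rewrite (neval_agree ag).
- case/andP=> aT esT; rewrite (map_neval_agree ag) //.
  by case: ag => _ _ -> //; rewrite addn0.
- by case/andP=> h1 h2; rewrite (IH1 _ _ ag) // (IH2 _ _ ag).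
- by move=> h1; rewrite (IH1 _ _ ag).
- by move=> h1; rewrite (IH1 _ _ ag).
- case/and4P=> h1 h2 h3 h4.
  by rewrite !(neval_agree ag) // (IH1 _ _ ag) // (IH2 _ _ ag).
- case/and4P=> h1 h2 h3 h4.
  by rewrite (IH1 _ _ ag) // (IH2 _ _ ag) // (IH3 _ _ ag) // (IH4 _ _ ag).
- case/and4P=> h1 h2 h3 h4; rewrite (neval_agree ag) // (IH0 _ _ ag) //.
  by apply: eq_bigr => p _; apply: IH1 => //; exact: agree_set_nvar.
Qed.

Lemma xbnd_agree N st st' E : agree 0 st st' -> xok E -> xbnd N st E -> xbnd N st' E.
Proof.
elim: E st st' => [e|a es|o E1 IH1 E2 IH2|E1 IH1|E1 IH1|e1 e2 E1 IH1 E2 IH2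
  |E1 IH1 E2 IH2 E3 IH3 E4 IH4|o E0 IH0 v b E1 IH1] st st' ag //=.
- by case/andP=> h1 h2 [b1 b2]; split; [exact: (IH1 st) | exact: (IH2 st)].
- exact: IH1.
- exact: IH1.
- by case/and4P=> h1 h2 h3 h4 [b1 b2]; split; [exact: (IH1 st) | exact: (IH2 st)].
- case/and4P=> h1 h2 h3 h4 [b1 b2 b3 b4].
  by split; [exact: (IH1 st)|exact: (IH2 st)|exact: (IH3 st)|exact: (IH4 st)].
- case/and4P=> h1 h2 h3 h4 [b0 bN b1].
  split; [exact: (IH0 st)|by rewrite (neval_agree ag)|].
  move=> p; rewrite (neval_agree ag) // => pb.
  by apply: (IH1 (set_nvar st v p)) => //; [exact: agree_set_nvar|exact: b1].
Qed.

Fixpoint setaddr (x : nat) (es : seq nexp) : com :=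
  if es is e :: es' then CSeq (CSetVar x e) (setaddr x.+1 es') else CSkip.

Definition opcom (o : binop) (dst : nat) (a b : rexp) : com :=
  match o with
  | OAdd => CSetReal dst [::] (RAdd a b)
  | OSub => CSetReal dst [::] (RSub a b)
  | OMul => CSetReal dst [::] (RMul a b)
  | ODiv => CSetReal dst [::] (RDiv a b)
  | OMin => CIf (BRealLe a b) (CSetReal dst [::] a) (CSetReal dst [::] b)
  end.

(** [xcomp d E] leaves the value of [E] in the real cell [T + d] and changes
  nothing below [T + d]: the depth [d] plays the role of a stack pointer.  The
  scalar [T + d] keeps the previous value of the variable bound by an iteration,
  which is restored at the end. *)
Fixpoint xcomp (d : nat) (E : xexp) : com :=
  let res := RGet (T + d) [::] in
  let aux := RGet (T + d.+1) [::] in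
  match E with
  | XNat e => CSetReal (T + d) [::] (RNat e)
  | XGet a es =>
      CSeq (setaddr (T + d) es)
           (CSetReal (T + d) [::] (RGet a (iota (T + d) (size es))))
  | XBin o E1 E2 =>
      CSeq (xcomp d E1) (CSeq (xcomp d.+1 E2) (opcom o (T + d) res aux))
  | XExp E1 => CSeq (xcomp d E1) (CSetReal (T + d) [::] (RExp res))
  | XLn E1 => CSeq (xcomp d E1) (CSetReal (T + d) [::] (RLn res))
  | XIfN e1 e2 E1 E2 => CIf (BNatLe e1 e2) (xcomp d E1) (xcomp d E2)
  | XIfR E1 E2 E3 E4 =>
      CSeq (xcomp d E1) (CSeq (xcomp d.+1 E2)
        (CIf (BRealLe res aux) (xcomp d E3) (xcomp d E4)))
  | XBig o E0 v b E1 =>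
      CSeq (xcomp d E0) (CSeq (CSetVar (T + d) (NVar v)) (CSeq (CSetVar v b)
        (CSeq (CWhile (BNatLe (NCst 1) (NVar v))
                 (CSeq (CSetVar v (NSub (NVar v) (NCst 1)))
                    (CSeq (xcomp d.+1 E1) (opcom o (T + d) aux res))))
              (CSetVar v (NVar (T + d))))))
  end.

Fixpoint prog_com (c : prog) : com :=
  match c with
  | PSkip => CSkip
  | PNat x e => CSetVar x e
  | PNatA a xs e => CSetNat a xs e
  | PReal a xs E => CSeq (xcomp 0 E) (CSetReal a xs (RGet (T + 0) [::]))
  | PSeq c1 c2 => CSeq (prog_com c1) (prog_com c2)
  | PIf E1 E2 c1 c2 =>
      CSeq (xcomp 0 E1) (CSeq (xcomp 1 E2)
        (CIf (BRealLe (RGet (T + 0) [::]) (RGet (T + 1) [::])) (prog_com c1) (prog_com c2)))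
  | PWhile e1 e2 c1 => CWhile (BNatLe e1 e2) (prog_com c1)
  end.

Definition esize (es : seq nexp) : nat := sumn (map (fun e => (ncost e).+1) es).

Fixpoint xtime (N : nat) (E : xexp) : nat :=
  match E with
  | XNat e => ncost e + 2
  | XGet a es => esize es + 3
  | XBin _ E1 E2 => xtime N E1 + xtime N E2 + 8
  | XExp E1 | XLn E1 => xtime N E1 + 4
  | XIfN e1 e2 E1 E2 => ncost e1 + ncost e2 + 1 + xtime N E1 + xtime N E2
  | XIfR E1 E2 E3 E4 => xtime N E1 + xtime N E2 + 3 + xtime N E3 + xtime N E4
  | XBig _ E0 v b E1 => xtime N E0 + ncost b + 20 + N * (xtime N E1 + 20)
  end.

Fixpoint ptime (N : nat) (c : prog) : nat :=
  match c with
  | PSkip => 1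
  | PNat x e | PNatA x _ e => (ncost e).+1
  | PReal a xs E => xtime N E + 2
  | PSeq c1 c2 => ptime N c1 + ptime N c2
  | PIf E1 E2 c1 c2 => xtime N E1 + xtime N E2 + 3 + ptime N c1 + ptime N c2
  | PWhile e1 e2 c1 =>
      N * (ncost e1 + ncost e2 + 1 + ptime N c1) + ncost e1 + ncost e2 + 1
  end.

Lemma exec_setaddr st x es : (T <= x)%N -> all nok es ->
  exists t st', [/\ exec (setaddr x es) st t st', (t <= esize es + 1)%N,
    forall y, (y < x)%N -> nvar st' y = nvar st y,
    narr st' = narr st /\ rarr st' = rarr st &
    address st' (iota x (size es)) = map (neval st) es].
Proof.
elim: es x st => [|e es IH] x st xT /=.
  by move=> _; exists 1%N, st; split=> //; constructor.
case/andP=> eT esT.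
have [|//|t [st' [ex tb ny [na nr] ad]]] := IH x.+1 (set_nvar st x (neval st e)).
  by lia.
exists ((ncost e).+1 + t)%N, st'; split=> //.
- by econstructor; [constructor | exact: ex].
- by rewrite /esize /= -/(esize es); lia.
- by move=> y yx; rewrite ny /=; [case: eqP => //; lia | lia].
- rewrite ny //= eqxx; congr (_ :: _); rewrite ad.
  apply: map_neval_agree => //; split=> //= y; rewrite addn0 => yT.
  by case: eqP => //; lia.
Qed.

Lemma exec_opcom st o d a b :
  exists2 t, (t <= rcost a + rcost b + rcost a + rcost b + 4)%N &
   exec (opcom o d a b) st t (set_rarr st d [::] (opR o (reval st a) (reval st b))).
Proof.
case: o => /=.
- exists (rcost (RAdd a b)).+1 => /=; first by lia.
  exact: (ExecSetReal d [::] (RAdd a b)).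
- exists (rcost (RSub a b)).+1 => /=; first by lia.
  exact: (ExecSetReal d [::] (RSub a b)).
- exists (rcost (RMul a b)).+1 => /=; first by lia.
  exact: (ExecSetReal d [::] (RMul a b)).
- exists (rcost (RDiv a b)).+1 => /=; first by lia.
  exact: (ExecSetReal d [::] (RDiv a b)).
- case: (leP (reval st a) (reval st b)) => ab.
    exists (bcost (BRealLe a b) + (rcost a).+1)%N => /=; first by lia.
    by constructor; rewrite /= ab; exact: (ExecSetReal d [::] a).
  exists (bcost (BRealLe a b) + (rcost b).+1)%N => /=; first by lia.
  by constructor; rewrite /= leNgt ab; exact: (ExecSetReal d [::] b).
Qed.

Lemma exec_xcomp N st d E : xok E -> xbnd N st E ->
  exists t st', [/\ exec (xcomp d E) st t st', (t <= xtime N E)%N,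
    agree d st st' & rarr st' (T + d)%N [::] = xeval st E].
Proof.
elim: E st d => [e|a es|o E1 IH1 E2 IH2|E1 IH1|E1 IH1|e1 e2 E1 IH1 E2 IH2
  |E1 IH1 E2 IH2 E3 IH3 E4 IH4|o E0 IH0 v b E1 IH1] st d /=.
- move=> eT _; exists (rcost (RNat e)).+1, (set_rarr st (T + d) [::] (neval st e)%:R).
  split=> /=; rewrite ?eqxx ?addn2 //.
    exact: (ExecSetReal (T + d) [::] (RNat e)).
  exact: agree_tmpr.
- case/andP=> aT esT _.
  have [|t [st' [ex tb ny [na nr] ad]]] := exec_setaddr st (x := (T + d)%N) _ esT.
    by lia.
  exists (t + 2)%N, (set_rarr st' (T + d) [::] (rarr st' a (address st' (iota (T + d) (size es))))).
  split; first by econstructor; [exact: ex | exact: (ExecSetReal _ [::] (RGet _ _))].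
  + by lia.
  + apply: (agree_trans (st2 := st')); last exact: agree_tmpr.
    by split=> // x xT; rewrite ?na ?nr.
  + by rewrite /= !eqxx /= nr ad.
- case/andP=> h1 h2 [b1 b2].
  have [t1 [st1 [ex1 tb1 ag1 v1]]] := IH1 st d h1 b1.
  have ag01 : agree 0 st st1 by apply: agree_le ag1.
  have [t2 [st2 [ex2 tb2 ag2 v2]]] := IH2 st1 d.+1 h2 (xbnd_agree ag01 h2 b2).
  have [t3 tb3 ex3] := exec_opcom st2 o (T + d) (RGet (T + d) [::]) (RGet (T + d.+1) [::]).
  eexists (t1 + (t2 + t3))%N, _; split.
  + by econstructor; [exact: ex1 | econstructor; [exact: ex2 | exact: ex3]].
  + by move: tb3 => /=; lia.
  + apply: (agree_trans ag1); apply: (agree_trans (agree_le _ ag2)) => //.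
    exact: agree_tmpr.
  + rewrite /= !eqxx /= v2 (xeval_agree ag01) //; case: ag2 => _ _ -> //; last by lia.
    by rewrite v1.
- move=> h1 b1; have [t1 [st1 [ex1 tb1 ag1 v1]]] := IH1 st d h1 b1.
  eexists (t1 + (rcost (RExp (RGet (T + d) [::]))).+1)%N, _; split.
  + by econstructor; [exact: ex1 | exact: (ExecSetReal _ [::] (RExp _))].
  + by rewrite /=; lia.
  + by apply: (agree_trans ag1); exact: agree_tmpr.
  + by rewrite /= !eqxx /= v1.
- move=> h1 b1; have [t1 [st1 [ex1 tb1 ag1 v1]]] := IH1 st d h1 b1.
  eexists (t1 + (rcost (RLn (RGet (T + d) [::]))).+1)%N, _; split.
  + by econstructor; [exact: ex1 | exact: (ExecSetReal _ [::] (RLn _))].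
  + by rewrite /=; lia.
  + by apply: (agree_trans ag1); exact: agree_tmpr.
  + by rewrite /= !eqxx /= v1.
- case/and4P=> h1 h2 h3 h4 [b1 b2]; case: ifP => cc.
    have [t1 [st1 [ex1 tb1 ag1 v1]]] := IH1 st d h3 b1.
    exists (bcost (BNatLe e1 e2) + t1)%N, st1; split=> //=; last by lia.
    by apply: (ExecIf (b := BNatLe e1 e2)); rewrite /= cc.
  have [t1 [st1 [ex1 tb1 ag1 v1]]] := IH2 st d h4 b2.
  exists (bcost (BNatLe e1 e2) + t1)%N, st1; split=> //=; last by lia.
  by apply: (ExecIf (b := BNatLe e1 e2)); rewrite /= cc.
- case/and4P=> h1 h2 h3 h4 [b1 b2 b3 b4].
  have [t1 [st1 [ex1 tb1 ag1 v1]]] := IH1 st d h1 b1.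
  have ag01 : agree 0 st st1 by apply: agree_le ag1.
  have [t2 [st2 [ex2 tb2 ag2 v2]]] := IH2 st1 d.+1 h2 (xbnd_agree ag01 h2 b2).
  have ag12 : agree d st1 st2 by apply: agree_le ag2.
  have ag02 : agree 0 st st2.
    by apply: (agree_trans ag01); apply: agree_le ag2.
  pose bb := BRealLe (RGet (T + d) [::]) (RGet (T + d.+1) [::]).
  have bbE : beval st2 bb = (xeval st E1 <= xeval st E2).
    rewrite /= v2 (xeval_agree ag01) //; case: ag2 => _ _ -> //; last by lia.
    by rewrite v1.
  case: ifP => cc.
    have [t3 [st3 [ex3 tb3 ag3 v3]]] := IH3 st2 d h3 (xbnd_agree ag02 h3 b3).
    exists (t1 + (t2 + (bcost bb + t3)))%N, st3; split.
    + econstructor; first exact: ex1; econstructor; first exact: ex2.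
      by apply: ExecIf; rewrite bbE cc.
    + by rewrite /=; lia.
    + by apply: (agree_trans ag1); apply: (agree_trans ag12).
    + by rewrite v3 (xeval_agree ag02).
  have [t3 [st3 [ex3 tb3 ag3 v3]]] := IH4 st2 d h4 (xbnd_agree ag02 h4 b4).
  exists (t1 + (t2 + (bcost bb + t3)))%N, st3; split.
  + econstructor; first exact: ex1; econstructor; first exact: ex2.
    by apply: ExecIf; rewrite bbE cc.
  + by rewrite /=; lia.
  + by apply: (agree_trans ag1); apply: (agree_trans ag12).
  + by rewrite v3 (xeval_agree ag02).
- case/and4P=> h0 hv hb h1 [b0 bN b1].
  have [t0 [st0 [ex0 tb0 ag0 v0]]] := IH0 st d h0 b0.
  have ag00 : agree 0 st st0 by apply: agree_le ag0.
  set B := neval st b in bN b1 *.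
  pose F p := xeval (set_nvar st v p) E1.
  pose idx := xeval st E0.
  pose st1 := set_nvar st0 (T + d) (nvar st0 v).
  have ag01 : agree 0 st st1.
    by apply: agree_trans ag00 _; exact: agree_tmpn.
  set W := CWhile _ _.
  (* the loop runs downwards, so that the accumulator is a right fold *)
  have loop p st2 : (p <= B)%N -> nvar st2 v = p -> 
      nvar st2 (T + d)%N = nvar st v ->
      agree d st (set_nvar (set_nvar st2 v (nvar st v)) (T + d) (nvar st (T + d)%N)) ->
      rarr st2 (T + d)%N [::] = \big[opR o/idx]_(p <= q < B) F q ->
      exists t st3, [/\ exec W st2 t st3, (t <= p * (xtime N E1 + 20) + 3)%N,
        nvar st3 (T + d)%N = nvar st v,
        agree d st (set_nvar (set_nvar st3 v (nvar st v)) (T + d) (nvar st (T + d)%N)) &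
        rarr st3 (T + d)%N [::] = \big[opR o/idx]_(0 <= q < B) F q].
    elim: p st2 => [|p IHp] st2 pB vp vs ag2 acc.
      exists (bcost (BNatLe (NCst 1) (NVar v))), st2; split=> //.
      by apply: ExecWhileStop; rewrite /= vp.
    pose st3 := set_nvar st2 v p.
    have ag3 : agree 0 (set_nvar st v p) st3.
      have [n2 a2 r2] := agree_le (leq0n d) ag2; split=> //= x xT.
      have := n2 x xT; rewrite /=; case: eqP => [|_]; first by lia.
      by case: eqP.
    have [t4 [st4 [ex4 tb4 ag4 v4]]] := IH1 st3 d.+1 h1 (xbnd_agree ag3 h1 (b1 p pB)).
    have [t5 tb5 ex5] := exec_opcom st4 o (T + d) (RGet (T + d.+1) [::]) (RGet (T + d) [::]).
    set st5 := set_rarr _ _ _ _ in ex5.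
    have [n4 a4 r4] := ag4.
    have [|||||t6 [st6 [ex6 tb6 ns6 ag6 r6]]] := IHp st5.
    + by lia.
    + by rewrite /st5 /= n4 /= ?eqxx //; lia.
    + by rewrite /st5 /= n4 /= ?vs; [case: eqP => //; lia | lia].
    + have [n2 a2 r2] := ag2; split=> /= x xT.
      * have := n2 x xT; rewrite /= n4 /=; last by lia.
        by do 2! case: eqP => //.
      * by move=> l; rewrite a4 /=; [exact: a2 | lia].
      * move=> l; case: eqP => [|_] /=; first by lia.
        by rewrite r4 /=; [exact: r2 | lia].
    + rewrite /st5 /= !eqxx /= v4 r4 /=; last by lia.
      rewrite acc (big_ltn pB) (xeval_agree ag3) //.
    exists (bcost (BNatLe (NCst 1) (NVar v)) + (4 + (t4 + t5)) + t6)%N, st6; split=> //.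
      apply: ExecWhileStep; [by rewrite /= vp | | exact: ex6].
      apply: (ExecSeq (st1 := st3)).
        have := ExecSetVar v (NSub (NVar v) (NCst 1)) st2.
        by rewrite /= vp subn1.
      by econstructor; [exact: ex4 | exact: ex5].
    by move: tb5 => /=; lia.
  pose st2 := set_nvar st1 v B.
  have [//|||||t3 [st3 [ex3 tb3 ns3 ag3 r3]]] := loop B st2.
  + by rewrite /=  eqxx.
  + rewrite /= eqxx; case: eqP => [|_]; first by lia.
    by case: ag00 => -> //; rewrite addn0.
  + have [n0 a0 r0] := ag0; split=> //= x xT.
    case: eqP => [|_]; first by lia.
    by case: eqP => [->|_] //; rewrite n0.
  + by rewrite /= v0 big_geq.
  exists (t0 + (2 + ((ncost b).+1 + (t3 + 2))))%N, (set_nvar st3 v (nvar st v)); split.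
  + econstructor; first exact: ex0; econstructor.
      exact: (ExecSetVar (T + d) (NVar v) st0).
    rewrite -/st1; econstructor; first exact: (ExecSetVar v b st1).
    rewrite (neval_agree ag01 hb) -/B -/st2; econstructor; first exact: ex3.
    by rewrite -ns3; exact: (ExecSetVar v (NVar (T + d)) st3).
  + have := leq_mul bN (leqnn (xtime N E1 + 20)%N); lia.
  + have [n3 a3 r3'] := ag3; split=> //= x xT.
    by have := n3 x xT; rewrite /=; case: eqP => [|_]; first by lia.
  + by rewrite /= r3.
Qed.

Lemma agree_set_narr st st' a l m :
  agree 0 st st' -> agree 0 (set_narr st a l m) (set_narr st' a l m).
Proof. by move=> [n1 a1 r1]; split=> //= x xP l'; rewrite a1. Qed.

Lemma agree_set_rarr st st' a l x :
  agree 0 st st' -> agree 0 (set_rarr st a l x) (set_rarr st' a l x).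
Proof. by move=> [n1 a1 r1]; split=> //= y yP l'; rewrite r1. Qed.

(** The correctness of compilation: what is established for the structured
  program holds, up to temporaries, for the machine program, within [ptime N]
  operations. *)
Lemma exec_prog_com N c (Q : store R -> Prop) st st0 :
  pok c -> wp N c Q st -> agree 0 st st0 ->
  exists t st0' st', [/\ exec (prog_com c) st0 t st0', (t <= ptime N c)%N,
    agree 0 st' st0' & Q st'].
Proof.
elim: c Q st st0 => [|x e|a xs e|a xs E|c1 IH1 c2 IH2|E1 E2 c1 IH1 c2 IH2|e1 e2 c IH]
  Q st st0 /=.
- by move=> _ q ag; exists 1%N, st0, st; split=> //; constructor.
- case/andP=> xT eT q ag.
  exists (ncost e).+1, (set_nvar st0 x (neval st0 e)), (set_nvar st x (neval st e)).
  by split=> //; [constructor|rewrite (neval_agree ag) //; exact: agree_set_nvar].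
- case/and3P=> aT xsT eT q ag.
  exists (ncost e).+1, (set_narr st0 a (address st0 xs) (neval st0 e)),
    (set_narr st a (address st xs) (neval st e)).
  split=> //; first by constructor.
  by rewrite (neval_agree ag) // (address_agree ag) //; exact: agree_set_narr.
- case/and3P=> aT xsT eT [b q] ag.
  have [t [st1 [ex tb ag1 v1]]] := exec_xcomp 0 eT (xbnd_agree ag eT b).
  have ag01 := agree_trans ag ag1.
  exists (t + 2)%N, (set_rarr st1 a (address st1 xs) (rarr st1 (T + 0)%N [::])),
    (set_rarr st a (address st xs) (xeval st E)).
  split=> //; last 2 first.
  + by rewrite leq_add2r.
  + rewrite v1 (xeval_agree ag) // (address_agree ag01) //; exact: agree_set_rarr.
  + by econstructor; [exact: ex | exact: (ExecSetReal a xs (RGet (T + 0) [::]))].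
- case/andP=> h1 h2 q ag.
  have [t1 [st1' [st1 [ex1 tb1 ag1 q1]]]] := IH1 _ _ _ h1 q ag.
  have [t2 [st2' [st2 [ex2 tb2 ag2 q2]]]] := IH2 _ _ _ h2 q1 ag1.
  exists (t1 + t2)%N, st2', st2; split=> //; last exact: leq_add.
  by econstructor; [exact: ex1 | exact: ex2].
- case/and4P=> h1 h2 h3 h4 [b1 b2 q] ag.
  have [t1 [st1 [ex1 tb1 ag1 v1]]] := exec_xcomp 0 h1 (xbnd_agree ag h1 b1).
  have ag01 := agree_trans ag ag1.
  have [t2 [st2 [ex2 tb2 ag2 v2]]] := exec_xcomp 1 h2 (xbnd_agree ag01 h2 b2).
  have ag02 : agree 0 st st2 by apply: agree_trans ag01 _; apply: agree_le ag2.
  pose bb := BRealLe (RGet (T + 0) [::]) (RGet (T + 1) [::]).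
  have bbE : beval st2 bb = (xeval st E1 <= xeval st E2).
    rewrite /= v2 (xeval_agree ag01) //; case: ag2 => _ _ -> //; last by lia.
    by rewrite v1 (xeval_agree ag).
  move: q; case: ifP => cc q.
    have [t3 [st3' [st3 [ex3 tb3 ag3 q3]]]] := IH1 _ _ _ h3 q ag02.
    exists (t1 + (t2 + (bcost bb + t3)))%N, st3', st3; split=> //=; last by lia.
    econstructor; first exact: ex1; econstructor; first exact: ex2.
    by apply: ExecIf; rewrite bbE cc.
  have [t3 [st3' [st3 [ex3 tb3 ag3 q3]]]] := IH2 _ _ _ h4 q ag02.
  exists (t1 + (t2 + (bcost bb + t3)))%N, st3', st3; split=> //=; last by lia.
  econstructor; first exact: ex1; econstructor; first exact: ex2.
  by apply: ExecIf; rewrite bbE cc.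
- case/and3P=> h1 h2 h3.
  suff H f : wloop (wp N c) e1 e2 Q f st -> agree 0 st st0 ->
     exists t st0' st', [/\ exec (CWhile (BNatLe e1 e2) (prog_com c)) st0 t st0',
       (t <= f * (ncost e1 + ncost e2 + 1 + ptime N c) + ncost e1 + ncost e2 + 1)%N,
       agree 0 st' st0' & Q st'] by exact: H.
  elim: f st st0 => [|f IHf] st st0 /=; case: ifP => // cc H ag.
  + exists (bcost (BNatLe e1 e2)), st0, st; split=> //=; last by lia.
    by apply: ExecWhileStop; rewrite /= !(neval_agree ag) // cc.
  + have [t1 [st1' [st1 [ex1 tb1 ag1 q1]]]] := IH _ _ _ h3 H ag.
    have [t2 [st2' [st2 [ex2 tb2 ag2 q2]]]] := IHf _ _ q1 ag1.
    exists (bcost (BNatLe e1 e2) + t1 + t2)%N, st2', st2; split=> //=; last first.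
      by rewrite mulSn; lia.
    apply: ExecWhileStep; [|exact: ex1|exact: ex2].
    by rewrite /= !(neval_agree ag) // cc.
  + exists (bcost (BNatLe e1 e2)), st0, st; split=> //=; last by lia.
    by apply: ExecWhileStop; rewrite /= !(neval_agree ag) // cc.
Qed.

End Compile.

(** ** Polynomial growth *)

Definition poly_growth (f : nat -> nat) : Prop :=
  exists c e : nat, forall N, (f N <= c * (1 + N) ^ e)%N.

Lemma poly_growth_cst m : poly_growth (fun=> m).
Proof. by exists m, 0%N => N; rewrite muln1. Qed.

Lemma poly_growth_id : poly_growth id.
Proof. by exists 1%N, 1%N => N; lia. Qed.

Lemma poly_growth_add f g : poly_growth f -> poly_growth g -> poly_growth (fun N => f N + g N)%N.
Proof.
move=> [c1 [e1 h1]] [c2 [e2 h2]]; exists (c1 + c2)%N, (maxn e1 e2) => N.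
rewrite mulnDl; apply: leq_add.
  by apply: leq_trans (h1 N) _; rewrite leq_mul2l leq_pexp2l ?orbT // leq_maxl.
by apply: leq_trans (h2 N) _; rewrite leq_mul2l leq_pexp2l ?orbT // leq_maxr.
Qed.

Lemma poly_growth_mul f g : poly_growth f -> poly_growth g -> poly_growth (fun N => f N * g N)%N.
Proof.
move=> [c1 [e1 h1]] [c2 [e2 h2]]; exists (c1 * c2)%N, (e1 + e2)%N => N.
by rewrite expnD mulnACA; apply: leq_mul.
Qed.

Lemma poly_growth_xtime E : poly_growth (xtime ^~ E).
Proof.
by elim: E => /=; intros; repeat (assumption || apply: poly_growth_add || apply: poly_growth_mul
  || apply: poly_growth_cst || apply: poly_growth_id).
Qed.

Lemma poly_growth_ptime c : poly_growth (ptime ^~ c).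
Proof.
elim: c => /=; intros; repeat (assumption || apply: poly_growth_xtime || apply: poly_growth_add || apply: poly_growth_mul
  || apply: poly_growth_cst || apply: poly_growth_id).
Qed.

(** ** Rules for expressions and array assignments *)
Section Rules.
Variable R : realType.
Implicit Types (st : store R) (Q : store R -> Prop).

Definition xval (N : nat) st (E : xexp) (x : R) : Prop :=
  xbnd N st E /\ xeval st E = x.

Lemma xval_nat N st e : xval N st (XNat e) (neval st e)%:R.
Proof. by []. Qed.

Lemma xval_get N st a es l x :
  map (neval st) es = l -> rarr st a l = x -> xval N st (XGet a es) x.
Proof. by move=> <- <-. Qed.

Lemma xval_bin N st o E1 E2 x y :
  xval N st E1 x -> xval N st E2 y -> xval N st (XBin o E1 E2) (opR o x y).
Proof. by move=> [b1 <-] [b2 <-]. Qed.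

Lemma xval_exp N st E x : xval N st E x -> xval N st (XExp E) (expR x).
Proof. by move=> [b1 <-]. Qed.

Lemma xval_ln N st E x : xval N st E x -> xval N st (XLn E) (ln x).
Proof. by move=> [b1 <-]. Qed.

Lemma xval_ifN N st e1 e2 E1 E2 x y :
  xval N st E1 x -> xval N st E2 y ->
  xval N st (XIfN e1 e2 E1 E2) (if (neval st e1 <= neval st e2)%N then x else y).
Proof. by move=> [b1 <-] [b2 <-]. Qed.

Lemma xval_ifR N st E1 E2 E3 E4 x1 x2 x3 x4 :
  xval N st E1 x1 -> xval N st E2 x2 -> xval N st E3 x3 -> xval N st E4 x4 ->
  xval N st (XIfR E1 E2 E3 E4) (if x1 <= x2 then x3 else x4).
Proof. by move=> [b1 <-] [b2 <-] [b3 <-] [b4 <-]. Qed.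

Lemma xval_big N st o E0 v b E B x0 (F : 'I_B -> R) :
  neval st b = B -> (B <= N)%N -> xval N st E0 x0 ->
  (forall i : 'I_B, xval N (set_nvar st v i) E (F i)) ->
  xval N st (XBig o E0 v b E) (\big[opR o/x0]_(i < B) F i).
Proof.
move=> bB BN [b0 e0] FE; split=> /=.
  by rewrite bB; split=> // p pB; case: (FE (Ordinal pB)).
by rewrite bB e0 big_mkord; apply: eq_bigr => i _; case: (FE i).
Qed.

Definition X0 := XNat (NCst 0).
Definition X1 := XNat (NCst 1).
Definition XSum v b E := XBig OAdd X0 v b E.
Definition XProd v b E := XBig OMul X1 v b E.
Definition XIfEq e1 e2 E1 E2 := XIfN e1 e2 (XIfN e2 e1 E1 E2) E2.

Lemma xval_sum N st v b E B (F : 'I_B -> R) :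
  neval st b = B -> (B <= N)%N ->
  (forall i : 'I_B, xval N (set_nvar st v i) E (F i)) ->
  xval N st (XSum v b E) (\sum_(i < B) F i).
Proof. by move=> bB BN; exact: xval_big. Qed.

Lemma xval_prod N st v b E B (F : 'I_B -> R) :
  neval st b = B -> (B <= N)%N ->
  (forall i : 'I_B, xval N (set_nvar st v i) E (F i)) ->
  xval N st (XProd v b E) (\prod_(i < B) F i).
Proof. by move=> bB BN; exact: xval_big. Qed.

Lemma xval_ifeq N st e1 e2 E1 E2 x y :
  xval N st E1 x -> xval N st E2 y ->
  xval N st (XIfEq e1 e2 E1 E2) (if neval st e1 == neval st e2 then x else y).
Proof.
move=> v1 v2; rewrite eqn_leq.
have := xval_ifN e1 e2 (xval_ifN e2 e1 v1 v2) v2.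
by case: (_ <= _)%N.
Qed.

Lemma xval_eq N st E x y : xval N st E x -> x = y -> xval N st E y.
Proof. by move=> ? <-. Qed.

Lemma nvar_ne st v p x : (x == v) = false -> nvar (set_nvar st v p) x = nvar st x.
Proof. by rewrite /= => ->. Qed.

(** Filling an array from an expression that may read the old value of the entry
  being replaced, as the updates of scaling vectors do. *)
Lemma wp_fill1 N st v x B a xs E (addr : nat -> seq nat) f Q :
  (x == v) = false -> nvar st x = B -> (B <= N)%N ->
  (forall i st', nvar st' v = i -> (forall y, y != v -> nvar st' y = nvar st y) ->
     address st' xs = addr i) ->
  injective addr ->
  (forall i st', (i < B)%N -> same [:: v] [::] [:: a] st st' -> nvar st' v = i ->
     rarr st' a (addr i) = rarr st a (addr i) -> xval N st' E (f i)) ->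
  (forall st', same [:: v] [::] [:: a] st st' ->
     (forall i, (i < B)%N -> rarr st' a (addr i) = f i) ->
     (forall l, (forall i, (i < B)%N -> l != addr i) -> rarr st' a l = rarr st a l) ->
     Q st') ->
  wp N (PFor v (NVar x) (PReal a xs E)) Q st.
Proof.
move=> xv xB BN ad adI ev HQ.
pose Inv p st' := (forall i, (i < p)%N -> rarr st' a (addr i) = f i) /\
     (forall l, (forall i, (i < p)%N -> l != addr i) -> rarr st' a l = rarr st a l).
apply: (wp_for (B := B) (Inv := Inv)) => //=.
- by move=> st' [s1 _ _]; rewrite s1 // inE xv.
- move=> p st' pB vp ss [I1 I2].
  have adE : address st' xs = addr p.
    apply: ad => // y yv; case: ss => s1 _ _; apply: s1.
      by rewrite inE yv.
  have [|b e] := ev p st' pB ss vp.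
    by apply: I2 => i ip; rewrite (inj_eq adI) gtn_eqF.
  split=> //; rewrite e adE; split=> [i ip|l lp] /=; rewrite eqxx /=.
    case: eqP => [/adI ->//|ne]; apply: I1.
    have : i != p by apply/eqP => ip'; apply: ne; rewrite ip'.
    by lia.
  rewrite (negPf (lp p _)) //; apply: I2 => i ip; apply: lp; exact: ltnW.
- by move=> st' ss vB [I1 I2]; apply: HQ.
Qed.

Lemma wp_fill2 N st vi vj x y Bx By a E f Q :
  (x == vi) || (x == vj) = false -> (y == vi) || (y == vj) = false ->
  (vi == vj) = false ->
  nvar st x = Bx -> (Bx <= N)%N -> nvar st y = By -> (By <= N)%N ->
  (forall i j st', (i < Bx)%N -> (j < By)%N ->
     same [:: vi; vj] [::] [:: a] st st' -> nvar st' vi = i -> nvar st' vj = j ->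
     rarr st' a [:: i; j] = rarr st a [:: i; j] -> xval N st' E (f i j)) ->
  (forall st', same [:: vi; vj] [::] [:: a] st st' ->
     (forall i j, (i < Bx)%N -> (j < By)%N -> rarr st' a [:: i; j] = f i j) -> Q st') ->
  wp N (PFor vi (NVar x) (PFor vj (NVar y) (PReal a [:: vi; vj] E))) Q st.
Proof.
move=> /norP[xvi xvj] /norP[yvi yvj] vij xB BxN yB ByN ev HQ.
pose Inv p st' := (forall i j, (i < p)%N -> (j < By)%N -> rarr st' a [:: i; j] = f i j) /\
  (forall i j, (p <= i)%N -> rarr st' a [:: i; j] = rarr st a [:: i; j]).
apply: (wp_for (B := Bx) (Inv := Inv)) => //.
- by rewrite /= !inE vij.
- by move=> st' [s1 _ _] /=; rewrite s1 //= !inE !negb_or xvi xvj.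
- move=> p st' pB vp ss [I1 I2]; have [s1 s2 s3] := ss.
  apply: (wp_fill1 (B := By) (addr := fun j => [:: p; j]) (f := f p)).
  + exact: negPf.
  + by rewrite s1 // !inE !negb_or yvi yvj.
  + by [].
  + move=> j st1 vj1 e1; rewrite /address /= vj1.
    by rewrite e1 ?vij // vp.
  + by move=> j1 j2 [].
  + move=> j st1 jB ss1 vj1 r1; have [t1 t2 t3] := ss1.
    apply: ev => //.
    * have ss' : same [:: vi; vj] [::] [:: a] st st'.
        by apply: same_sub ss => z /=; rewrite !inE; lia.
      apply: (same_trans ss'); apply: same_sub ss1 => z //=.
      by rewrite !inE => ->; rewrite orbT.
    * by rewrite t1 // inE vij.
    * by rewrite r1 I2.
  + move=> st1 [t1 t2 t3] r1 r2; split=> [i j|i j] /=.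
      rewrite ltnS leq_eqVlt => /orP[/eqP->|ip] jB; first exact: r1.
      rewrite r2; first exact: I1.
      by move=> j' _; apply/eqP => -[ip' _]; lia.
    move=> ip; rewrite r2; first by rewrite I2 //; exact: ltnW.
    by move=> j' _; apply/eqP => -[ip' _]; lia.
- move=> st' ss vB [I1 I2]; apply: HQ => //.
  by apply: same_sub ss => z /=; rewrite !inE; lia.
Qed.

Definition PArgmax (best v x a : nat)  : prog :=
  PSeq (PNat best (NCst 0))
    (PFor v (NVar x)
       (PIf (XGet a [:: NVar best]) (XGet a [:: NVar v]) (PNat best (NVar v)) PSkip)).

Lemma wp_argmax N st best v x B a Q :
  (x == v) || (x == best) = false -> (best == v) = false ->
  nvar st x = B -> (0 < B)%N -> (B <= N)%N ->
  (forall st' b, same [:: v; best] [::] [::] st st' -> nvar st' best = b ->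
     (b < B)%N -> (forall j, (j < B)%N -> rarr st a [:: j] <= rarr st a [:: b]) -> Q st') ->
  wp N (PArgmax best v x a) Q st.
Proof.
move=> /norP[xv xb] bv xB B0 BN HQ; rewrite /PArgmax.
change (wp N (PFor v (NVar x)
       (PIf (XGet a [:: NVar best]) (XGet a [:: NVar v]) (PNat best (NVar v)) PSkip)) Q
   (set_nvar st best 0)).
pose Inv p st' := (nvar st' best < maxn p 1)%N /\
  (forall j, (j < p)%N -> rarr st a [:: j] <= rarr st a [:: nvar st' best]).
apply: (wp_for (B := B) (Inv := Inv)) => //=.
- by rewrite inE eq_sym bv.
- move=> st' [s1 _ _]; rewrite s1; last by rewrite !inE !negb_or xv.
  by rewrite /= (negPf xb).
- by split=> //=; rewrite bv eqxx.
- move=> p st' pB vp [s1 s2 s3] [I1 I2]; split=> //.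
  rewrite vp !s3 //=.
  case: ifP => cmp; split=> /=; rewrite ?bv ?eqxx ?vp.
  + by lia.
  + move=> j; rewrite ltnS leq_eqVlt => /orP[/eqP->//|jp].
    by apply: le_trans cmp; exact: I2.
  + by move: I1; lia.
  + move=> j; rewrite ltnS leq_eqVlt => /orP[/eqP->//|jp]; last exact: I2.
    by rewrite ltW // ltNge cmp.
- move=> st' [s1 s2 s3] vB [I1 I2]; apply: (HQ _ _ _ erefl).
  + split=> [y|b _|b _]; [|exact: s2|exact: s3].
    rewrite !inE negb_or => /andP[yv yb].
    by rewrite s1 /= ?(negPf yb) // !inE !negb_or yv yb.
  + by move: I1; lia.
  + exact: I2.
Qed.

End Rules.

(** * Expressions for low-rank plus sparse tensors *)

(** Binomial coefficients are obtained as real products of quotients, since the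
  machine does not multiply naturals. *)
Lemma prod_falling (R : realType) (d p : nat) : (p <= d)%N ->
  \prod_(z < p) ((d - z)%:R / (z + 1)%:R) = 'C(d, p)%:R :> R.
Proof.
elim: p => [|p IH] pd; first by rewrite big_ord0 bin0.
rewrite big_ord_recr /= IH; last exact: ltnW.
have p1 : ((p + 1)%:R : R) != 0 by rewrite pnatr_eq0; lia.
apply: (mulIf p1); rewrite -mulrA divfK // -!natrM; congr (_%:R).
by rewrite addn1 mulnC -mul_bin_left mulnC.
Qed.

Section SparseSum.
Variables (R : realType) (r : nat) (I : instance R r).

Lemma sparse_part_pos t : injective (spos I) -> sparse_part I (spos I t) = Defs.sval I t.
Proof.
move=> inj; rewrite /sparse_part (bigD1 t) //= big1 ?addr0 // => t' /andP[/eqP/inj->].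
by rewrite eqxx.
Qed.

Lemma sparse_part_out jj : (forall t, spos I t != jj) -> sparse_part I jj = 0.
Proof. by move=> out; rewrite /sparse_part big_pred0 // => t; exact: negPf. Qed.

(** A function that vanishes where the sparse part does is summed over the listed
  entries; [h 0 = 0] and the absence of repeated positions make both sums agree. *)
Lemma sum_sparse (G : midx (side I) (nmarg I) -> R) (h : R -> R) :
  injective (spos I) -> h 0 = 0 ->
  \sum_(t < spars I) G (spos I t) * h (Defs.sval I t) =
  \sum_jj G jj * h (sparse_part I jj).
Proof.
move=> inj h0.
pose D := [set spos I t | t : 'I_(spars I)].
rewrite [RHS](bigID [in D]) /= [X in _ + X]big1 ?addr0; last first.
  move=> jj jjD; rewrite sparse_part_out ?h0 ?mulr0 // => t.
  by apply: contra jjD => /eqP <-; exact: imset_f.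
rewrite big_imset /=; last by move=> ? ? _ _; exact: inj.
rewrite [RHS](eq_bigl xpredT); last by move=> t; rewrite inE.
by apply: eq_bigr => t _; rewrite sparse_part_pos.
Qed.

End SparseSum.

Section Expressions.
Variables (R : realType) (r : nat).

(** Scalar variables bound in expressions: 20 a coordinate, 21 the value of a
  coordinate, 22 the factors of a power, 23 a rank-one term, 24 a sparse entry,
  25 a list entry, and [40 + l] the exponent of the [l]-th rank-one term. *)
Definition fresh : nat := 40 + r.

(** The low-rank and the sparse part at the multi-index whose [i]-th coordinate is
  the value of [a] when variable 20 holds [i]. *)
Definition RX (a : nexp) : xexp :=
  XSum 23 (NCst r) (XProd 20 (NVar 1) (XGet 1 [:: NVar 20; NVar 23; a])).

Definition SX (a : nexp) : xexp :=
  XSum 24 (NVar 2) (XBin OMul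
    (XProd 20 (NVar 1) (XIfEq (NGet 0 [:: 24; 20]%N) a X1 X0)) (XGet 2 [:: NVar 24])).

(** Real array 5 holds the scaling vectors [d], real cell 6 the inverse temperature
  [th], variable 3 the degree [m], and variables 5 and 6 the indices [i], [j] of
  the marginal entry.  Replacing the [i]-th vector by its [j]-th entry alone turns
  that marginal entry into a sum over all multi-indices. *)
Definition DX (a b : nexp) : xexp :=
  XIfEq a (NVar 5) (XIfEq b (NVar 6) (XGet 5 [:: a; b]) X0) (XGet 5 [:: a; b]).

Fixpoint UX (l : nat) : xexp :=
  if l is l'.+1 then
    XBin OMul (UX l') (XProd 22 (NVar (40 + l')) (XGet 1 [:: NVar 20; NCst l'; NVar 21]))
  else X1.

Definition BODYX : xexp :=
  XProd 20 (NVar 1) (XSum 21 (NVar 0) (XBin OMul (DX (NVar 20) (NVar 21)) (UX r))).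

Definition COEFX (l : nat) (rem : nexp) : xexp :=
  XProd 22 (NVar (40 + l))
    (XBin OMul
      (XBin ODiv (XNat (NSub rem (NVar 22))) (XNat (NAdd (NVar 22) (NCst 1))))
      (XBin ODiv (XBin OSub X0 (XGet 6 [::])) (XNat (NVar 3)))).

(** The multinomial expansion of [(1 - th * R / m) ^ m], by recursion on the number
  of rank-one terms of [R]: the loop variable [40 + l] is the exponent given to
  term [l], [rem] is the power still to be distributed, and the exponent of the
  constant 1 is what remains at the end.  With all exponents fixed the summand is
  a product of functions of one coordinate ([BODYX]), so that its sum over the
  multi-indices is a product of sums. *)
Fixpoint LRX (l : nat) (rem : nexp) : xexp :=
  if l is l'.+1 then
    XSum (40 + l') (NAdd rem (NCst 1))
      (XBin OMul (COEFX l' rem) (LRX l' (NSub rem (NVar (40 + l')))))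
  else BODYX.

Definition BASEX (a : nexp) : xexp :=
  XBin OSub X1 (XBin ODiv (XBin OMul (XGet 6 [::]) (RX a)) (XNat (NVar 3))).

(** The expansion ignores the sparse part; the second sum corrects the entries at
  which that part is non-zero. *)
Definition MARGX : xexp :=
  XBin OAdd (LRX r (NVar 3))
    (XSum 24 (NVar 2)
      (XBin OMul
        (XBin OMul (XProd 20 (NVar 1) (DX (NVar 20) (NGet 0 [:: 24; 20]%N)))
                   (XProd 22 (NVar 3) (BASEX (NGet 0 [:: 24; 20]%N))))
        (XBin OSub (XExp (XBin OSub X0 (XBin OMul (XGet 6 [::]) (XGet 2 [:: NVar 24])))) X1))).

Lemma xok_UX l : (l <= r)%N -> xok fresh (UX l).
Proof.
elim: l => //= l IH lr; rewrite IH /=; last exact: ltnW.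
by rewrite /fresh ltn_add2l lr.
Qed.

Lemma xok_LRX l rem : (l <= r)%N -> nok fresh rem -> xok fresh (LRX l rem).
Proof.
elim: l rem => [|l IH] rem lr remok /=; first by rewrite /BODYX /= xok_UX.
have lf : (40 + l < fresh)%N by rewrite /fresh ltn_add2l.
by rewrite IH /= ?remok ?lf //; exact: ltnW.
Qed.

Variables (I : instance R r) (eps : R) (tape : seq 'I_(nmarg I)).
Implicit Types st : store R.
Local Notation n := (side I).
Local Notation k := (nmarg I).
Local Notation loaded := (loaded I eps tape).

Lemma loaded_set_nvar st v p : (2 < v)%N -> loaded st -> loaded (set_nvar st v p).
Proof.
by case: v => [|[|[|v]]] // _ [h0 [h1 [h2 h]]]; do !split.
Qed.

Lemma loaded_same xs bs rs st st' :
  [&& 0%N \notin xs, 1%N \notin xs & 2%N \notin xs] ->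
  (0%N \notin bs) && (1%N \notin bs) ->
  [&& 0%N \notin rs, 1%N \notin rs, 2%N \notin rs, 3%N \notin rs & 4%N \notin rs] ->
  same xs bs rs st st' -> loaded st -> loaded st'.
Proof.
move=> /and3P[x0 x1 x2] /andP[b0 b1] /and5P[r0 r1 r2 r3 r4] [s1 s2 s3].
move=> [h0 [h1 [h2 [h3 [h4 [h5 [h6 [h7 [h8 h9]]]]]]]]].
rewrite /Defs.loaded !s1 // !s3 // h8 h9; do !split => //.
- by move=> t i; rewrite s2.
- by move=> t tt; rewrite s2 // h4.
- by move=> i j; rewrite s3.
- by move=> i l j; rewrite s3.
- by move=> t; rewrite s3.
Qed.

Lemma xval_RX N st a (jj : midx n k) :
  loaded st -> (r <= N)%N -> (k <= N)%N ->
  (forall (i : 'I_k) l, neval (set_nvar (set_nvar st 23 l) 20 i) a = jj i) ->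
  xval N st (RX a) (low_rank_part I jj).
Proof.
move=> ld rN kN aE; apply: xval_sum => // l; apply: xval_prod => //.
  by case: ld => _ [].
move=> i; apply: xval_get; last by case: ld => [_ [_ [_ [_ [_ [_ [h _]]]]]]]; exact: h.
by rewrite /= -(aE i l).
Qed.

Lemma xval_SX N st a (jj : midx n k) :
  loaded st -> (spars I <= N)%N -> (k <= N)%N ->
  (forall (i : 'I_k) t, neval (set_nvar (set_nvar st 24 t) 20 i) a = jj i) ->
  xval N st (SX a) (sparse_part I jj).
Proof.
move=> ld sN kN aE.
have ld' := ld; case: ld' => [_ [_ [n2 [h3 [_ [_ [_ [h7 _]]]]]]]].
rewrite /sparse_part.
apply: xval_eq.
  apply: (@xval_sum _ _ _ _ _ _ (spars I)); [by []|by []|move=> t].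
  apply: xval_bin; last by apply: xval_get; last exact: h7.
  apply: (@xval_prod _ _ _ _ _ _ k); [by case: ld => _ []|by []|].
  by move=> i; apply: xval_ifeq; exact: xval_nat.
rewrite [RHS]big_mkcond /=; apply: eq_bigr => t _.
case: eqP => [tE|ne].
  rewrite big1 ?mul1r // => i _ /=.
  by have := aE i t => /= ->; rewrite h3 tE eqxx.
suff [i ii] : exists i, spos I t i != jj i.
  rewrite (bigD1 i) //=; have := aE i t => /= ->.
  by rewrite h3 (inj_eq val_inj) (negPf ii) !mul0r.
apply/existsP; rewrite -negb_forall; apply/negP => /forallP al; apply: ne.
by apply/ffunP => i; apply/eqP.
Qed.

Section Marg.
Variables (N : nat) (st0 : store R) (m : nat) (th : R) (i0 : 'I_k) (j0 : 'I_n).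
Variable d : 'I_k -> 'I_n -> R.
Hypotheses (rN : (r <= N)%N) (kN : (k <= N)%N) (nN : (n <= N)%N)
  (sN : (spars I <= N)%N) (mN : (m < N)%N).

Definition marg_env st : Prop :=
  [/\ loaded st, nvar st 3 = m, nvar st 5 = i0 /\ nvar st 6 = j0,
      rarr st 6 [::] = th & forall i j, rarr st 5 [:: val i; val j] = d i j].

Lemma marg_env_set st v p : (6 < v)%N -> marg_env st -> marg_env (set_nvar st v p).
Proof.
move=> v6 [ld h3 [h5 h6] h7 h8].
split=> //; first by apply: loaded_set_nvar => //; lia.
  by rewrite nvar_ne //; lia.
by rewrite !nvar_ne //; lia.
Qed.

Definition masked (i : 'I_k) (j : 'I_n) : R :=
  if i == i0 then (if j == j0 then d i j else 0) else d i j.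

Definition rank_one (l : 'I_r) (jj : midx n k) : R := \prod_i Defs.factor I i l (jj i).

Lemma xval_DX st a b (i : 'I_k) (j : 'I_n) : marg_env st ->
  neval st a = i -> neval st b = j -> xval N st (DX a b) (masked i j).
Proof.
move=> [ld h3 [h5 h6] h7 h8] aE bE; apply: xval_eq.
  apply: xval_ifeq; first apply: xval_ifeq;
    try (by apply: xval_get; [rewrite /= aE bE | exact: h8]); exact: xval_nat.
by rewrite /= aE bE h5 h6 /masked.
Qed.

Lemma xval_UX st l (al : nat -> nat) (i : 'I_k) (j : 'I_n) :
  marg_env st -> (l <= r)%N -> (forall l', (l' < r)%N -> nvar st (40 + l') = al l') ->
  (forall l', (l' < r)%N -> (al l' <= N)%N) ->
  nvar st 20 = i -> nvar st 21 = j ->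
  xval N st (UX l) (\prod_(l' < r | (l' < l)%N) Defs.factor I i l' j ^+ al l').
Proof.
move=> env lr alE alN iE jE; elim: l lr => [|l IH] lr.
  by rewrite big_pred0 //; exact: xval_nat.
apply: xval_eq.
  apply: xval_bin; first by apply: IH; exact: ltnW.
  apply: (@xval_prod _ _ _ _ _ _ (al l)); [exact: alE|exact: alN|].
  move=> z; apply: xval_get; first by rewrite /= iE jE.
  by case: env => [[_ [_ [_ [_ [_ [_ [h _]]]]]]] _ _ _ _]; exact: (h i (Ordinal lr) j).
rewrite /= prodr_const card_ord [RHS](bigD1 (Ordinal lr)) //= mulrC; congr (_ * _).
by apply: eq_bigl => l'; rewrite -val_eqE /=; lia.
Qed.

Lemma xval_BODYX st (al : nat -> nat) :
  marg_env st -> (forall l', (l' < r)%N -> nvar st (40 + l') = al l') ->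
  (forall l', (l' < r)%N -> (al l' <= N)%N) ->
  xval N st BODYX
   (\sum_(jj : midx n k) (\prod_i masked i (jj i)) * \prod_(l < r) rank_one l jj ^+ al l).
Proof.
move=> env alE alN; apply: xval_eq.
  apply: (@xval_prod _ _ _ _ _ _ k); [by case: env => [[_ []]]|by []|].
  move=> i; apply: (@xval_sum _ _ _ _ _ _ n); [by case: env => [[]]|by []|].
  move=> j; apply: xval_bin.
    by apply: (xval_DX (i := i) (j := j)) => //; do 2! apply: marg_env_set => //.
  apply: (xval_UX (al := al) (i := i) (j := j)) => //.
rewrite /= bigA_distr_bigA /=; apply: eq_bigr => jj _; rewrite big_split /=; congr (_ * _).
rewrite exchange_big /=.
under eq_bigl => l do rewrite ltn_ord.
by apply: eq_bigr => l _; rewrite /rank_one prodrXl.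
Qed.

(** The induction is on the binomial theorem: splitting off the last rank-one term
  from the base of the power is one more summation over its exponent. *)
Lemma xval_LRX st l (al : nat -> nat) rem D :
  marg_env st -> (l <= r)%N ->
  (forall l', (l <= l' < r)%N -> nvar st (40 + l') = al l') ->
  (forall l', (l <= l' < r)%N -> (al l' <= N)%N) ->
  (forall st', (forall x, (x == 3) || (40 + l <= x)%N -> nvar st' x = nvar st x) ->
      neval st' rem = D) -> (D < N)%N ->
  xval N st (LRX l rem)
   (\sum_(jj : midx n k) ((\prod_i masked i (jj i)) * \prod_(l' < r | (l <= l')%N) rank_one l' jj ^+ al l')
      * (1 + \sum_(l' < r | (l' < l)%N) (- th / m%:R) * rank_one l' jj) ^+ D).
Proof.
elim: l st al rem D => [|l IH] st al rem D env lr alE alN remE DN.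
  apply: xval_eq; first by apply: (xval_BODYX (al := al)) => // l' lr; first [exact: alE | exact: alN].
  by apply: eq_bigr => jj _; rewrite [X in 1 + X]big_pred0 // addr0 expr1n mulr1.
pose Ol := Ordinal lr.
pose al' p := fun l' => if l' == l then p else al l'.
apply: xval_eq.
  apply: (@xval_sum _ _ _ _ _ _ (D + 1)).
  - by rewrite /= remE.
  - by lia.
  move=> p; apply: xval_bin.
    apply: (@xval_prod _ _ _ _ _ _ p); first by rewrite /= eqxx.
      by have := ltn_ord p; lia.
    move=> z; apply: xval_bin; apply: xval_bin; [exact: xval_nat|exact: xval_nat| |exact: xval_nat].
    by apply: xval_bin; [exact: xval_nat | case: env => _ _ _ h _; apply: xval_get].
  apply: (IH _ (al' p) _ (D - p)%N).
  - exact: marg_env_set.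
  - exact: ltnW.
  - move=> l' ll; rewrite /= eqn_add2l /al'; case: eqP => // ne; apply: alE; lia.
  - move=> l' ll; rewrite /al'; case: eqP => [_|ne]; last by apply: alN; lia.
    by have := ltn_ord p; lia.
  - move=> st' h /=; rewrite remE ?h /= ?eqxx ?leqnn ?orbT // => x xl.
    rewrite h /=; last by lia.
    by case: eqP => // xE; lia.
  - by lia.
have remEz p z : neval (set_nvar (set_nvar st (40 + l) p) 22 z) rem = D.
  apply: remE => x xl; rewrite /=; case: eqP => [|_]; first by lia.
  by case: eqP => //; lia.
have [_ h3 _ h6 _] := env.
under eq_bigr => p _.
  rewrite /= big_split /= prodr_const card_ord h3 sub0r.
  under eq_bigr => z _ do rewrite remEz.
  rewrite prod_falling; last by have := ltn_ord p; lia.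
  rewrite big_distrr /=; over.
rewrite exchange_big /=; apply: eq_bigr => jj _.
rewrite [X in _ * (1 + X) ^+ _](bigD1 Ol) //=.
set A := \prod_i _; set y := - th / _ * rank_one Ol jj.
set B := \prod_(l' < r | (l < l')%N) _.
have BE p : \prod_(l' < r | (l <= l')%N) rank_one l' jj ^+ al' p l' = rank_one Ol jj ^+ p * B.
  rewrite (bigD1 Ol) //= /al' eqxx; congr (_ * _); apply: eq_big => l'.
    by rewrite -val_eqE /=; lia.
  by case/andP=> _; rewrite -val_eqE /= => /negPf->.
have SE : \sum_(l' < r | (l' < l.+1)%N && (l' != Ol)) (- th / m%:R) * rank_one l' jj =
  \sum_(l' < r | (l' < l)%N) (- th / m%:R) * rank_one l' jj.
  by apply: eq_bigl => l'; rewrite -val_eqE /=; lia.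
rewrite SE addrCA addrC exprDn addn1 big_distrr /=.
apply: eq_bigr => p _; rewrite BE h6 /y !exprMn -mulr_natr; ring.
Qed.

(** A kernel close to [exp (- th * cost)] whose marginals, after scaling, are
  computable: the exponential of the low-rank part is replaced by a power. *)
Definition gibbs (jj : midx n k) : R :=
  (1 - th * low_rank_part I jj / m%:R) ^+ m * expR (- (th * sparse_part I jj)).

Lemma xval_MARGX st : marg_env st -> injective (spos I) ->
  xval N st MARGX (marg (fun jj => \prod_i d i (jj i) * gibbs jj) i0 j0).
Proof.
move=> env inj; have [ld h3 _ h7 _] := env.
pose h x := expR (0 - th * x) - 1.
pose G (jj : midx n k) := (\prod_i masked i (jj i)) * (1 - th * low_rank_part I jj / m%:R) ^+ m.
apply: (@xval_eq _ _ _ _ (\sum_(jj : midx n k) G jj + \sum_(t < spars I) G (spos I t) * h (Defs.sval I t))).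
  apply: xval_bin.
    apply: xval_eq.
      apply: (xval_LRX (al := fun l => 0%N) (D := m)) => //.
      - by move=> l'; lia.
      - by move=> st' st'E; rewrite /= st'E.
    apply: eq_bigr => jj _; rewrite [X in _ * X * _]big_pred0; last first.
      by move=> l; rewrite leqNgt ltn_ord.
    rewrite mulr1 /G; congr (_ * _ ^+ _).
    rewrite /low_rank_part /sum_rank1 -mulrA mulrCA -mulrN.
    under eq_bigl => l do rewrite ltn_ord.
    rewrite -big_distrr /= /rank_one mulrC.
    by rewrite mulNr mulrN mulrC -mulrA.
  apply: (@xval_sum _ _ _ _ _ _ (spars I)); [by case: ld => [_ [_ []]]|by []|].
  move=> t; have envt : marg_env (set_nvar st 24 t) by exact: marg_env_set.
  have [_ [_ [_ [p0 [_ [_ [_ [p7 _]]]]]]]] := ld.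
  apply: xval_bin; first apply: xval_bin.
  - apply: (@xval_prod _ _ _ _ _ _ k); [by case: ld => [_ []]|by []|].
    move=> i; apply: xval_DX => //.
    exact: p0.
  - apply: xval_eq.
      apply: (@xval_prod _ _ _ _ _ _ m _); [exact: h3|exact: ltnW|].
      move=> z; apply: xval_bin; first exact: xval_nat.
      apply: xval_bin; last exact: xval_nat.
      apply: xval_bin; first by apply: xval_get.
      apply: (xval_RX (jj := spos I t)) => //.
      by move=> i l; exact: p0.
    by rewrite /= prodr_const card_ord h3 h7.
  - apply: xval_bin; last exact: xval_nat.
    apply: xval_exp; apply: xval_bin; first exact: xval_nat.
    by apply: xval_bin; [apply: xval_get | apply: xval_get; last exact: p7].
rewrite sum_sparse //; last by rewrite /h mulr0 subr0 expR0 subrr.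
rewrite -big_split /= /marg [RHS]big_mkcond /=; apply: eq_bigr => jj _.
rewrite /G /h /gibbs.
have -> : \prod_i masked i (jj i) = if jj i0 == j0 then \prod_i d i (jj i) else 0.
  rewrite (bigD1 i0) //= /masked eqxx; case: ifP => _; last by rewrite mul0r.
  rewrite [RHS](bigD1 i0) //=; congr (_ * _); apply: eq_bigr => i /negPf ->; by [].
case: ifP => _; last by rewrite !mul0r addr0.
by rewrite sub0r; ring.
Qed.

End Marg.
End Expressions.
Arguments gibbs {R r} I m th jj.

(** * Elementary estimates *)

Section Estimates.
Variable R : realType.
Implicit Types x y z u v : R.

Lemma ln_le_sub1 x : 0 < x -> ln x <= x - 1.
Proof.
move=> x0; rewrite -(ler_expR) lnK ?posrE //.
by have := expR_ge1Dx (x - 1); rewrite addrCA subrr addr0.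
Qed.

Lemma expR_lower z : `|z| <= 1 / 2 -> expR (z - 2 * z ^+ 2) <= 1 + z.
Proof.
rewrite ler_norml => /andP[z1 z2].
have h : 1 <= (1 + z) * expR (2 * z ^+ 2 - z).
  apply: (@le_trans _ _ ((1 + z) * (1 + (2 * z ^+ 2 - z)))); last first.
    by apply: ler_wpM2l; [lra | exact: expR_ge1Dx].
  have : 0 <= z ^+ 2 * (1 + 2 * z) by rewrite mulr_ge0 ?sqr_ge0 //; lra.
  by nra.
have e0 := expR_gt0 (2 * z ^+ 2 - z).
rewrite -[z - _]opprB expRN -[leLHS]mul1r ler_pdivrMr //.
Qed.

Lemma compound_le x (m : nat) : (0 < m)%N -> - m%:R <= x ->
  (1 + x / m%:R) ^+ m <= expR x.
Proof.
move=> m0 mx; have m0' : (0 : R) < m%:R by rewrite ltr0n.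
have -> : expR x = expR (x / m%:R) ^+ m.
  by rewrite -expRM_natl mulrC divfK // gt_eqF.
apply: lerXn2r; rewrite ?nnegrE ?expR_ge0 //; last exact: expR_ge1Dx.
by rewrite -lerBlDl sub0r ler_pdivlMr // mulN1r.
Qed.

(** A degree quadratic in the range [X] suffices, because the logarithm of the power
  falls short of [x] by at most [2 * x ^+ 2 / m]. *)
Lemma compound_ge x X (m : nat) : `|x| <= X -> 16 * (X + 1) ^+ 2 <= m%:R ->
  expR (x - 1 / 8) <= (1 + x / m%:R) ^+ m.
Proof.
move=> xX Xm; have X0 : 0 <= X by exact: le_trans xX.
have m0 : (0 : R) < m%:R by apply: lt_le_trans Xm; nra.
have xm : `|x / m%:R| <= 1 / 2.
  rewrite normrM [`|_^-1|]gtr0_norm ?invr_gt0 // ler_pdivrMr //.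
  by apply: le_trans xX _; nra.
apply: (@le_trans _ _ (expR (x / m%:R - 2 * (x / m%:R) ^+ 2) ^+ m)); last first.
  apply: lerXn2r; rewrite ?nnegrE ?expR_ge0 //; last exact: expR_lower.
  by move: xm; rewrite ler_norml => /andP[]; lra.
rewrite -expRM_natl ler_expR mulrBr [m%:R * (x / _)]mulrC divfK ?gt_eqF //.
rewrite lerD2l lerN2.
have -> : m%:R * (2 * (x / m%:R) ^+ 2) = 2 * x ^+ 2 / m%:R :> R.
  by field; rewrite gt_eqF.
rewrite ler_pdivrMr //.
have : x ^+ 2 <= X ^+ 2 by rewrite -real_normK ?num_real // lerXn2r ?nnegrE.
by nra.
Qed.

(** Relative entropy dominates the squared Hellinger distance, by
  [ln x <= x - 1] at the square root of the likelihood ratio. *)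
Lemma entropy_ge_hellinger u v : 0 <= u -> 0 <= v -> (0 < u -> 0 < v) ->
  2 * u - 2 * (Num.sqrt u * Num.sqrt v) <= u * ln (u / v).
Proof.
move=> u0 v0 uv; case: (ltgtP 0 u) u0 => // [u1|<-] _; last first.
  by rewrite !mul0r sqrtr0 mul0r !mulr0 subrr.
have v1 := uv u1; have su : 0 < Num.sqrt u by rewrite sqrtr_gt0.
have sv : 0 < Num.sqrt v by rewrite sqrtr_gt0.
have uE : u = Num.sqrt u ^+ 2 by rewrite sqr_sqrtr // ltW.
have vE : v = Num.sqrt v ^+ 2 by rewrite sqr_sqrtr // ltW.
move: (Num.sqrt u) (Num.sqrt v) su sv uE vE => a b su sv uE vE.
have -> : ln (u / v) = - (2 * ln (b / a)).
  rewrite uE vE !ln_div ?posrE ?exprn_gt0 // !lnXn //.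
  by rewrite mulrBr opprB !mulr_natl.
rewrite mulrN lerNr opprB.
apply: (@le_trans _ _ (u * (2 * (b / a - 1)))).
  by apply: ler_wpM2l; [exact: ltW | rewrite ler_wpM2l // ln_le_sub1 // divr_gt0].
have -> : u * (2 * (b / a - 1)) = 2 * (a * b) - 2 * u by rewrite uE; field; rewrite gt_eqF.
by [].
Qed.

Lemma entropy_ge u v : 0 <= u -> 0 <= v -> (0 < u -> 0 < v) ->
  u - v <= u * ln (u / v).
Proof.
move=> u0 v0 uv; apply: le_trans (entropy_ge_hellinger u0 v0 uv).
have := sqr_ge0 (Num.sqrt u - Num.sqrt v).
by rewrite sqrrB !sqr_sqrtr //; lra.
Qed.

(** A Pinsker inequality, through the Hellinger distance: the total variation
  is the sum of [|a - b| * (a + b)] over square roots [a], [b] of the weights. *)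
Lemma pinsker (T : finType) (p q : T -> R) :
  (forall t, 0 <= p t) -> (forall t, 0 <= q t) -> (forall t, 0 < p t -> 0 < q t) ->
  \sum_t p t = 1 -> \sum_t q t = 1 ->
  (\sum_t `|p t - q t|) ^+ 2 / 4 <= \sum_t p t * ln (p t / q t).
Proof.
move=> p0 q0 pq p1 q1; set V := \sum_t _.
have V0 : 0 <= V by exact: sumr_ge0.
have step t : V * `|p t - q t| <=
    2 * (p t * ln (p t / q t) - p t + q t) + V ^+ 2 / 4 * (p t + q t).
  have := entropy_ge_hellinger (p0 t) (q0 t) (pq t).
  have pE : p t = Num.sqrt (p t) ^+ 2 by rewrite sqr_sqrtr.
  have qE : q t = Num.sqrt (q t) ^+ 2 by rewrite sqr_sqrtr.
  have := sqrtr_ge0 (p t); have := sqrtr_ge0 (q t).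
  set a := Num.sqrt (p t) in pE *; set b := Num.sqrt (q t) in qE *.
  set L := _ * ln _ => b0 a0 hL.
  have -> : `|p t - q t| = `|a - b| * (a + b).
    rewrite pE qE subr_sqr normrM; congr (_ * _); exact: ger0_norm (addr_ge0 _ _).
  have hab : `|a - b| ^+ 2 = (a - b) ^+ 2 by rewrite real_normK ?num_real.
  have := normr_ge0 (a - b); set c := `|a - b| in hab *.
  (* a weighted mean inequality; its weight makes the right-hand side absorb
     exactly half of [V ^+ 2] after summation *)
  have h1 := sqr_ge0 (4 * c - V * (a + b)).
  have h2 : (a + b) ^+ 2 <= 2 * (p t + q t).
    by have := sqr_ge0 (a - b); rewrite pE qE; nra.
  have h3 : 0 <= V ^+ 2 * (2 * (p t + q t) - (a + b) ^+ 2).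
    by apply: mulr_ge0; [exact: sqr_ge0 | rewrite subr_ge0].
  rewrite pE qE in h2 h3 hL *.
  have h4 : 16 * c ^+ 2 - 8 * (V * (c * (a + b))) + V ^+ 2 * (a + b) ^+ 2 >= 0.
    by apply: le_trans h1 _; rewrite le_eqVlt; apply/orP; left; apply/eqP; ring.
  have h5 : c ^+ 2 = a ^+ 2 - 2 * (a * b) + b ^+ 2 by rewrite hab; ring.
  by move: h3 h4 hL; rewrite h5 mulrBr; lra.
have := ler_sum (P := xpredT) (index_enum T) (fun t _ => step t).
rewrite -mulr_sumr -/V big_split /= -!mulr_sumr !big_split /= sumrN p1 q1.
by rewrite expr2; lra.
Qed.

End Estimates.

(** * Tensors with prescribed marginals *)

Section TensorTheory.
Variables (R : realType) (n k : nat).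
Implicit Types (P Q C : tensor R n k) (nu : 'I_k -> 'I_n -> R) (i : 'I_k) (j : 'I_n).

Definition dist1 P Q : R := \sum_jj `|P jj - Q jj|.

Definition gap nu P i : R := \sum_j `|nu i j - marg P i j|.

Lemma sum_marg (P : tensor R n k) i : \sum_j marg P i j = mass P.
Proof. by rewrite /mass (partition_big (fun jj : midx n k => jj i) xpredT). Qed.

Lemma marg_ge0 P i j : (forall jj, 0 <= P jj) -> 0 <= marg P i j.
Proof. by move=> P0; exact: sumr_ge0. Qed.

Lemma le_marg P Q i j : (forall jj, P jj <= Q jj) -> marg P i j <= marg Q i j.
Proof. by move=> PQ; exact: ler_sum. Qed.

Lemma entry_le_marg P jj i : (forall jj, 0 <= P jj) -> P jj <= marg P i (jj i).
Proof.
move=> P0; rewrite /marg (bigD1 jj) //= lerDl; exact: sumr_ge0.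
Qed.

Lemma entry_le_mass P jj : (forall jj, 0 <= P jj) -> P jj <= mass P.
Proof.
move=> P0; rewrite /mass (bigD1 jj) //= lerDl; exact: sumr_ge0.
Qed.

Lemma inner_dist1 C P Q c : (forall jj, `|C jj| <= c) ->
  inner C P <= inner C Q + c * dist1 P Q.
Proof.
move=> Cc; rewrite -lerBlDl /inner -sumrB /dist1 mulr_sumr; apply: ler_sum => jj _.
rewrite -mulrBr; apply: le_trans (ler_norm _) _.
by rewrite normrM ler_wpM2r.
Qed.

Lemma marg_dist1 P Q i : \sum_j `|marg P i j - marg Q i j| <= dist1 P Q.
Proof.
rewrite /dist1 (partition_big (fun jj : midx n k => jj i) xpredT) //=.
apply: ler_sum => j _; rewrite /marg -sumrB; exact: ler_norm_sum.
Qed.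

Lemma gap_dist1 nu P Q i : gap nu P i <= gap nu Q i + dist1 P Q.
Proof.
apply: le_trans (lerD (lexx _) (marg_dist1 P Q i)).
rewrite /gap -big_split /=; apply: ler_sum => j _.
by rewrite [`|marg P i j - _|]distrC; exact: ler_distD.
Qed.

Lemma dist1_trans P Q Q' : dist1 P Q' <= dist1 P Q + dist1 Q Q'.
Proof.
by rewrite /dist1 -big_split /=; apply: ler_sum => jj _; exact: ler_distD.
Qed.

Lemma mass_prod (f : 'I_k -> 'I_n -> R) :
  mass (fun jj : midx n k => \prod_i f i (jj i)) = \prod_i \sum_j f i j.
Proof. by rewrite /mass bigA_distr_bigA. Qed.

Lemma marg_prod (f : 'I_k -> 'I_n -> R) i0 j0 :
  marg (fun jj : midx n k => \prod_i f i (jj i)) i0 j0 =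
  f i0 j0 * \prod_(i | i != i0) \sum_j f i j.
Proof.
pose g i j := if i == i0 then (if j == j0 then f i j else 0) else f i j.
transitivity (\prod_i \sum_j g i j).
  rewrite -mass_prod /marg /mass big_mkcond /=; apply: eq_bigr => jj _.
  rewrite [RHS](bigD1 i0) //= {1}/g eqxx; case: ifP => _; last by rewrite mul0r.
  rewrite [LHS](bigD1 i0) //=; congr (_ * _).
  by apply: eq_bigr => i; rewrite /g => /negPf ->.
rewrite (bigD1 i0) //=; congr (_ * _).
  rewrite (bigD1 j0) //= /g !eqxx big1 ?addr0 // => j /negPf ->; by [].
by apply: eq_bigr => i ii; apply: eq_bigr => j _; rewrite /g (negPf ii).
Qed.

Lemma sum_coord (P : tensor R n k) i (g : 'I_n -> R) :
  \sum_jj P jj * g (jj i) = \sum_j marg P i j * g j.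
Proof.
rewrite (partition_big (fun jj : midx n k => jj i) xpredT) //=.
by apply: eq_bigr => j _; rewrite mulr_suml; apply: eq_bigr => jj /eqP ->.
Qed.

Lemma feasible_mass nu P i : in_simplex (nu i) -> feasible nu P -> mass P = 1.
Proof.
move=> [_ s1] [_ m1]; rewrite -(sum_marg P i) -[RHS]s1; exact: eq_bigr.
Qed.

Lemma feasible_prod nu : (forall i, in_simplex (nu i)) ->
  feasible nu (fun jj : midx n k => \prod_i nu i (jj i)).
Proof.
move=> sx; split=> [jj|i j]; first by apply: prodr_ge0 => i _; case: (sx i).
by rewrite marg_prod big1 ?mulr1 // => i' _; case: (sx i').
Qed.

(** The effect on the tensor of one multiplication of the final sweep of SINKHORN. *)
Definition trim nu (P : tensor R n k) i : tensor R n k :=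
  fun jj => P jj * Num.min 1 (nu i (jj i) / marg P i (jj i)).

Definition trims nu P (s : seq 'I_k) : tensor R n k := foldl (trim nu) P s.

(** The missing mass is spread as a product tensor, whose marginals are the missing
  marginals. *)
Definition fill nu P : tensor R n k :=
  fun jj => P jj + (\prod_i (nu i (jj i) - marg P i (jj i))) / (1 - mass P) ^+ k.-1.

Section Rounding.
Variable nu : 'I_k -> 'I_n -> R.
Hypothesis nu0 : forall i j, 0 <= nu i j.

Lemma trim_factor P i j : (forall jj, 0 <= P jj) ->
  0 <= Num.min 1 (nu i j / marg P i j) <= 1.
Proof.
move=> P0; rewrite ge_min lexx le_min ler01 /= andbT.
by rewrite divr_ge0 ?marg_ge0.
Qed.

Lemma trim_ge0 P i jj : (forall jj, 0 <= P jj) -> 0 <= trim nu P i jj.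
Proof.
by move=> P0; apply: mulr_ge0 => //; case/andP: (trim_factor i (jj i) P0).
Qed.

Lemma trim_le P i jj : (forall jj, 0 <= P jj) -> trim nu P i jj <= P jj.
Proof.
by move=> P0; rewrite -[leRHS]mulr1 ler_wpM2l //; case/andP: (trim_factor i (jj i) P0).
Qed.

Lemma marg_trim P i j : (forall jj, 0 <= P jj) ->
  marg (trim nu P i) i j = Num.min (marg P i j) (nu i j).
Proof.
move=> P0; rewrite /marg /trim.
under eq_bigr => jj /eqP -> do over.
rewrite -mulr_suml -/(marg P i j).
have := marg_ge0 i j P0; rewrite le_eqVlt => /predU1P[<-|m0].
  by rewrite mul0r min_l.
by rewrite minr_pMr ?mulr1 1?mulrC ?divfK ?gt_eqF // ltW.
Qed.

Definition excess P i : R := \sum_j Num.max 0 (marg P i j - nu i j).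

Lemma excess_gap P i : excess P i <= gap nu P i.
Proof.
apply: ler_sum => j _; rewrite ge_max normr_ge0 /= distrC; exact: ler_norm.
Qed.

Lemma excess_le P Q i : (forall jj, P jj <= Q jj) -> excess P i <= excess Q i.
Proof.
move=> PQ; apply: ler_sum => j _; rewrite ge_max le_max lexx /= le_max.
by rewrite lerD2r le_marg ?orbT.
Qed.

Lemma mass_trim P i : (forall jj, 0 <= P jj) ->
  mass P - mass (trim nu P i) = excess P i.
Proof.
move=> P0; rewrite -(sum_marg P i) -(sum_marg (trim nu P i) i) -sumrB.
apply: eq_bigr => j _; rewrite marg_trim //.
case: (leP (marg P i j) (nu i j)) => h.
  by rewrite subrr max_l // subr_le0.
by rewrite max_r // subr_ge0 ltW.
Qed.

Lemma trims_spec P s : (forall jj, 0 <= P jj) ->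
  let P' := trims nu P s in
  [/\ forall jj, 0 <= P' jj <= P jj,
      forall i j, i \in s -> marg P' i j <= nu i j
    & mass P - mass P' <= \sum_(i <- s) excess P i].
Proof.
elim: s P => [|i s IH] P P0 /=.
  by split=> // [jj|]; rewrite ?P0 ?lexx // subrr big_nil.
have [|h1 h2 h3] := IH (trim nu P i); first by move=> jj; exact: trim_ge0.
split=> [jj|i' j|].
- by have /andP[-> /= h] := h1 jj; apply: le_trans h (trim_le i jj P0).
- rewrite inE => /predU1P[->|]; last exact: h2.
  apply: (@le_trans _ _ (marg (trim nu P i) i j)).
    by apply: le_marg => jj; case/andP: (h1 jj).
  by rewrite marg_trim // ge_min lexx orbT.
- rewrite big_cons -(mass_trim i P0).
  have : \sum_(i' <- s) excess (trim nu P i) i' <= \sum_(i' <- s) excess P i'.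
    by apply: ler_sum => i' _; apply: excess_le => jj; exact: trim_le.
  by move: h3; rewrite /trims; lra.
Qed.

Lemma trims_gt0 P s jj : (forall jj, 0 <= P jj) -> 0 < P jj ->
  (forall i, 0 < nu i (jj i)) -> 0 < trims nu P s jj.
Proof.
move=> P0 Pjj nujj; elim: s P P0 Pjj => //= i s IH P P0 Pjj.
apply: IH => [jj'|]; first exact: trim_ge0.
rewrite mulr_gt0 // lt_min ltr01 divr_gt0 //.
exact: lt_le_trans (entry_le_marg jj i P0).
Qed.

Section Fill.
Hypothesis nu1 : forall i, in_simplex (nu i).
Variable P : tensor R n k.
Hypotheses (P0 : forall jj, 0 <= P jj) (Pnu : forall i j, marg P i j <= nu i j).

Lemma sum_residual i : \sum_j (nu i j - marg P i j) = 1 - mass P.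
Proof. by rewrite sumrB sum_marg; case: (nu1 i) => _ ->. Qed.

Lemma mass_le1 : (0 < k)%N -> mass P <= 1.
Proof.
move=> k0; rewrite -subr_ge0 -(sum_residual (Ordinal k0)).
by apply: sumr_ge0 => j _; rewrite subr_ge0.
Qed.

Lemma fill_ge jj : (0 < k)%N -> P jj <= fill nu P jj.
Proof.
move=> k0; rewrite lerDl divr_ge0 //.
  by apply: prodr_ge0 => i _; rewrite subr_ge0.
by rewrite exprn_ge0 // subr_ge0 mass_le1.
Qed.

Lemma feasible_fill : (0 < k)%N -> feasible nu (fill nu P).
Proof.
move=> k0; split=> [jj|i j]; first exact: le_trans (fill_ge jj k0).
rewrite /marg /fill big_split /= -/(marg P i j) -mulr_suml.
rewrite -/(marg (fun jj : midx n k => \prod_i (nu i (jj i) - marg P i (jj i))) i j).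
rewrite (marg_prod (fun i j => nu i j - marg P i j)).
under eq_bigr => i' _ do rewrite sum_residual.
rewrite prodr_const cardC1 card_ord.
have [d0|d0] := eqVneq (1 - mass P) 0.
  have : nu i j - marg P i j == 0.
    rewrite -[X in X == _]/((fun j => nu i j - marg P i j) j).
    have := sum_residual i; rewrite d0 => /eqP.
    rewrite psumr_eq0; last by move=> j' _; rewrite subr_ge0.
    by move=> /allP/(_ j); rewrite mem_index_enum => /(_ isT).
  by rewrite subr_eq0 => /eqP ->; rewrite subrr !mul0r addr0.
by rewrite mulfK ?expf_neq0 // addrC subrK.
Qed.

Lemma dist1_fill : (0 < k)%N -> dist1 (fill nu P) P = 1 - mass P.
Proof.
move=> k0; rewrite -(feasible_mass (nu1 (Ordinal k0)) (feasible_fill k0)).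
rewrite /mass -sumrB; apply: eq_bigr => jj _.
by rewrite ger0_norm // subr_ge0 fill_ge.
Qed.

End Fill.

(** Trimming removes at most the excess of the marginals and filling restores the
  same mass.  The statement is used twice: for the output of SINKHORN and, in its
  analysis, to move a competing plan to the marginals of the unrounded iterate. *)
Lemma rounding_close P : (0 < k)%N -> (forall i, in_simplex (nu i)) ->
  (forall jj, 0 <= P jj) -> mass P = 1 ->
  let P' := fill nu (trims nu P (enum 'I_k)) in
  feasible nu P' /\ dist1 P' P <= 2 * \sum_i gap nu P i.
Proof.
move=> k0 nu1 P0 P1 /=; have [h1 h2 h3] := trims_spec (enum 'I_k) P0.
set T := trims _ _ _ in h1 h2 h3 *.
have T0 jj : 0 <= T jj by case/andP: (h1 jj).
have Tnu i j : marg T i j <= nu i j by apply: h2; rewrite mem_enum.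
split; first exact: feasible_fill.
apply: le_trans (dist1_trans _ T _) _.
have -> : dist1 T P = mass P - mass T.
  rewrite /mass -sumrB; apply: eq_bigr => jj _.
  by rewrite distrC ger0_norm // subr_ge0; case/andP: (h1 jj).
have h : 1 - mass T <= \sum_i gap nu P i.
  rewrite -P1; apply: le_trans h3 _; rewrite big_enum /=.
  by apply: ler_sum => i _; exact: excess_gap.
by rewrite dist1_fill // P1 mulr_natl mulr2n; exact: lerD.
Qed.

End Rounding.
End TensorTheory.

(** * Convergence of the Sinkhorn iteration *)

Section SinkhornTheory.
Variables (R : realType) (n k : nat) (C : tensor R n k) (mu : 'I_k -> 'I_n -> R).
Variables (eta B : R).
Hypotheses (k0 : (0 < k)%N) (mu1 : forall i, in_simplex (mu i)).
Hypothesis etaC : forall jj, `|eta * C jj| <= B.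
Implicit Types (d : 'I_k -> 'I_n -> R) (i : 'I_k) (j : 'I_n) (jj : midx n k).

Local Notation scl d := (scaled C d eta).
Local Notation upd := (sinkhorn_update C mu eta).
Local Notation viol d i := (violation C mu eta d i).

Let mu0 i j : 0 <= mu i j. Proof. by case: (mu1 i). Qed.

(** An update against a zero target produces a zero scaling, so positivity is only kept where the target is
  positive; this suffices for every logarithm that has a non-zero weight. *)
Definition admissible d : Prop :=
  forall i j, 0 <= d i j /\ (0 < mu i j -> 0 < d i j).

(** The dual objective of entropic transport, without its mass term, which is
  constant from the first update on. *)
Definition dual d : R := \sum_i \sum_j mu i j * ln (d i j).

Lemma scaled_ge0 d jj : (forall i j, 0 <= d i j) -> 0 <= scl d jj.
Proof. by move=> d0; rewrite mulr_ge0 ?expR_ge0 //; apply: prodr_ge0. Qed.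

Lemma admissible_ge0 d jj : admissible d -> 0 <= scl d jj.
Proof. by move=> ad; apply: scaled_ge0 => i j; case: (ad i j). Qed.

Lemma scaled_gt0 d jj : admissible d -> (forall i, 0 < mu i (jj i)) -> 0 < scl d jj.
Proof.
move=> ad mjj; rewrite mulr_gt0 ?expR_gt0 //; apply: prodr_gt0 => i _.
by case: (ad i (jj i)) => _; apply.
Qed.

Lemma support_point i : exists j, 0 < mu i j.
Proof.
case: (mu1 i) => m0 m1; apply/existsP; apply: contraT.
rewrite negb_exists => /forallP al.
have : \sum_j mu i j = 0.
  by apply: big1 => j _; apply/eqP; rewrite eq_le m0 andbT leNgt.
by rewrite m1 => /eqP; rewrite oner_eq0.
Qed.

Lemma MARG_gt0 d i j : admissible d -> 0 < mu i j -> 0 < MARG C d eta i j.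
Proof.
move=> ad mij; pose c i' := sval (sigW (support_point i')).
pose jj : midx n k := [ffun i' => if i' == i then j else c i'].
have jjP i' : 0 < mu i' (jj i').
  by rewrite ffunE; case: eqP => [->//|_]; rewrite /c; case: sigW.
have jji : jj i = j by rewrite ffunE eqxx.
apply: (lt_le_trans (scaled_gt0 ad jjP)).
by rewrite -[in MARG _ _ _ _ _]jji; apply: entry_le_marg => jj'; exact: admissible_ge0.
Qed.

Lemma MARG_ge0 d i j : admissible d -> 0 <= MARG C d eta i j.
Proof. by move=> ad; apply: marg_ge0 => jj; exact: admissible_ge0. Qed.

Lemma admissible_ones : admissible (fun _ _ => 1).
Proof. by []. Qed.

Lemma admissible_upd d i : admissible d -> admissible (upd d i).
Proof.
move=> ad i' j; rewrite /sinkhorn_update; case: eqP => [->|_]; last exact: ad.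
case: (ad i j) => d0 d1; split.
  by rewrite mulr_ge0 // divr_ge0 // MARG_ge0.
by move=> m; rewrite mulr_gt0 ?d1 // divr_gt0 // MARG_gt0.
Qed.

Lemma scaled_upd d i jj :
  scl (upd d i) jj = scl d jj * (mu i (jj i) / MARG C d eta i (jj i)).
Proof.
rewrite /scaled [RHS]mulrAC; congr (_ * _).
rewrite (bigD1 i) //= [in RHS](bigD1 i) //= /sinkhorn_update eqxx [LHS]mulrAC.
congr (_ * _ * _).
by apply: eq_bigr => i' /negPf ->.
Qed.

Lemma MARG_upd d i j : admissible d -> MARG C (upd d i) eta i j = mu i j.
Proof.
move=> ad; rewrite /MARG /marg.
under eq_bigr => jj /eqP jji do rewrite scaled_upd jji.
rewrite -mulr_suml -/(marg (scl d) i j) -/(MARG C d eta i j).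
have := mu0 i j; rewrite le_eqVlt => /predU1P[<-|m0]; first by rewrite mul0r mulr0.
by rewrite mulrC divfK // gt_eqF // MARG_gt0.
Qed.

Lemma mass_upd d i : admissible d -> mass (scl (upd d i)) = 1.
Proof.
move=> ad; rewrite -(sum_marg _ i); have [_ s1] := mu1 i; rewrite -[RHS]s1.
by apply: eq_bigr => j _; exact: MARG_upd.
Qed.

Lemma dual_upd d i : admissible d ->
  dual (upd d i) = dual d + \sum_j mu i j * ln (mu i j / MARG C d eta i j).
Proof.
move=> ad; rewrite /dual (bigD1 i) //= [in RHS](bigD1 i) //= addrAC; congr (_ + _).
  rewrite -big_split /=; apply: eq_bigr => j _; rewrite /sinkhorn_update eqxx -mulrDr.
  have := mu0 i j; rewrite le_eqVlt => /predU1P[<-|m0]; first by rewrite !mul0r.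
  congr (_ * _); rewrite lnM // posrE; first by case: (ad i j) => _; apply.
  by rewrite divr_gt0 // MARG_gt0.
by apply: eq_bigr => i' /negPf ii; apply: eq_bigr => j _; rewrite /sinkhorn_update ii.
Qed.

(** The gain of an update is the relative entropy of the target to the current
  marginal. *)
Lemma dual_incr d i : admissible d -> mass (scl d) = 1 ->
  dual d + viol d i ^+ 2 / 4 <= dual (upd d i).
Proof.
move=> ad m1; rewrite dual_upd // lerD2l; apply: pinsker => //.
- by move=> j; exact: MARG_ge0.
- by move=> j; exact: MARG_gt0.
- by case: (mu1 i).
- by rewrite -m1 -(sum_marg _ i).
Qed.

Lemma dual_prod d :
  dual d = \sum_(jj : midx n k) (\prod_i mu i (jj i)) * \sum_i ln (d i (jj i)).
Proof.
under [RHS]eq_bigr => jj _ do rewrite mulr_sumr.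
rewrite exchange_big /=; apply: eq_bigr => i _.
rewrite (sum_coord (fun jj : midx n k => \prod_i mu i (jj i)) i (fun j => ln (d i j))).
apply: eq_bigr => j _; congr (_ * _).
by case: (feasible_prod mu1) => _ ->.
Qed.

Lemma ln_prod (T : finType) (f : T -> R) : (forall t, 0 < f t) ->
  ln (\prod_t f t) = \sum_t ln (f t).
Proof.
move=> f0; suff [] : 0 < \prod_t f t /\ ln (\prod_t f t) = \sum_t ln (f t) by [].
elim/big_rec2 : _ => [|t y1 y2 _ [p0 <-]]; first by rewrite ln1.
by rewrite mulr_gt0 // lnM // posrE.
Qed.

Lemma ln_scaled d jj : (forall i, 0 < d i (jj i)) ->
  ln (scl d jj) = \sum_i ln (d i (jj i)) - eta * C jj.
Proof.
by move=> dp; rewrite /scaled lnM ?posrE ?expR_gt0 ?prodr_gt0 // expRK mulNr ln_prod.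
Qed.

Lemma ln_le0 (x : R) : 0 < x -> x <= 1 -> ln x <= 0.
Proof. by move=> x0 x1; apply: le_trans (ln_le_sub1 x0) _; rewrite subr_le0. Qed.

(** Averaged against the product of the targets, the dual objective is the expected
  logarithm of an entry plus [eta * C], and no entry exceeds the mass 1. *)
Lemma dual_le d : admissible d -> mass (scl d) = 1 -> dual d <= B.
Proof.
move=> ad m1; rewrite dual_prod.
have <- : \sum_(jj : midx n k) (\prod_i mu i (jj i)) * B = B.
  rewrite -mulr_suml -/(mass (fun jj : midx n k => \prod_i mu i (jj i))).
  by rewrite (feasible_mass (mu1 (Ordinal k0)) (feasible_prod mu1)) mul1r.
apply: ler_sum => jj _; have p0 : 0 <= \prod_i mu i (jj i) by exact: prodr_ge0.
move: p0; rewrite le_eqVlt => /predU1P[<-|p0]; first by rewrite !mul0r.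
rewrite ler_wpM2l //; first exact: ltW.
have mjj i : 0 < mu i (jj i).
  rewrite lt_neqAle mu0 andbT eq_sym; apply/eqP => m0.
  by move: p0; rewrite (bigD1 i) //= m0 mul0r ltxx.
have dp i : 0 < d i (jj i) by case: (ad i (jj i)) => _; apply.
have -> : \sum_i ln (d i (jj i)) = ln (scl d jj) + eta * C jj.
  by rewrite ln_scaled // subrK.
apply: (@le_trans _ _ (0 + B)); last by rewrite add0r.
apply: lerD; last by apply: le_trans (ler_norm _) (etaC jj).
apply: ln_le0; first exact: scaled_gt0.
by rewrite -m1; apply: entry_le_mass => jj'; exact: admissible_ge0.
Qed.

Lemma n_gt0 : (0 < n)%N.
Proof. by case: (support_point (Ordinal k0)) => j _; exact: leq_ltn_trans (ltn_ord j). Qed.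

Lemma mass_ones_le : mass (scl (fun _ _ => 1)) <= expR (k%:R * ln n%:R + B).
Proof.
apply: (@le_trans _ _ (\sum_(jj : midx n k) expR B)).
  apply: ler_sum => jj _; rewrite /scaled big1 // mul1r ler_expR mulNr.
  by have := etaC jj; rewrite ler_norml; lra.
rewrite sumr_const card_ffun !card_ord -[X in X <= _]mulr_natl natrX expRD ler_wpM2r ?expR_ge0 //.
by rewrite expRM_natl lnK // posrE ltr0n n_gt0.
Qed.

(** The starting tensor has mass at most [n ^ k * exp B], so that the first update
  cannot lose more than the logarithm of this. *)
Lemma dual_first i : - (k%:R * ln n%:R + B) <= dual (upd (fun _ _ => 1) i).
Proof.
set F := _ + _; rewrite dual_upd; last exact: admissible_ones.
have -> : dual (fun _ _ => 1) = 0.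
  by apply: big1 => i' _; apply: big1 => j _; rewrite ln1 mulr0.
rewrite add0r; set m := MARG _ _ _ _.
have ad := admissible_ones.
have step j : mu i j - m j / expR F - mu i j * F <= mu i j * ln (mu i j / m j).
  have := mu0 i j; rewrite le_eqVlt => /predU1P[<-|mp].
    rewrite !mul0r subr0 sub0r oppr_le0 divr_ge0 ?expR_ge0 //; exact: MARG_ge0.
  have m0 : 0 < m j by exact: MARG_gt0.
  have -> : ln (mu i j / m j) = ln (mu i j / (m j / expR F)) - F.
    by rewrite invfM invrK mulrA [in RHS]lnM ?posrE ?divr_gt0 ?expR_gt0 // expRK addrK.
  rewrite mulrBr lerD2r; apply: entropy_ge; rewrite ?ltW ?divr_gt0 ?expR_gt0 //.
apply: le_trans (ler_sum _ (fun j _ => step j)).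
rewrite !sumrB -!mulr_suml; have [_ ->] := mu1 i; rewrite mul1r.
rewrite -[X in - X <= _]add0r opprD oppr0 lerD2r subr_ge0 ler_pdivrMr ?expR_gt0 // mul1r.
by rewrite (sum_marg (scl (fun _ _ => 1)) i) mass_ones_le.
Qed.

Lemma dist1_upd d i : admissible d -> dist1 (scl (upd d i)) (scl d) = viol d i.
Proof.
move=> ad; rewrite /dist1 /violation.
transitivity (\sum_jj scl d jj * `|mu i (jj i) / MARG C d eta i (jj i) - 1|).
  apply: eq_bigr => jj _; rewrite scaled_upd -[X in _ - X]mulr1 -mulrBr normrM.
  by rewrite ger0_norm // admissible_ge0.
rewrite (sum_coord (scl d) i (fun j => `|mu i j / MARG C d eta i j - 1|)).
apply: eq_bigr => j _; rewrite -/(MARG C d eta i j).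
have := MARG_ge0 i j ad; rewrite le_eqVlt => /predU1P[m0|m0].
  rewrite -m0 mul0r subr0; have := mu0 i j.
  rewrite le_eqVlt => /predU1P[<-|mp]; first by rewrite normr0.
  by have := MARG_gt0 ad mp; rewrite -m0 ltxx.
by rewrite -{1}(gtr0_norm m0) -normrM mulrBr mulr1 mulrC divfK // gt_eqF.
Qed.

(** ** Deterministic update rules *)

Section Deterministic.
Variables (sigma : nat -> 'I_k) (thr : R).
Hypothesis thr0 : 0 < thr.

Definition iterate t := sinkhorn_iter C mu eta (mkseq sigma t).

Lemma iterateS t : iterate t.+1 = upd (iterate t) (sigma t).
Proof. by rewrite /iterate /sinkhorn_iter mkseqS -cats1 foldl_cat. Qed.

Lemma admissible_iterate t : admissible (iterate t).
Proof. by elim: t => // t IH; rewrite iterateS; exact: admissible_upd. Qed.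

Lemma mass_iterate t : mass (scl (iterate t.+1)) = 1.
Proof. by rewrite iterateS mass_upd //; exact: admissible_iterate. Qed.

Lemma dual_iterateS t : dual (iterate t.+1) + viol (iterate t.+1) (sigma t.+1) ^+ 2 / 4
  <= dual (iterate t.+2).
Proof. by rewrite [X in _ <= dual X]iterateS dual_incr ?mass_iterate //; exact: admissible_iterate. Qed.

Lemma dual_iterate_mono t q : dual (iterate t.+1) <= dual (iterate (t.+1 + q)).
Proof.
elim: q => [|q IH]; first by rewrite addn0.
apply: le_trans IH _; rewrite addnS; apply: le_trans (dual_iterateS (t + q)).
by rewrite addSn lerDl divr_ge0 ?sqr_ge0.
Qed.

Definition total_violation d : R := \sum_i viol d i.

Lemma violation_ge0 d i : 0 <= viol d i.
Proof. exact: sumr_ge0. Qed.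

(** The common part of the deterministic rules: if within any [k] consecutive
  updates one repairs a violation of [thr / k ^ 2], the bounded dual objective
  leaves room for few sweeps. *)
Variable N : nat.
Hypothesis progress : forall t, (t + k <= k * N)%N ->
  thr < total_violation (iterate t.+1) ->
  exists2 q, (q < k)%N &
    thr / k%:R ^+ 2 <= viol (iterate (t.+1 + q)) (sigma (t.+1 + q)).

Lemma deterministic_convergence :
  k%:R * ln n%:R + 2 * B < N%:R * (thr ^+ 2 / (4 * k%:R ^+ 4)) ->
  exists t, (t <= k * N)%N /\ total_violation (iterate t.+1) <= thr.
Proof.
move=> NB; apply: contrapT => nstop.
have run t : (t <= k * N)%N -> thr < total_violation (iterate t.+1).
  by move=> tN; rewrite ltNge; apply/negP => h; apply: nstop; exists t.
pose c := thr ^+ 2 / (4 * k%:R ^+ 4).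
have kR : (0 : R) < k%:R by rewrite ltr0n.
have gain p : (p <= N)%N -> dual (iterate 1) + p%:R * c <= dual (iterate (k * p).+1).
  elim: p => [|p IH] pN; first by rewrite mul0r addr0 muln0.
  have [||q qk hq] := progress (t := (k * p)%N).
    by rewrite -mulnSr leq_mul2l pN orbT.
    by apply: run; rewrite leq_mul2l ltnW ?orbT.
  have := IH (ltnW pN); rewrite -[p.+1]addn1 natrD mulrDl mul1r addrA => h.
  apply: le_trans (lerD h (lexx c)) _.
  apply: (@le_trans _ _ (dual (iterate ((k * p).+1 + q)) + c)).
    by rewrite lerD2r dual_iterate_mono.
  apply: (@le_trans _ _ (dual (iterate ((k * p) + q).+2))).
    apply: le_trans (dual_iterateS (k * p + q)); rewrite addSn lerD2l /c.
    have -> : thr ^+ 2 / (4 * k%:R ^+ 4) = (thr / k%:R ^+ 2) ^+ 2 / 4.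
      by field; rewrite gt_eqF.
    rewrite ler_wpM2r ?invr_ge0 // lerXn2r ?nnegrE ?violation_ge0 //.
      by rewrite divr_ge0 ?exprn_ge0 // ltW.
  have -> : (k * (p + 1)).+1 = ((k * p + q).+2 + (k - q - 1))%N by rewrite mulnDr muln1; lia.
  exact: dual_iterate_mono.
have := gain N (leqnn N).
have := dual_le (admissible_iterate (k * N).+1) (mass_iterate _).
have : - (k%:R * ln n%:R + B) <= dual (iterate 1) by rewrite iterateS; exact: dual_first.
by move: NB; rewrite -/c; lra.
Qed.

End Deterministic.

Lemma some_violation d thr : thr < total_violation d ->
  exists i, thr / k%:R < viol d i.
Proof.
move=> h; apply: contrapT => no.
have kR : (0 : R) < k%:R by rewrite ltr0n.
have : total_violation d <= \sum_(i < k) thr / k%:R.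
  by apply: ler_sum => i _; rewrite leNgt; apply/negP => hi; apply: no; exists i.
rewrite sumr_const card_ord -[X in _ <= X]mulr_natl mulrC divfK ?gt_eqF //.
by rewrite leNgt h.
Qed.

Lemma greedy_progress (sigma : nat -> 'I_k) (thr : R) (t : nat) : 0 < thr ->
  (forall i, viol (iterate sigma t.+1) i <= viol (iterate sigma t.+1) (sigma t.+1)) ->
  thr < total_violation (iterate sigma t.+1) ->
  exists2 q, (q < k)%N &
    thr / k%:R ^+ 2 <= viol (iterate sigma (t.+1 + q)) (sigma (t.+1 + q)%N).
Proof.
move=> thr0 gr /some_violation[i hi]; exists 0%N => //; rewrite addn0.
apply: le_trans (gr i); apply: le_trans (ltW hi).
have kR : (0 : R) < k%:R by rewrite ltr0n.
rewrite ler_wpM2l ?(ltW thr0) // lef_pV2 ?posrE ?exprn_gt0 // expr2 ler_peMl ?(ltW kR) //.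
by rewrite ler1n.
Qed.

(** If all the updates of a sweep are small, the marginals were already close to
  their targets when the sweep began, because each update moves the tensor by
  exactly the violation that it repairs. *)
Lemma round_robin_progress (sigma : nat -> 'I_k) (thr : R) (t : nat) : 0 < thr ->
  (forall q, (q <= t + k)%N -> sigma q = (q %% k)%N :> nat) ->
  thr < total_violation (iterate sigma t.+1) ->
  exists2 q, (q < k)%N &
    thr / k%:R ^+ 2 <= viol (iterate sigma (t.+1 + q)) (sigma (t.+1 + q)%N).
Proof.
move=> thr0 rr h; apply: contrapT => no.
have kR : (0 : R) < k%:R by rewrite ltr0n.
set e := thr / _ in no.
have e0 : 0 <= e by rewrite divr_ge0 ?exprn_ge0 // ltW.
have small q : (q < k)%N -> viol (iterate sigma (t.+1 + q)) (sigma (t.+1 + q)%N) <= e.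
  by move=> qk; rewrite leNgt; apply/negP => hq; apply: no; exists q => //; exact: ltW.
have drift q : (q < k)%N ->
    dist1 (scl (iterate sigma t.+1)) (scl (iterate sigma (t.+1 + q))) <= q%:R * e.
  elim: q => [|q IH] qk.
    by rewrite addn0 mul0r /dist1 big1 // => jj _; rewrite subrr normr0.
  apply: le_trans (dist1_trans _ (scl (iterate sigma (t.+1 + q))) _) _.
  rewrite -[q.+1 in X in _ <= X]addn1 natrD mulrDl mul1r lerD ?IH ?(ltnW qk) //.
  apply: le_trans (small q (ltnW qk)).
  rewrite addnS iterateS -(dist1_upd (sigma (t.+1 + q)) (admissible_iterate sigma (t.+1 + q))).
  by rewrite /dist1; apply: ler_sum => jj _; rewrite distrC.
have all_small i : viol (iterate sigma t.+1) i <= k%:R * e.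
  have [q qk qi] : exists2 q, (q < k)%N & sigma (t.+1 + q)%N = i.
    exists ((i + (k - t.+1 %% k)) %% k)%N; first by rewrite ltn_mod.
    apply: val_inj; rewrite /= rr ?modnDmr; last first.
      have := ltn_pmod (i + (k - t.+1 %% k)) k0; lia.
    have : (t.+1 %% k < k)%N by rewrite ltn_mod.
    rewrite {2}(divn_eq t.+1 k) => tk.
    have -> : (t.+1 %/ k * k + t.+1 %% k + (i + (k - t.+1 %% k)) =
       t.+1 %/ k * k + (k + i))%N by lia.
    by rewrite modnMDl modnDl modn_small.
  apply: le_trans (gap_dist1 mu _ (scl (iterate sigma (t.+1 + q))) i) _.
  have -> : k%:R * e = e + (k.-1)%:R * e.
    by rewrite -[X in X%:R * e](prednK k0) -addn1 natrD; ring.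
  apply: lerD; first by have := small q qk; rewrite qi.
  apply: le_trans (drift q qk) _; rewrite ler_wpM2r // ler_nat; lia.
have : total_violation (iterate sigma t.+1) <= \sum_(i < k) k%:R * e.
  by apply: ler_sum => i _.
rewrite sumr_const card_ord -[X in _ <= X]mulr_natl mulrA -expr2 /e mulrC.
by rewrite divfK ?leNgt ?h // expf_neq0 // gt_eqF.
Qed.

End SinkhornTheory.

Section RandomSinkhorn.
Variables (R : realType) (n k : nat) (C : tensor R n k) (mu : 'I_k -> 'I_n -> R).
Variables (eta B thr : R).
Hypotheses (k0 : (0 < k)%N) (mu1 : forall i, in_simplex (mu i)).
Hypothesis etaC : forall jj, `|eta * C jj| <= B.
Hypothesis thr0 : 0 < thr.
Implicit Types (d : 'I_k -> 'I_n -> R) (i : 'I_k) (j : 'I_n) (jj : midx n k).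

Local Notation scl d := (scaled C d eta).
Local Notation upd := (sinkhorn_update C mu eta).
Local Notation total d := (total_violation C mu eta d).

(** ** Random update rule *)

Fixpoint stops d (s : seq 'I_k) : bool :=
  (total d <= thr) || (if s is i :: s' then stops (upd d i) s' else false).

Lemma stopsP d s : stops d s ->
  exists2 t, (t <= size s)%N & total (foldl upd d (take t s)) <= thr.
Proof.
elim: s d => [|i s IH] d /=; first by rewrite orbF => h; exists 0%N.
case/orP => [h|/IH[t ts h]]; first by exists 0%N.
by exists t.+1.
Qed.

Definition unstopped T d : nat := #|[set w : T.-tuple 'I_k | ~~ stops d w]|.

Lemma unstopped_le T d : (unstopped T d <= k ^ T)%N.
Proof. by apply: leq_trans (max_card _) _; rewrite card_tuple card_ord. Qed.

Lemma unstopped_stop T d : total d <= thr -> unstopped T d = 0%N.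
Proof.
move=> h; apply: eq_card0 => w; rewrite !inE.
by case: w => -[|i s] _ /=; rewrite h.
Qed.

Lemma unstoppedS T d : thr < total d ->
  unstopped T.+1 d = (\sum_i unstopped T (upd d i))%N.
Proof.
move=> h; rewrite /unstopped -sum1dep_card.
under [RHS]eq_bigr => i _ do rewrite -sum1dep_card.
rewrite pair_big_dep /=.
rewrite (reindex (fun p : 'I_k * T.-tuple 'I_k => cons_tuple p.1 p.2)) /=; last first.
  exists (fun w => (thead w, behead_tuple w)) => [[i w] _|w _] /=.
    by rewrite /thead (tnth_nth i) /=; congr (_, _); apply: val_inj.
  by rewrite [RHS](tuple_eta w); apply: val_inj.
by apply: eq_bigl => -[i w] /=; rewrite leNgt h.
Qed.

(** Counting index sequences instead of taking expectations: averaged over the next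
  index the dual objective gains [thr ^+ 2 / (4 * k ^ 3)] unless the violation is
  already small, so the fraction of sequences that never stop is at most the
  remaining gap over [T] such gains. *)
Lemma unstopped_bound T d : admissible mu d -> mass (scl d) = 1 ->
  T%:R * (thr ^+ 2 / (4 * k%:R ^+ 3)) * (unstopped T d)%:R <=
  (B - dual mu d) * k%:R ^+ T.
Proof.
set c := _ / _; have kR : (0 : R) < k%:R by rewrite ltr0n.
have c0 : 0 <= c by rewrite divr_ge0 ?sqr_ge0 // mulr_ge0 ?exprn_ge0 // ltW.
elim: T d => [|T IH] d ad m1.
  by rewrite !mul0r mulr1 subr_ge0 (dual_le k0 mu1 etaC).
case: (leP (total d) thr) => h.
  rewrite unstopped_stop // mulr0 mulr_ge0 ?exprn_ge0 ?(ltW kR) // subr_ge0.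
  exact: (dual_le k0 mu1 etaC).
rewrite unstoppedS // natr_sum mulr_sumr.
have step i : T.+1%:R * c * (unstopped T (upd d i))%:R <=
    (B - dual mu (upd d i) + c) * k%:R ^+ T.
  rewrite -[T.+1]addn1 natrD 2!mulrDl mul1r [leRHS]mulrDl; apply: lerD.
    by apply: IH; [exact: admissible_upd | exact: mass_upd].
  by rewrite ler_wpM2l // -natrX ler_nat unstopped_le.
apply: le_trans (ler_sum _ (fun i _ => step i)) _.
rewrite -mulr_suml exprS mulrA ler_wpM2r ?exprn_ge0 ?(ltW kR) //.
rewrite big_split sumrB /= !sumr_const !card_ord -[B *+ k]mulr_natl -[c *+ k]mulr_natl.
have gain : \sum_i (dual mu d + violation C mu eta d i ^+ 2 / 4) <= \sum_i dual mu (upd d i).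
  by apply: ler_sum => i _; exact: dual_incr.
have viol2 : k%:R * c <= \sum_i violation C mu eta d i ^+ 2 / 4.
  have [i hi] := some_violation k0 h.
  apply: (@le_trans _ _ (violation C mu eta d i ^+ 2 / 4)); last first.
    rewrite (bigD1 i) //= lerDl sumr_ge0 // => i' _.
    by rewrite divr_ge0 ?sqr_ge0.
  have -> : k%:R * c = (thr / k%:R) ^+ 2 / 4 by rewrite /c; field; rewrite gt_eqF.
  rewrite ler_wpM2r ?invr_ge0 // lerXn2r ?nnegrE ?violation_ge0 //; last exact: ltW.
  by rewrite divr_ge0 // ltW.
move: gain; rewrite big_split /= sumr_const card_ord -[dual mu d *+ k]mulr_natl.
by lra.
Qed.

Lemma random_convergence T (delta : R) : 0 < delta ->
  k%:R * ln n%:R + 2 * B <= T%:R * (thr ^+ 2 / (4 * k%:R ^+ 3)) * delta -> (0 < T)%N ->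
  (1 - delta) * k%:R ^+ T.+1 <=
  #|[set w : T.+1.-tuple 'I_k | `[< exists2 t, (t <= T)%N &
       total (sinkhorn_iter C mu eta (take t.+1 w)) <= thr >]]|%:R.
Proof.
set c := _ / _ => d0 Tb T0; have kR : (0 : R) < k%:R by rewrite ltr0n.
have c0 : 0 < c by rewrite divr_gt0 ?exprn_gt0 // mulr_gt0 ?exprn_gt0.
have TR : (0 : R) < T%:R by rewrite ltr0n.
pose d1 i := upd (fun _ _ => 1) i.
pose A := [set w : T.+1.-tuple 'I_k | ~~ stops (d1 (thead w)) (behead w)].
have cardA : #|A| = (\sum_i unstopped T (d1 i))%N.
  rewrite /unstopped -sum1dep_card.
  under [RHS]eq_bigr => i _ do rewrite -sum1dep_card.
  rewrite pair_big_dep /=.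
  rewrite (reindex (fun p : 'I_k * T.-tuple 'I_k => cons_tuple p.1 p.2)) /=; last first.
    exists (fun w => (thead w, behead_tuple w)) => [[i w] _|w _] /=.
      by rewrite /thead (tnth_nth i) /=; congr (_, _); apply: val_inj.
    by rewrite [RHS](tuple_eta w); apply: val_inj.
  by apply: eq_bigl => -[i w] /=; rewrite /thead (tnth_nth i).
have small i : (unstopped T (d1 i))%:R <= delta * k%:R ^+ T.
  have ad0 : admissible mu (fun _ _ => 1) by [].
  have ad : admissible mu (d1 i) by exact: admissible_upd.
  have m1 : mass (scl (d1 i)) = 1 by exact: mass_upd.
  have := unstopped_bound T ad m1.
  have lo := dual_first k0 mu1 etaC i.
  rewrite -/c -/(d1 i) => h.
  rewrite -(ler_pM2l (mulr_gt0 TR c0)); apply: le_trans h _.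
  rewrite mulrA ler_wpM2r ?exprn_ge0 ?(ltW kR) //.
  by apply: le_trans Tb; move: lo; rewrite -/(d1 i); lra.
have AR : #|A|%:R <= delta * k%:R ^+ T.+1.
  rewrite cardA natr_sum; apply: le_trans (ler_sum _ (fun i _ => small i)) _.
  by rewrite sumr_const card_ord -[X in X <= _]mulr_natl exprS mulrCA.
have cover : (k ^ T.+1 <= #|A| + #|[set w : T.+1.-tuple 'I_k | `[< exists2 t, (t <= T)%N &
       (total (sinkhorn_iter C mu eta (take t.+1 w)) <= thr)%R >]]|)%N.
  rewrite -[X in (X <= _)%N](_ : #|{: T.+1.-tuple 'I_k}| = _); last first.
    by rewrite card_tuple card_ord.
  rewrite -(cardC A) leq_add2l; apply: subset_leq_card; apply/fintype.subsetP => w.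
  rewrite !inE negbK => /stopsP[t ts ht].
  exists t.
    by move: ts; rewrite size_behead size_tuple.
  by move: ht; rewrite [in X in _ -> X](tuple_eta w).
move: cover; rewrite -(ler_nat R) natrD natrX => cover.
by move: AR cover; rewrite mulrBl mul1r; lra.
Qed.

End RandomSinkhorn.

(** * Accuracy of the rounded Sinkhorn output *)

Section Accuracy.
Variables (R : realType) (n k : nat) (C : tensor R n k) (mu : 'I_k -> 'I_n -> R).
Variables (eta : R).
Hypotheses (k0 : (0 < k)%N) (mu1 : forall i, in_simplex (mu i)).
Implicit Types (d : 'I_k -> 'I_n -> R) (i : 'I_k) (j : 'I_n) (jj : midx n k).
Implicit Types P Q : tensor R n k.

Local Notation scl d := (scaled C d eta).

Lemma scaled_round d i : scl (round_update C mu eta d i) = trim mu (scl d) i.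
Proof.
apply/funext => jj; rewrite /trim /scaled [RHS]mulrAC; congr (_ * _).
rewrite (bigD1 i) //= [in RHS](bigD1 i) //= /round_update eqxx [LHS]mulrAC.
by congr (_ * _ * _); apply: eq_bigr => i' /negPf ->.
Qed.

Lemma scaled_rounded d : scl (rounded C mu eta d) = trims mu (scl d) (enum 'I_k).
Proof.
rewrite /rounded /trims; elim: (enum _) d => //= i s IH d.
by rewrite IH scaled_round.
Qed.

Lemma residual_ge0 d i j : (forall i j, MARG C d eta i j <= mu i j) ->
  0 <= residual C mu eta d i j.
Proof.
move=> le; rewrite /residual; case: ifP => _; last by rewrite subr_ge0.
by rewrite divr_ge0 ?subr_ge0 // exprn_ge0 // sumr_ge0.
Qed.

Lemma implicit_fill d : (forall i j, MARG C d eta i j <= mu i j) ->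
  implicit_tensor C eta d (residual C mu eta d) = fill mu (scl d).
Proof.
move=> le; apply/funext => jj; rewrite /implicit_tensor /fill; congr (_ + _).
pose o := Ordinal k0.
rewrite (bigD1 o) //= [in RHS](bigD1 o) //= {1}/residual /= [RHS]mulrAC.
have -> : \sum_j `|mu o j - MARG C d eta o j| = 1 - mass (scl d).
  rewrite -(sum_residual mu1 (scl d) o); apply: eq_bigr => j _.
  by rewrite ger0_norm // subr_ge0.
congr (_ * _); apply: eq_bigr => i io; rewrite /residual.
by rewrite -[0%N]/(val o) (inj_eq val_inj) (negPf io).
Qed.

(** The logarithm of an entry is [- eta] times the cost plus a sum of functions of
  single coordinates, whose average depends on the marginals only; what is left is
  the entropy, at most [k ln n]. *)
Lemma gibbs_optimal d Q : (0 < n)%N -> (forall i j, 0 <= d i j) -> mass (scl d) = 1 ->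
  (forall jj, 0 <= Q jj) -> (forall i j, marg Q i j = marg (scl d) i j) ->
  eta * inner C (scl d) <= eta * inner C Q + k%:R * ln n%:R.
Proof.
move=> n0 d0 m1 Q0 QP; set P := scl d in m1 QP *.
have P0 jj : 0 <= P jj by exact: scaled_ge0.
pose phi jj := \sum_i ln (d i (jj i)).
have phiE T : (forall jj, 0 <= T jj) -> (forall jj, 0 < T jj -> forall i, 0 < d i (jj i)) ->
    eta * inner C T = \sum_jj T jj * phi jj - \sum_jj T jj * ln (P jj).
  move=> T0 Td; rewrite /inner mulr_sumr -sumrB; apply: eq_bigr => jj _.
  have := T0 jj; rewrite le_eqVlt => /predU1P[<-|Tp]; first by rewrite !mul0r !mulr0 subrr.
  by rewrite ln_scaled; [rewrite -/(phi jj); ring | exact: Td].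
have dpos jj : 0 < P jj -> forall i, 0 < d i (jj i).
  move=> Pp i; rewrite lt_neqAle d0 andbT eq_sym; apply/eqP => di.
  by move: Pp; rewrite /P /scaled (bigD1 i) //= di !mul0r ltxx.
have dposQ jj : 0 < Q jj -> forall i, 0 < d i (jj i).
  move=> Qp i; rewrite lt_neqAle d0 andbT eq_sym; apply/eqP => di.
  have := entry_le_marg jj i Q0; rewrite QP leNgt => /negP; apply.
  rewrite /marg big1 // => jj' /eqP jji.
  by rewrite /P /scaled (bigD1 i) //= jji di !mul0r.
rewrite (phiE P) // (phiE Q) //.
have phi_eq : \sum_jj P jj * phi jj = \sum_jj Q jj * phi jj.
  rewrite /phi; under eq_bigr => jj _ do rewrite mulr_sumr.
  under [RHS]eq_bigr => jj _ do rewrite mulr_sumr.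
  rewrite exchange_big [RHS]exchange_big /=; apply: eq_bigr => i _.
  rewrite !(sum_coord _ i (fun j => ln (d i j))).
  by apply: eq_bigr => j _; rewrite QP.
have Pln jj : 0 < P jj -> ln (P jj) <= 0.
  by move=> Pp; apply: ln_le0 => //; rewrite -m1; exact: entry_le_mass.
have Qln : \sum_jj Q jj * ln (P jj) <= 0.
  apply: sumr_le0 => jj _; have := Q0 jj; rewrite le_eqVlt => /predU1P[<-|Qp].
    by rewrite mul0r.
  rewrite pmulr_rle0 // Pln // mulr_gt0 ?expR_gt0 // prodr_gt0 // => i _.
  exact: dposQ.
have nk : (0 : R) < (n%:R ^+ k)^-1 by rewrite invr_gt0 exprn_gt0 // ltr0n.
have ent : - (k%:R * ln n%:R) <= \sum_jj P jj * ln (P jj).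
  have step jj : P jj - (n%:R ^+ k)^-1 - P jj * (k%:R * ln n%:R) <= P jj * ln (P jj).
    have := P0 jj; rewrite le_eqVlt => /predU1P[<-|Pp].
      by rewrite !mul0r subr0 sub0r oppr_le0 ltW.
    have -> : ln (P jj) = ln (P jj / (n%:R ^+ k)^-1) - k%:R * ln n%:R.
      by rewrite invrK lnM ?posrE ?exprn_gt0 ?ltr0n // lnXn ?ltr0n // mulr_natl addrK.
    by rewrite mulrBr lerD2r; apply: entropy_ge; rewrite ?(ltW Pp) ?(ltW nk).
  apply: le_trans (ler_sum _ (fun jj _ => step jj)).
  rewrite !sumrB -mulr_suml -/(mass P) m1 mul1r sumr_const card_ffun !card_ord.
  rewrite -[X in 1 - X]mulr_natl natrX divff ?subrr ?sub0r //.
  by rewrite expf_neq0 // pnatr_eq0 -lt0n.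
by rewrite phi_eq; lra.
Qed.

(** A competitor [Q] is first moved to the marginals of the unrounded iterate, at
  cost [2 * c * thr]; the iterate nearly beats it by [gibbs_optimal]; rounding the
  iterate costs another [2 * c * thr]. *)
Lemma sinkhorn_accuracy d (c thr : R) :
  (forall jj, `|C jj| <= c) -> admissible mu d -> mass (scl d) = 1 ->
  total_violation C mu eta d <= thr ->
  let d' := rounded C mu eta d in
  let P := implicit_tensor C eta d' (residual C mu eta d') in
  [/\ feasible mu P, forall i j, 0 <= d' i j /\ 0 <= residual C mu eta d' i j,
      forall jj, in_support mu jj -> 0 < P jj &
      0 < eta -> forall Q, feasible mu Q ->
        inner C P <= inner C Q + 4 * c * thr + k%:R * ln n%:R / eta].
Proof.
move=> Cc ad m1 tv d' P.
have mu0 i j : 0 <= mu i j by case: (mu1 i).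
have S0 jj : 0 <= scl d jj by exact: admissible_ge0 ad.
have [h1 h2 h3] := trims_spec mu0 (enum 'I_k) S0.
have sd' : scl d' = trims mu (scl d) (enum 'I_k) by exact: scaled_rounded.
have T0 jj : 0 <= trims mu (scl d) (enum 'I_k) jj by case/andP: (h1 jj).
have le i j : MARG C d' eta i j <= mu i j.
  by rewrite /MARG sd'; apply: h2; rewrite mem_enum.
have PE : P = fill mu (scl d') by exact: implicit_fill.
have le' i j : marg (scl d') i j <= mu i j by exact: le.
have T0' jj : 0 <= scl d' jj by rewrite sd'.
have [feas dist] := rounding_close mu0 k0 mu1 S0 m1.
have c0 : 0 <= c.
  have [j _] := support_point mu1 (Ordinal k0).
  by apply: le_trans (Cc [ffun=> j]); exact: normr_ge0.
split.
- by rewrite PE sd'.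
- move=> i j; split; last exact: residual_ge0.
  have d'0 : forall s e, (forall i j, 0 <= e i j) ->
      forall i j, 0 <= foldl (round_update C mu eta) e s i j.
    elim=> //= i' s IH e e0; apply: IH => i'' j''.
    rewrite /round_update; case: eqP => // _; apply: mulr_ge0 => //.
    rewrite le_min ler01 /= divr_ge0 //; apply: marg_ge0 => jj.
    exact: scaled_ge0.
  by apply: d'0 => i' j'; case: (ad i' j').
- move=> jj js; rewrite PE; apply: (lt_le_trans _ (fill_ge mu1 le' jj k0)).
  by rewrite sd'; apply: trims_gt0 => //; exact: scaled_gt0.
- move=> eta0 Q fQ; have [Q0 Qm] := fQ.
  have mQ := feasible_mass (mu1 (Ordinal k0)) fQ.
  have nu0 i j : 0 <= marg (scl d) i j by exact: marg_ge0.
  have nu1 i : in_simplex (marg (scl d) i) by split=> //; rewrite sum_marg.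
  have [[Q'0 Q'm] distQ] := rounding_close nu0 k0 nu1 Q0 mQ.
  set Q' := fill _ _ in Q'0 Q'm distQ.
  have gapQ : \sum_i gap (marg (scl d)) Q i = total_violation C mu eta d.
    apply: eq_bigr => i _; apply: eq_bigr => j _; rewrite Qm distrC; by [].
  have n0 : (0 < n)%N by exact: (n_gt0 k0 mu1).
  have opt := gibbs_optimal n0 (fun i j => (ad i j).1) m1 Q'0 Q'm.
  have opt' : inner C (scl d) <= inner C Q' + k%:R * ln n%:R / eta.
    rewrite -(ler_pM2l eta0) mulrDr; apply: le_trans opt _.
    by rewrite lerD2l mulrCA divff ?mulr1 // gt_eqF.
  have i1 := inner_dist1 P (scl d) Cc.
  have i2 := inner_dist1 Q' Q Cc.
  rewrite PE sd' in i1 *.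
  have e1 : c * dist1 (fill mu (trims mu (scl d) (enum 'I_k))) (scl d) <= c * (2 * thr).
    apply: ler_wpM2l => //; apply: le_trans dist _; exact: ler_wpM2l.
  have e2 : c * dist1 Q' Q <= c * (2 * thr).
    apply: ler_wpM2l => //; apply: le_trans distQ _; rewrite gapQ; exact: ler_wpM2l.
  by move: i1 i2 e1 e2 opt'; lra.
Qed.

End Accuracy.

(** * Program blocks *)

Section Blocks.
Variable R : realType.
Implicit Types (st : store R) (Q : store R -> Prop).

Lemma wp_seq N c1 c2 Q st : wp N c1 (wp N c2 Q) st -> wp N (PSeq c1 c2) Q st.
Proof. by []. Qed.

Lemma wp_nat N x e Q st : Q (set_nvar st x (neval st e)) -> wp N (PNat x e) Q st.
Proof. by []. Qed.

Lemma wp_real N a xs E x Q st :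
  xval N st E x -> Q (set_rarr st a (address st xs) x) -> wp N (PReal a xs E) Q st.
Proof. by move=> [b <-]. Qed.

Lemma wp_if N E1 E2 c1 c2 x y Q st : xval N st E1 x -> xval N st E2 y ->
  (if x <= y then wp N c1 Q st else wp N c2 Q st) -> wp N (PIf E1 E2 c1 c2) Q st.
Proof. by move=> [b1 <-] [b2 <-]. Qed.

Lemma same_nvar st x p : same [:: x] [::] [::] st (set_nvar st x p).
Proof. by split=> //= y; rewrite inE => /negPf ->. Qed.

Lemma same_rarr st a l x : same [::] [::] [:: a] st (set_rarr st a l x).
Proof. by split=> //= b; rewrite inE => /negPf h l' /=; rewrite h. Qed.

Definition XAdd := XBin OAdd.
Definition XSub := XBin OSub.
Definition XMul := XBin OMul.
Definition XDiv := XBin ODiv.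
Definition XN m := XNat (NCst m).
Definition XV x := XNat (NVar x).
Definition XC a := XGet a [::].
Definition XA1 a x := XGet a [:: NVar x].
Definition XA2 a x y := XGet a [:: NVar x; NVar y].
Definition XAbs E := XIfR X0 E E (XSub X0 E).

Lemma xval_abs N st E x : xval N st E x -> xval N st (XAbs E) `|x|.
Proof.
move=> v; apply: xval_eq.
  by apply: xval_ifR; [exact: xval_nat | exact: v | exact: v |
    apply: xval_bin; [exact: xval_nat | exact: v]].
by rewrite /= sub0r; case: (lerP 0 x) => [/ger0_norm|/ltr0_norm].
Qed.

(** The machine cannot round, so the variable [m] counts up to the first natural
  above the real cell [a]. *)
Definition PCeil (m f a : nat) : prog :=
  PSeq (PNat m (NCst 0)) (PSeq (PNat f (NCst 1))
    (PWhile (NCst 1) (NVar f)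
       (PIf (XV m) (XC a) (PNat m (NAdd (NVar m) (NCst 1))) (PNat f (NCst 0))))).

Lemma wp_ceil N m f a x Q st : (m == f) = false ->
  rarr st a [::] = x -> 0 <= x -> ((Num.truncn x).+2 <= N)%N ->
  (forall st', same [:: m; f] [::] [::] st st' -> nvar st' m = (Num.truncn x).+1 -> Q st') ->
  wp N (PCeil m f a) Q st.
Proof.
move=> mf ax x0 xN HQ; rewrite /PCeil /=.
have fm : (f == m) = false by rewrite eq_sym.
set X := (Num.truncn x).+1.
change (wp N (PWhile (NCst 1) (NVar f)
       (PIf (XV m) (XC a) (PNat m (NAdd (NVar m) (NCst 1))) (PNat f (NCst 0)))) Q
    (set_nvar (set_nvar st m 0) f 1)).
pose Inv t st' := same [:: m; f] [::] [::] st st' /\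
  ((nvar st' f = 1 /\ nvar st' m = t /\ (t <= X)%N) \/
   (nvar st' f = 0 /\ nvar st' m = X /\ t = X.+1))%N.
apply: (wp_while (Inv := Inv)).
- split; last by left; rewrite /= mf !eqxx.
  by split=> //= y; rewrite !inE negb_or => /andP[/negPf -> /negPf ->].
- move=> t st' [ss [[f1 [m1 tX]]|[f0 _]]]; last by rewrite /= f0.
  move=> _; split; first by rewrite /X in tX *; lia.
  have [s1 s2 s3] := ss.
  apply: (wp_if (x := t%:R) (y := x)).
  + by rewrite -m1; exact: xval_nat.
  + by apply: xval_get; [|rewrite s3].
  case: (lerP t%:R x) => tx; (split; first last).
  + left; rewrite /= eqxx fm f1 m1 addn1; split=> //; split=> //.
    have := truncn_le x; have := truncnS_gt x; rewrite -/X => h1 h2.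
    by rewrite -(ltr_nat R); exact: le_lt_trans tx h1.
  + apply: (same_trans ss); split=> //= y; rewrite !inE negb_or.
    by case/andP=> /negPf ->.
  + right; rewrite /= eqxx mf m1.
    have tE : t = X.
      apply/eqP; rewrite eqn_leq tX /= ltnNge; apply/negP => h.
      move: tx; rewrite ltNge => /negP; apply.
      apply: le_trans (_ : (Num.truncn x)%:R <= x); first by rewrite ler_nat.
      by rewrite truncn_le.
    by rewrite tE.
  + apply: (same_trans ss); split=> //= y; rewrite !inE negb_or.
    by case/andP=> _ /negPf ->.
- move=> t st' [ss [[f1 _]|[f0 [mX _]]]] tN /=; first by rewrite f1.
  by move=> _; apply: HQ.
Qed.

End Blocks.

Section MargBlock.
Variables (R : realType) (r : nat) (I : instance R r) (eps : R) (tape : seq 'I_(nmarg I)).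
Variable N : nat.
Implicit Types (st : store R) (Q : store R -> Prop).
Local Notation n := (side I).
Local Notation k := (nmarg I).
Hypotheses (rN : (r <= N)%N) (kN : (k <= N)%N) (nN : (n <= N)%N) (sN : (spars I <= N)%N).
Hypothesis inj : injective (spos I).

Definition PMARG : prog :=
  PFor 5 (NVar 1) (PFor 6 (NVar 0) (PReal 7 [:: 5; 6]%N (MARGX r))).

Definition holds_mat st (a : nat) (d : 'I_k -> 'I_n -> R) : Prop :=
  forall i j, rarr st a [:: val i; val j] = d i j.

Lemma holds_mat_same xs bs rs st st' a d :
  a \notin rs -> same xs bs rs st st' -> holds_mat st a d -> holds_mat st' a d.
Proof. by move=> ars [_ _ s3] h i j; rewrite s3. Qed.

Lemma wp_marg m th (d : 'I_k -> 'I_n -> R) st Q :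
  loaded I eps tape st -> nvar st 3 = m -> (m < N)%N -> rarr st 6 [::] = th ->
  holds_mat st 5 d ->
  (forall st', same [:: 5; 6]%N [::] [:: 7]%N st st' ->
     holds_mat st' 7 (marg (fun jj => \prod_i d i (jj i) * gibbs I m th jj)) -> Q st') ->
  wp N PMARG Q st.
Proof.
move=> ld m3 mN th6 d5 HQ.
have k1 : nvar st 1 = k by case: ld => _ [].
have n0 : nvar st 0 = n by case: ld.
pose F (i j : nat) : R := if insub i is Some i' then if insub j is Some j' then
   marg (fun jj => \prod_i d i (jj i) * gibbs I m th jj) i' j' else 0 else 0.
apply: (wp_fill2 (Bx := k) (By := n) (f := F)) => //.
  move=> i j st' iB jB ss i5 j6 _.
  rewrite /F !insubT.
  apply: (xval_MARGX (eps := eps) (tape := tape)) => //.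
  have [s1 s2 s3] := ss.
  split; first exact: loaded_same ss ld.
  - by rewrite s1.
  - by rewrite i5 j6 !SubK.
  - by rewrite s3.
  - by move=> i' j'; rewrite s3.
move=> st' ss h; apply: HQ => // i j.
by have := h i j (ltn_ord i) (ltn_ord j); rewrite /F !valK.
Qed.

End MargBlock.

(** * Sinkhorn on low-rank plus sparse costs *)

Section Surrogate.
Variables (R : realType) (r : nat) (I : instance R r) (eps : R) (K : nat).
Local Notation n := (side I).
Local Notation k := (nmarg I).
Local Notation eta := (sinkhorn_eta n k (eps / 2)).
Hypotheses (eps0 : 0 < eps) (k0 : (0 < k)%N) (n0 : (0 < n)%N).
Hypothesis RK : forall jj, `|low_rank_part I jj| <= K%:R * Cmax I.

(** Sufficient for [compound_ge]; written as a product so that the program computes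
  literally this expression. *)
Definition degree_bound (x : R) : R := 16 * ((x + 1) * (x + 1)).
Definition degree_of (x : R) : nat := (Num.truncn (degree_bound x)).+1.

Lemma degree_bound_ge0 x : 0 <= x -> 0 <= degree_bound x.
Proof. by move=> x0; rewrite /degree_bound; nra. Qed.

Lemma degree_ofP x : 0 <= x -> 16 * (x + 1) ^+ 2 <= (degree_of x)%:R.
Proof.
by move=> x0; rewrite expr2; apply: ltW; exact: truncnS_gt.
Qed.

Lemma gibbs_bounds th X jj : `|th * low_rank_part I jj| <= X ->
  let g := gibbs I (degree_of X) th jj in
  expR (- (th * cost I jj) - 1 / 8) <= g <= expR (- (th * cost I jj)).
Proof.
move=> hX /=; have X0 : 0 <= X by exact: le_trans hX.
have dP := degree_ofP X0; rewrite /gibbs /cost mulrDr opprD.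
set m := degree_of X in dP *; set x := th * low_rank_part I jj in hX *.
have -> : - x - th * sparse_part I jj - 1 / 8 = (- x - 1 / 8) - th * sparse_part I jj by ring.
rewrite !(expRD _ (- (th * _))) -[- (x / m%:R)]mulNr.
have m0 : (0 < m)%N by [].
have hX' : `|- x| <= X by rewrite normrN.
apply/andP; split; rewrite ler_wpM2r ?expR_ge0 //; first exact: compound_ge dP.
apply: compound_le => //; rewrite lerN2.
apply: le_trans (ler_norm _) (le_trans hX _); apply: le_trans dP; nra.
Qed.

Lemma gibbs_base_gt0 th X jj : `|th * low_rank_part I jj| <= X ->
  0 < 1 - th * low_rank_part I jj / (degree_of X)%:R.
Proof.
move=> hX; have X0 : 0 <= X by exact: le_trans hX.
have m0 : (0 : R) < (degree_of X)%:R by rewrite ltr0n.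
rewrite subr_gt0 ltr_pdivrMr // mul1r; apply: le_lt_trans (ler_norm _) (le_lt_trans hX _).
apply: lt_le_trans (degree_ofP X0); nra.
Qed.

Definition sink_range : R := eta * (K%:R * Cmax I).
Definition sink_degree : nat := degree_of sink_range.

(** The cost whose Gibbs kernel at inverse temperature [eta] is exactly the kernel
  [gibbs].  SINKHORN runs on this cost without error, and it stays close to the
  true one.  If [eta = 0], which means [n = 1], every cost has the same kernel. *)
Definition surrogate : tensor R n k := fun jj =>
  if eta <= 0 then cost I jj else
  sparse_part I jj - sink_degree%:R / eta *
    ln (1 - eta * low_rank_part I jj / sink_degree%:R).

Lemma eta_ge0 : 0 <= eta.
Proof.
rewrite /sinkhorn_eta divr_ge0 //; last by rewrite divr_ge0 // ltW.
by rewrite mulr_ge0 ?mulr_ge0 // ln_ge0 // ler1n.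
Qed.

Lemma etaR jj : `|eta * low_rank_part I jj| <= sink_range.
Proof. by rewrite normrM ger0_norm ?eta_ge0 // ler_wpM2l ?eta_ge0. Qed.

Lemma eta_eq : eta = 4 * (k%:R * ln n%:R) / eps.
Proof. by rewrite /sinkhorn_eta; field; rewrite gt_eqF. Qed.

Lemma eta_gt0 : (1 < n)%N -> 1 <= eta * eps.
Proof.
move=> n1; rewrite eta_eq divfK ?gt_eqF //.
have k1 : (1 : R) <= k%:R by rewrite ler1n.
have h2 : (2 : R) <= n%:R by rewrite ler_nat.
have : 1 / 2 <= ln (n%:R : R).
  apply: (@le_trans _ _ (ln 2)); last by rewrite ler_ln ?posrE // ltr0n.
  have := @ln_le_sub1 R 2^-1 ltac:(by []); rewrite lnV ?posrE //; lra.
set L := ln _ => hL; nra.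
Qed.

Lemma gibbs_surrogate jj : expR (- eta * surrogate jj) = gibbs I sink_degree eta jj.
Proof.
rewrite /surrogate /gibbs; case: (lerP eta 0) => h.
  have -> : eta = 0 by apply/eqP; rewrite eq_le h eta_ge0.
  by rewrite oppr0 !mul0r subr0 expr1n oppr0 mul1r.
have b0 := gibbs_base_gt0 (etaR jj); rewrite -/sink_degree in b0 *.
set b := 1 - _ in b0 *.
have -> : - eta * (sparse_part I jj - sink_degree%:R / eta * ln b) =
    sink_degree%:R * ln b - eta * sparse_part I jj by field; rewrite gt_eqF.
by rewrite expRD expRM_natl lnK ?posrE.
Qed.

Lemma surrogate_close jj : `|cost I jj - surrogate jj| <= eps / 8.
Proof.
case: (lerP eta 0) => h.
  rewrite /surrogate h subrr normr0; by rewrite divr_ge0 // ltW.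
have n1 : (1 < n)%N.
  rewrite ltn_neqAle n0 andbT; apply: contraL h => /eqP n1.
  by rewrite -leNgt eta_eq -n1 ln1 !mulr0 mul0r.
have := gibbs_bounds (etaR jj); rewrite /= -/sink_degree -gibbs_surrogate !ler_expR mulNr.
have := eta_gt0 n1; set e := eta in h *; set c := cost I jj; set s := surrogate jj.
move=> ee /andP[h1 h2].
rewrite -(ler_pM2l h) -{1}(gtr0_norm h) -normrM ler_norml mulrBr mulrA.
by apply/andP; split; lra.
Qed.

End Surrogate.
Arguments surrogate {R r} I eps K jj.
Arguments sink_degree {R r} I eps K.
Arguments sink_range {R r} I eps K.

(** Variable 9 receives the index to update; variable 12 is the counter of the round
  robin, array 8 holds the violations, and the tape is read at position 8. *)
Definition PChoose (rule : update_rule) : prog :=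
  match rule with
  | RoundRobin => PSeq (PNat 9 (NVar 12)) (PSeq (PNat 12 (NAdd (NVar 12) (NCst 1)))
       (PIf (XV 1) (XV 12) (PNat 12 (NCst 0)) PSkip))
  | Greedy => PArgmax 9 11 1 8
  | Random => PNat 9 (NGet 1 [:: 8]%N)
  end.

Definition PEta : prog :=
  PReal 6 [::] (XDiv (XMul (XMul (XN 2) (XV 1)) (XLn (XV 0))) (XDiv (XC 4) (XN 2))).

Definition PDegree (K : nat) : prog :=
  PSeq (PReal 11 [::] (XMul (XC 6) (XMul (XN K) (XC 3))))
  (PSeq (PReal 11 [::] (XMul (XN 16) (XMul (XAdd (XC 11) X1) (XAdd (XC 11) X1))))
     (PCeil 3 10 11)).

Definition PViolation (r : nat) : prog :=
  PSeq (PMARG r)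
  (PSeq (PFor 7 (NVar 1) (PReal 8 [:: 7]%N
     (XSum 20 (NVar 0) (XAbs (XSub (XA2 0 7 20) (XA2 7 7 20))))))
  (PReal 9 [::] (XSum 20 (NVar 1) (XA1 8 20)))).

(** The first update is unconditional, so that the iterate has mass 1 whenever the
  violation (cell 9) is compared with the threshold (cell 10). *)
Definition PSinkhornLoop (r : nat) (rule : update_rule) : prog :=
  PSeq (PNat 10 (NCst 1))
  (PWhile (NCst 1) (NVar 10)
    (PSeq (PChoose rule)
    (PSeq (PFor 6 (NVar 0) (PReal 5 [:: 9; 6]%N
       (XMul (XA2 5 9 6) (XDiv (XA2 0 9 6) (XA2 7 9 6)))))
    (PSeq (PNat 8 (NAdd (NVar 8) (NCst 1)))
    (PSeq (PViolation r)
      (PIf (XC 9) (XC 10) (PNat 10 (NCst 0)) (PNat 10 (NCst 1)))))))).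

Definition PRound (r : nat) : prog :=
  PFor 7 (NVar 1)
   (PSeq (PMARG r)
     (PFor 6 (NVar 0) (PReal 5 [:: 7; 6]%N
       (XMul (XA2 5 7 6) (XBin OMin X1 (XDiv (XA2 0 7 6) (XA2 7 7 6))))))).

Definition PResidual : prog :=
  PFor 5 (NVar 1) (PFor 6 (NVar 0) (PReal 12 [:: 5; 6]%N
    (XIfEq (NVar 5) (NCst 0)
       (XDiv (XSub (XA2 0 5 6) (XA2 7 5 6))
         (XProd 22 (NSub (NVar 1) (NCst 1))
            (XSum 21 (NVar 0) (XAbs (XSub (XA2 0 5 21) (XA2 7 5 21))))))
       (XSub (XA2 0 5 6) (XA2 7 5 6))))).

Definition PCopy2 (a b : nat) : prog :=
  PFor 5 (NVar 1) (PFor 6 (NVar 0) (PReal a [:: 5; 6]%N (XA2 b 5 6))).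

Definition PSinkhorn (r K : nat) (rule : update_rule) : prog :=
  PSeq PEta (PSeq (PDegree K)
  (PSeq (PReal 10 [::] (XDiv (XC 4) (XMul (XN 8) (XAdd (XC 3) (XC 4)))))
  (PSeq (PNat 8 (NCst 0)) (PSeq (PNat 12 (NCst 0))
  (PSeq (PFor 5 (NVar 1) (PFor 6 (NVar 0) (PReal 5 [:: 5; 6]%N X1)))
  (PSeq (PViolation r)
  (PSeq (PSinkhornLoop r rule)
  (PSeq (PRound r)
  (PSeq (PMARG r)
  (PSeq PResidual
  (PSeq (PCopy2 0 5) (PCopy2 1 12)))))))))))).

Definition PEvaluate (r K : nat) : prog :=
  PSeq PEta (PSeq (PDegree K)
   (PReal 0 [::]
     (XIfR (XC 6) X0
        (XAdd (RX r (NGet 2 [:: 20]%N)) (SX (NGet 2 [:: 20]%N)))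
        (XSub (SX (NGet 2 [:: 20]%N))
           (XMul (XDiv (XV 3) (XC 6)) (XLn (BASEX r (NGet 2 [:: 20]%N)))))))).

Section SinkhornProgram.
Variables (R : realType) (r : nat) (I : instance R r) (eps : R) (tape : seq 'I_(nmarg I)).
Variables (K N : nat) (rule : update_rule).
Implicit Types (st : store R) (Q : store R -> Prop) (d : 'I_(nmarg I) -> 'I_(side I) -> R).
Local Notation n := (side I).
Local Notation k := (nmarg I).
Local Notation eta := (sinkhorn_eta n k (eps / 2)).
Local Notation mu := (target I).
Local Notation m := (sink_degree I eps K).
Local Notation Ct := (surrogate I eps K).
Hypotheses (eps0 : 0 < eps) (k0 : (0 < k)%N) (n0 : (0 < n)%N).
Hypothesis RK : forall jj, `|low_rank_part I jj| <= K%:R * Cmax I.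
Hypothesis inj : injective (spos I).
Hypotheses (rN : (r <= N)%N) (kN : (k <= N)%N) (nN : (n <= N)%N) (sN : (spars I <= N)%N).
Hypothesis mN : (m < N)%N.

(** Small enough that rounding, which costs four times the largest cost times the
  violation, accounts for at most [eps / 2]. *)
Definition sink_thr : R := eps / (8 * (Cmax I + eps)).

Lemma loaded_nm st : loaded I eps tape st -> nvar st 0 = n /\ nvar st 1 = k.
Proof. by case=> -> [-> _]. Qed.

Lemma wp_eta st Q : loaded I eps tape st ->
  (forall st', same [::] [::] [:: 6]%N st st' -> rarr st' 6 [::] = eta -> Q st') ->
  wp N PEta Q st.
Proof.
move=> ld HQ; have [e0 e1] := loaded_nm ld.
apply: (wp_real (x := eta)).
  apply: xval_eq.
    apply: xval_bin; last by apply: xval_bin; [apply: xval_get | exact: xval_nat].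
    apply: xval_bin; first by apply: xval_bin; exact: xval_nat.
    by apply: xval_ln; exact: xval_nat.
  rewrite /= e0 e1; case: ld => _ [_ [_ [_ [_ [_ [_ [_ [_ ->]]]]]]]].
  by rewrite /sinkhorn_eta.
apply: HQ; first exact: same_rarr.
by [].
Qed.

Lemma wp_degree st Q : loaded I eps tape st -> rarr st 6 [::] = eta ->
  (forall st', same [:: 3; 10]%N [::] [:: 11]%N st st' -> nvar st' 3 = m -> Q st') ->
  wp N (PDegree K) Q st.
Proof.
move=> ld st6 HQ; have x0 : 0 <= sink_range I eps K.
  by rewrite mulr_ge0 ?eta_ge0 // (le_trans _ (RK [ffun=> Ordinal n0])).
have c3 : rarr st 3 [::] = Cmax I by case: ld => _ [_ [_ [_ [_ [_ [_ [_ []]]]]]]].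
apply: wp_seq; apply: (wp_real (x := sink_range I eps K)).
  apply: xval_bin; first by apply: xval_get.
  by apply: xval_bin; [exact: xval_nat | apply: xval_get].
set st1 := set_rarr _ _ _ _.
apply: wp_seq; apply: (wp_real (x := degree_bound (sink_range I eps K))).
  apply: xval_bin; first exact: xval_nat.
  by apply: xval_bin; (apply: xval_bin; [apply: xval_get | exact: xval_nat]).
set st2 := set_rarr _ _ _ _.
apply: (wp_ceil (x := degree_bound (sink_range I eps K))) => //.
  exact: degree_bound_ge0.
move=> st' [s1 s2 s3] m3; apply: HQ => //; split=> // a.
  by rewrite inE => /negPf a11 l; rewrite s3 //= !a11.
Qed.

Definition sink_env st : Prop :=
  [/\ loaded I eps tape st, nvar st 3 = m, rarr st 6 [::] = eta & rarr st 10 [::] = sink_thr].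

Lemma sink_env_same xs bs rs st st' :
  [&& 0%N \notin xs, 1%N \notin xs, 2%N \notin xs & 3%N \notin xs] ->
  (0%N \notin bs) && (1%N \notin bs) ->
  [&& 0%N \notin rs, 1%N \notin rs, 2%N \notin rs, 3%N \notin rs & 4%N \notin rs] ->
  (6 \notin rs)%N && (10 \notin rs)%N ->
  same xs bs rs st st' -> sink_env st -> sink_env st'.
Proof.
move=> /and4P[x0 x1 x2 x3] b r' /andP[r6 r10] ss [ld m3 st6 st10]; have [s1 s2 s3] := ss.
split; [|by rewrite s1|by rewrite s3|by rewrite s3].
by apply: loaded_same ss ld => //; rewrite x0 x1 x2.
Qed.

Lemma MARG_gibbs d : MARG Ct d eta = marg (fun jj => \prod_i d i (jj i) * gibbs I m eta jj).
Proof.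
rewrite /MARG /scaled; congr marg; apply/funext => jj.
by rewrite gibbs_surrogate.
Qed.

Lemma wp_marg_sink d st Q : sink_env st -> holds_mat st 5 d ->
  (forall st', same [:: 5; 6]%N [::] [:: 7]%N st st' -> holds_mat st' 7 (MARG Ct d eta) -> Q st') ->
  wp N (PMARG r) Q st.
Proof.
move=> [ld m3 st6 st10] d5 HQ.
apply: (@wp_marg R r I eps tape N rN kN nN sN inj m eta d st Q) => //.
by move=> st' ss h; apply: HQ => //; rewrite MARG_gibbs.
Qed.

Definition vec_holds st (a : nat) (v : 'I_k -> R) : Prop :=
  forall i, rarr st a [:: val i] = v i.

Lemma wp_violation d st Q : sink_env st -> holds_mat st 5 d ->
  (forall st', same [:: 5; 6; 7]%N [::] [:: 7; 8; 9]%N st st' ->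
     holds_mat st' 7 (MARG Ct d eta) -> vec_holds st' 8 (violation Ct mu eta d) ->
     rarr st' 9 [::] = total_violation Ct mu eta d -> Q st') ->
  wp N (PViolation r) Q st.
Proof.
move=> env d5 HQ; apply: wp_seq; apply: (wp_marg_sink env d5) => st1 ss1 h7.
have env1 : sink_env st1 by apply: sink_env_same ss1 env.
have [ld1 _ _ _] := env1; have [e0 e1] := loaded_nm ld1.
pose F (i : nat) : R := if insub i is Some i' then violation Ct mu eta d i' else 0.
apply: wp_seq; apply: (wp_fill1 (B := k) (addr := fun i => [:: i]) (f := F)) => //.
- by move=> i st' vi _; rewrite /address /= vi.
- by move=> i j [].
- move=> i st' iB ss vi _; have ld' : loaded I eps tape st' by apply: loaded_same ss ld1.
  have [e0' _] := loaded_nm ld'; have [s1 s2 s3] := ss.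
  rewrite /F insubT.
  apply: (@xval_sum _ _ _ _ _ _ n); [exact: e0'|by []|move=> j].
  apply: xval_abs; apply: xval_bin; apply: xval_get => //=.
    rewrite vi; case: ld' => _ [_ [_ [_ [_ [h _]]]]]; exact: (h (Sub i iB) j).
  by rewrite vi s3 //; exact: (h7 (Sub i iB) j).
- move=> st2 ss2 h8 _; have ld2 : loaded I eps tape st2 by apply: loaded_same ss2 ld1.
  have [e0' e1'] := loaded_nm ld2; have [s1 s2 s3] := ss2.
  have v8 : vec_holds st2 8 (violation Ct mu eta d).
    by move=> i; have := h8 i (ltn_ord i); rewrite /F valK.
  apply: (wp_real (x := total_violation Ct mu eta d)).
    apply: (@xval_sum _ _ _ _ _ _ k); [exact: e1'|by []|move=> i].
    by apply: xval_get; last exact: v8.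
  apply: HQ.
  + exact: (same_comp (same_comp (xs := [:: 5; 6; 7]%N) (bs := [::]) (rs := [:: 7; 8]%N) ss1 ss2 isT)
      (same_rarr st2 9 [::] _)).
  + by move=> i j; rewrite /= s3 //; exact: h7.
  + exact: v8.
  + by [].
Qed.


Local Notation iter := (sinkhorn_iter Ct mu eta).
Local Notation legit := (follows_rule Ct mu rule eta tape).

(** Every update of [s] was followed by a violation above the threshold: the runs
  after which the program still iterates. *)
Definition unstopped_run (s : seq 'I_k) : Prop :=
  forall q, (q < size s)%N -> sink_thr < total_violation Ct mu eta (iter (take q.+1 s)).

Hypothesis terminates : forall s, legit s -> unstopped_run s ->
  (size s < N)%N /\ (rule = Random -> (size s < size tape)%N).

Definition sink_state (s : seq 'I_k) st : Prop :=
  [/\ sink_env st, holds_mat st 5 (iter s) /\ holds_mat st 7 (MARG Ct (iter s) eta),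
      vec_holds st 8 (violation Ct mu eta (iter s)), nvar st 8 = size s &
      rule = RoundRobin -> nvar st 12 = (size s %% k)%N].

Lemma modnS_wrap (t : nat) :
  (t.+1 %% k)%N = if (k <= (t %% k).+1)%N then 0%N else (t %% k).+1.
Proof.
have tk := ltn_pmod t k0.
rewrite {1}(divn_eq t k) -addnS modnMDl; case: ifP => h; last by rewrite modn_small ?ltnNge ?h.
by have -> : (t %% k).+1 = k by [lia]; rewrite modnn.
Qed.

Lemma legit_rcons_greedy s i : rule = Greedy -> legit s ->
  (forall i', violation Ct mu eta (iter s) i' <= violation Ct mu eta (iter s) i) ->
  legit (rcons s i).
Proof.
move=> -> /= ls mx s1 i' s2; elim/last_ind: s2 => [|s2 x _].
  by rewrite cats1 => /rcons_inj[<- <-].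
by rewrite -rcons_cons -rcons_cat => /rcons_inj[sE _]; exact: ls sE.
Qed.

Lemma wp_choose s st Q : legit s -> unstopped_run s -> sink_state s st ->
  (forall st' (i : 'I_k), same [:: 9; 11; 12]%N [::] [::] st st' -> nvar st' 9 = i ->
     legit (rcons s i) -> (rule = RoundRobin -> nvar st' 12 = ((size s).+1 %% k)%N) -> Q st') ->
  wp N (PChoose rule) Q st.
Proof.
move=> ls us [env [d5 g7] v8 t8 r12] HQ; have [ld _ _ _] := env.
have [e0 e1] := loaded_nm ld.
have [sN' sT] := terminates ls us.
case ruleE: rule => /=.
- pose i := Ordinal (ltn_pmod (size s) k0).
  have rr := r12 ruleE.
  split=> //=; rewrite rr e1 ler_nat addn1.
  have lr : legit (rcons s i).
    move: ls; rewrite ruleE /= => ls.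
    by rewrite map_rcons ls size_rcons -[(size s).+1]addn1 iotaD map_cat cats1.
  case: ifP => h; apply: (HQ _ i) => //=; try (by rewrite modnS_wrap h);
    by split=> //= y; rewrite !inE !negb_or => /and3P[/negPf h1 /negPf h2 /negPf h3]; rewrite ?h3 ?h1.
- apply: (wp_argmax (B := k)) => // st' b ss b9 bk mx.
  apply: (HQ _ (Ordinal bk)) => //; first exact: same_incl ss.
    apply: legit_rcons_greedy => // i'.
    by have := mx i' (ltn_ord i'); rewrite v8 (v8 (Ordinal bk)).
  by rewrite ruleE.
- have {}sT := sT ruleE; pose i := nth (Ordinal k0) tape (size s).
  apply: (HQ _ i).
  + by apply: same_incl (same_nvar _ _ _).
  + rewrite /= t8; case: ld => _ [_ [_ [_ [h _]]]]; rewrite h //.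
    by rewrite (nth_map (Ordinal k0)).
  + move: ls; rewrite ruleE /= => /prefixP[s' tE].
    move: sT; rewrite /i tE; case: s' {tE} => [|x s'] sT.
      by move: sT; rewrite cats0 ltnn.
    rewrite nth_cat ltnn subnn /= -cat_rcons; exact: prefix_prefix.
  + by rewrite ruleE.
Qed.

Lemma sinkhorn_iter_rcons s i : iter (rcons s i) = sinkhorn_update Ct mu eta (iter s) i.
Proof. by rewrite /sinkhorn_iter -cats1 foldl_cat. Qed.

Lemma sink_step s st (Q : store R -> Prop) : legit s -> unstopped_run s -> sink_state s st ->
  (forall st' i, legit (rcons s i) -> sink_state (rcons s i) st' ->
     ((nvar st' 10 = 1)%N /\ sink_thr < total_violation Ct mu eta (iter (rcons s i)) \/
      (nvar st' 10 = 0)%N /\ total_violation Ct mu eta (iter (rcons s i)) <= sink_thr) -> Q st') ->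
  wp N (PSeq (PChoose rule)
    (PSeq (PFor 6 (NVar 0) (PReal 5 [:: 9; 6]%N
       (XMul (XA2 5 9 6) (XDiv (XA2 0 9 6) (XA2 7 9 6)))))
    (PSeq (PNat 8 (NAdd (NVar 8) (NCst 1)))
    (PSeq (PViolation r)
      (PIf (XC 9) (XC 10) (PNat 10 (NCst 0)) (PNat 10 (NCst 1))))))) Q st.
Proof.
move=> ls us LS HQ; have [env [d5 g7] v8 t8 r12] := LS.
apply: wp_seq; apply: (wp_choose ls us LS) => st1 i ss1 i9 li rr1.
have env1 : sink_env st1 by apply: sink_env_same ss1 env.
have d5' : holds_mat st1 5 (iter s) by apply: holds_mat_same ss1 d5.
have g7' : holds_mat st1 7 (MARG Ct (iter s) eta) by apply: holds_mat_same ss1 g7.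
have [ld1 _ _ _] := env1; have [e0 e1] := loaded_nm ld1.
pose F (j : nat) : R := if insub j is Some j' then sinkhorn_update Ct mu eta (iter s) i i j' else 0.
apply: wp_seq; apply: (wp_fill1 (B := n) (addr := fun j => [:: val i; j]) (f := F)) => //.
- by move=> j st' vj h; rewrite /address /= vj h // i9.
- by move=> j1 j2 [].
- move=> j st' jB ss vj rE; have [s1 s2 s3] := ss.
  have ld' : loaded I eps tape st' by apply: loaded_same ss ld1.
  rewrite /F insubT /sinkhorn_update eqxx.
  have aE : map (neval st') [:: NVar 9; NVar 6] = [:: val i; val (Sub j jB : 'I_n)].
    by rewrite /= vj s1 // i9.
  apply: xval_bin; first by apply: xval_get aE _; rewrite rE; exact: (d5' i (Sub j jB)).
  apply: xval_bin; apply: xval_get aE _; last by rewrite s3 //; exact: g7'.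
  by case: ld' => _ [_ [_ [_ [_ [h _]]]]]; exact: h.
move=> st2 ss2 F1 F2.
have d5'' : holds_mat st2 5 (iter (rcons s i)).
  move=> i' j; rewrite sinkhorn_iter_rcons.
  have [->|ne] := eqVneq i' i; first by have := F1 j (ltn_ord j); rewrite /F valK.
  rewrite F2; first by rewrite d5' /sinkhorn_update (negPf ne).
  by move=> j' _; apply/eqP => -[/val_inj ii _]; rewrite ii eqxx in ne.
apply: wp_seq; apply: wp_nat; set st3 := set_nvar _ _ _.
have ss3 : same [:: 6; 8]%N [::] [:: 5]%N st1 st3.
  by apply: (same_comp ss2 (same_nvar st2 8 _)).
have env3 : sink_env st3 by apply: sink_env_same ss3 env1.
have d53 : holds_mat st3 5 (iter (rcons s i)) by [].
have t83 : nvar st3 8 = size (rcons s i).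
  have [s1 _ _] := ss2; have [s1' _ _] := ss1.
  by rewrite /st3 /= s1 // s1' // t8 addn1 size_rcons.
apply: wp_seq; apply: (wp_violation env3 d53) => st4 ss4 g74 v84 V94.
have env4 : sink_env st4 by apply: sink_env_same ss4 env3.
have [_ _ _ thr4] := env4.
have fin st5 : same [:: 10]%N [::] [::] st4 st5 -> sink_state (rcons s i) st5.
  move=> ss5; have ss45 := same_comp (xs := [:: 5; 6; 7; 10]%N) (bs := [::]) (rs := [:: 7; 8; 9]%N) ss4 ss5 isT.
  have [s1 s2 s3] := ss45; have [t1 t2 t3] := ss5.
  split.
  - by apply: sink_env_same ss5 env4.
  - split; first exact: holds_mat_same ss45 d53.
    exact: holds_mat_same ss5 g74.
  - by move=> i'; rewrite t3.
  - by rewrite s1.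
  - move=> re; rewrite s1 // size_rcons; have [q1 _ _] := ss3.
    by rewrite q1 // rr1.
apply: (wp_if (x := total_violation Ct mu eta (iter (rcons s i))) (y := sink_thr)).
- exact: xval_get.
- exact: xval_get.
case: lerP => h; apply: wp_nat; apply: (HQ _ i) => //.
- by apply: fin; exact: same_nvar.
- by right.
- by apply: fin; exact: same_nvar.
- by left.
Qed.

Lemma wp_sinkhorn_loop st Q : sink_state [::] st ->
  (forall st' s, legit s -> (0 < size s <= N)%N -> sink_state s st' ->
     total_violation Ct mu eta (iter s) <= sink_thr -> Q st') ->
  wp N (PSinkhornLoop r rule) Q st.
Proof.
move=> LS HQ; apply: wp_seq; apply: wp_nat; set st1 := set_nvar _ _ _.
pose Inv t st' := exists s, [/\ size s = t, legit s, sink_state s st' &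
   ((nvar st' 10 = 1)%N /\ unstopped_run s) \/
   [/\ (nvar st' 10 = 0)%N, (0 < size s)%N & total_violation Ct mu eta (iter s) <= sink_thr]].
apply: (wp_while (Inv := Inv)).
- exists [::]; split=> //.
  + by case: (rule) => /=; [|case|rewrite prefix0s].
  + by left; split=> // q; rewrite ltn0.
- move=> t st' [s [sE ls LS' [[f1 us]|[f0 _ _]]]]; last by rewrite /= f0.
  move=> _; have [sN' _] := terminates ls us; split; first by rewrite -sE.
  apply: (sink_step ls us LS') => st2 i li LS2 alt.
  exists (rcons s i); split=> //; first by rewrite size_rcons sE.
  case: alt => -[f h]; [left | right]; last by split=> //; rewrite size_rcons.
  split=> // q; rewrite size_rcons ltnS leq_eqVlt => /predU1P[->|qs].
    by rewrite take_oversize ?size_rcons.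
  by rewrite -cats1 takel_cat //; exact: us.
- move=> t st' [s [sE ls LS' [[f1 us]|[f0 s0 h]]]] tN; first by rewrite /= f1.
  by move=> _; apply: (HQ _ s) => //; rewrite s0 sE.
Qed.

Lemma wp_round d st Q : sink_env st -> holds_mat st 5 d ->
  (forall st', same [:: 5; 6; 7]%N [::] [:: 5; 7]%N st st' ->
     holds_mat st' 5 (rounded Ct mu eta d) -> Q st') ->
  wp N (PRound r) Q st.
Proof.
move=> env d5 HQ; have [ld _ _ _] := env; have [e0 e1] := loaded_nm ld.
pose dp p := foldl (round_update Ct mu eta) d (take p (enum 'I_k)).
pose Inv p st' := holds_mat st' 5 (dp p).
apply: (wp_for (B := k) (Inv := Inv)) => //.
- by move=> st' [s1 _ _]; rewrite /= s1.
- by rewrite /Inv /dp take0.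
- move=> p st1 pk vp ss1 d51; pose i := Ordinal pk.
  have env1 : sink_env st1 by apply: sink_env_same ss1 env.
  apply: wp_seq; apply: (wp_marg_sink env1 d51) => st2 ss2 g2.
  have env2 : sink_env st2 by apply: sink_env_same ss2 env1.
  have d52 : holds_mat st2 5 (dp p) by apply: holds_mat_same ss2 d51.
  have [ld2 _ _ _] := env2; have [e02 e12] := loaded_nm ld2.
  pose F (j : nat) : R := if insub j is Some j' then round_update Ct mu eta (dp p) i i j' else 0.
  have v2 : nvar st2 7 = p by case: ss2 => -> //.
  apply: (wp_fill1 (B := n) (addr := fun j => [:: p; j]) (f := F)) => //.
  + by move=> j st' vj h; rewrite /address /= vj h // v2.
  + by move=> j1 j2 [].
  + move=> j st' jB ss vj rE; have [s1 s2 s3] := ss.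
    have ld' : loaded I eps tape st' by apply: loaded_same ss ld2.
    rewrite /F insubT /round_update eqxx.
    have aE : map (neval st') [:: NVar 7; NVar 6] = [:: val i; val (Sub j jB : 'I_n)].
      by rewrite /= vj s1 // v2.
    apply: xval_bin; first by apply: xval_get aE _; rewrite rE; exact: (d52 i (Sub j jB)).
    apply: xval_bin; first exact: xval_nat.
    apply: xval_bin; apply: xval_get aE _; last by rewrite s3 //; exact: g2.
    by case: ld' => _ [_ [_ [_ [_ [h _]]]]]; exact: h.
  move=> st3 ss3 F1 F2 i' j.
  have -> : dp p.+1 = round_update Ct mu eta (dp p) i.
    rewrite /dp (take_nth i) ?size_enum_ord // -cats1 foldl_cat /=.
    by rewrite -[p]/(val i) nth_ord_enum.
  rewrite -[LHS]/(rarr st3 5 [:: val i'; val j]).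
  have [->|ne] := eqVneq i' i; first by have := F1 j (ltn_ord j); rewrite /F valK.
  rewrite F2; first by rewrite d52 /round_update (negPf ne).
  by move=> j' _; apply/eqP => -[ii _]; case/eqP: ne; apply: val_inj.
- move=> st' ss vB; rewrite /Inv /dp take_oversize ?size_enum_ord // => h.
  by apply: HQ => //; apply: same_incl ss.
Qed.

Lemma wp_residual d st Q : sink_env st -> holds_mat st 7 (MARG Ct d eta) ->
  (forall st', same [:: 5; 6]%N [::] [:: 12]%N st st' ->
     holds_mat st' 12 (residual Ct mu eta d) -> Q st') ->
  wp N PResidual Q st.
Proof.
move=> env g7 HQ; have [ld _ _ _] := env; have [e0 e1] := loaded_nm ld.
pose F (i j : nat) : R := if insub i is Some i' then if insub j is Some j' then
   residual Ct mu eta d i' j' else 0 else 0.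
apply: (wp_fill2 (Bx := k) (By := n) (f := F)) => //; last first.
  move=> st' ss h; apply: HQ => // i j.
  by have := h i j (ltn_ord i) (ltn_ord j); rewrite /F !valK.
move=> i j st' iB jB ss vi vj _; rewrite /F !insubT; have [s1 s2 s3] := ss.
have ld' : loaded I eps tape st' by apply: loaded_same ss ld.
have [e0' e1'] := loaded_nm ld'.
set i' := Sub i iB : 'I_k; set j' := Sub j jB : 'I_n.
have mu' a : forall j, rarr st' 0 [:: val (a : 'I_k); val (j : 'I_n)] = mu a j.
  by case: ld' => _ [_ [_ [_ [_ [h _]]]]] j1; exact: h.
have g7' a j1 : rarr st' 7 [:: val (a : 'I_k); val (j1 : 'I_n)] = MARG Ct d eta a j1.
  by rewrite s3.
have v : xval N st' (XSub (XA2 0 5 6) (XA2 7 5 6)) (mu i' j' - MARG Ct d eta i' j').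
  have aE : map (neval st') [:: NVar 5; NVar 6] = [:: val i'; val j'] by rewrite /= vi vj.
  by apply: xval_bin; apply: xval_get aE _; [exact: mu' | exact: g7'].
apply: xval_eq.
  apply: xval_ifeq; last exact: v.
  apply: xval_bin; first exact: v.
  apply: (@xval_prod _ _ _ _ _ _ k.-1 (fun=> \sum_j1 `|mu i' j1 - MARG Ct d eta i' j1|)).
  - by rewrite /= e1' subn1.
  - by lia.
  move=> z; apply: (@xval_sum _ _ _ _ _ _ n); [exact: e0'|by []|move=> j1].
  have aE : map (neval (set_nvar (set_nvar st' 22 z) 21 j1)) [:: NVar 5; NVar 21] =
    [:: val i'; val j1] by rewrite /= vi.
  by apply: xval_abs; apply: xval_bin; apply: xval_get aE _; [exact: mu' | exact: g7'].
by rewrite /= vi prodr_const card_ord.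
Qed.

End SinkhornProgram.

Section SinkhornMain.
Variables (R : realType) (r : nat) (I : instance R r) (eps : R) (tape : seq 'I_(nmarg I)).
Variables (K N : nat) (rule : update_rule).
Implicit Types (st : store R) (Q : store R -> Prop) (d : 'I_(nmarg I) -> 'I_(side I) -> R).
Local Notation n := (side I).
Local Notation k := (nmarg I).
Local Notation eta := (sinkhorn_eta n k (eps / 2)).
Local Notation mu := (target I).
Local Notation m := (sink_degree I eps K).
Local Notation Ct := (surrogate I eps K).
Local Notation iter := (sinkhorn_iter Ct mu eta).
Local Notation legit := (follows_rule Ct mu rule eta tape).
Hypotheses (eps0 : 0 < eps) (k0 : (0 < k)%N) (n0 : (0 < n)%N).
Hypothesis RK : forall jj, `|low_rank_part I jj| <= K%:R * Cmax I.
Hypothesis inj : injective (spos I).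
Hypotheses (rN : (r <= N)%N) (kN : (k <= N)%N) (nN : (n <= N)%N) (sN : (spars I <= N)%N).
Hypothesis mN : (m < N)%N.

Lemma wp_copy2 a b d st Q : (a == b) = false ->
  nvar st 0 = n -> nvar st 1 = k -> holds_mat st b d ->
  (forall st', same [:: 5; 6]%N [::] [:: a] st st' -> holds_mat st' a d -> Q st') ->
  wp N (PCopy2 a b) Q st.
Proof.
move=> ab e0 e1 hb HQ.
apply: (wp_fill2 (Bx := k) (By := n) (f := fun i j => rarr st b [:: i; j])) => //.
  move=> i j st' _ _ [s1 s2 s3] vi vj _; apply: xval_get => //=.
  by rewrite s3 ?inE 1?eq_sym ?ab // vi vj.
move=> st' ss h; apply: HQ => // i j.
by rewrite h ?ltn_ord //; exact: hb.
Qed.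

Lemma wp_evaluate jj st : loaded I eps [::] st -> queried jj st ->
  wp N (PEvaluate r K) (fun st' => rarr st' 0 [::] = Ct jj) st.
Proof.
move=> ld qu; apply: wp_seq; apply: (wp_eta N ld) => // st1 ss1 h6.
have ld1 : loaded I eps [::] st1 by apply: loaded_same ss1 ld.
have q1 : queried jj st1 by move=> i; case: ss1 => _ s2 _; rewrite s2.
apply: wp_seq; apply: (wp_degree eps0 n0 RK mN ld1 h6) => // st2 ss2 h3.
have ld2 : loaded I eps [::] st2 by apply: loaded_same ss2 ld1.
have q2 : queried jj st2 by move=> i; case: ss2 => _ s2 _; rewrite s2.
have h62 : rarr st2 6 [::] = eta by case: ss2 => _ _ ->.
apply: (wp_real (x := Ct jj)); last by [].
have vR : xval N st2 (RX r (NGet 2 [:: 20]%N)) (low_rank_part I jj).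
  by apply: xval_RX ld2 rN kN _ => i l; exact: q2.
have vS : xval N st2 (SX (NGet 2 [:: 20]%N)) (sparse_part I jj).
  by apply: xval_SX ld2 sN kN _ => i l; exact: q2.
apply: xval_eq.
  apply: xval_ifR; [by apply: xval_get | exact: xval_nat | |].
    by apply: xval_bin; [exact: vR | exact: vS].
  apply: xval_bin; first exact: vS.
  apply: xval_bin; first by apply: xval_bin; [exact: xval_nat | exact: xval_get].
  apply: xval_ln; apply: xval_bin; first exact: xval_nat.
  apply: xval_bin; last exact: xval_nat.
  by apply: xval_bin; [exact: xval_get | exact: vR].
by rewrite /= h3 h62.
Qed.

Lemma pok_evaluate : pok (fresh r) (PEvaluate r K).
Proof. by rewrite /PEvaluate /PDegree /PCeil /=. Qed.

Lemma pok_sinkhorn : pok (fresh r) (PSinkhorn r K rule).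
Proof.
by rewrite /PSinkhorn /PDegree /PCeil /PRound /PSinkhornLoop /PViolation /PMARG /=
  !xok_LRX //; case: rule.
Qed.

Hypothesis terminates : forall s, legit s -> unstopped_run eps K s ->
  (size s < N)%N /\ (rule = Random -> (size s < size tape)%N).

Lemma wp_sinkhorn st : loaded I eps tape st ->
  wp N (PSinkhorn r K rule) (fun st' => exists s,
    [/\ legit s, (0 < size s <= N)%N,
      total_violation Ct mu eta (iter s) <= sink_thr I eps &
      let d := rounded Ct mu eta (iter s) in
      outputs_vectors d (residual Ct mu eta d) st']) st.
Proof.
move=> ld; apply: wp_seq; apply: (wp_eta N ld) => // st1 ss1 h6.
have ld1 : loaded I eps tape st1 by apply: loaded_same ss1 ld.
apply: wp_seq; apply: (wp_degree eps0 n0 RK mN ld1 h6) => // st2 ss2 h3.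
have ld2 : loaded I eps tape st2 by apply: loaded_same ss2 ld1.
have [c3 c4] : rarr st2 3 [::] = Cmax I /\ rarr st2 4 [::] = eps.
  by case: ld2 => _ [_ [_ [_ [_ [_ [_ [_ []]]]]]]].
apply: wp_seq; apply: (wp_real (x := sink_thr I eps)).
  apply: xval_bin; first exact: xval_get.
  apply: xval_bin; first exact: xval_nat.
  by apply: xval_bin; exact: xval_get.
set st3 := set_rarr _ _ _ _.
have env3 : sink_env eps tape K st3.
  split=> //.
  by rewrite /st3 /=; case: ss2 => _ _ -> //.
apply: wp_seq; apply: wp_nat; set st4 := set_nvar _ _ _.
apply: wp_seq; apply: wp_nat; set st5 := set_nvar _ _ _.
have env5 : sink_env eps tape K st5.
  by apply: sink_env_same (same_comp (xs := [:: 8; 12]%N) (bs := [::]) (rs := [::])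
    (same_nvar st3 8 _) (same_nvar st4 12 _) _) env3.
have [ld5 _ _ _] := env5; have [e0 e1] := loaded_nm ld5.
apply: wp_seq; apply: (wp_fill2 (Bx := k) (By := n) (f := fun _ _ => 1)) => // st6 ss6 d6.
have env6 : sink_env eps tape K st6 by apply: sink_env_same ss6 env5.
have d6' : holds_mat st6 5 (iter [::]) by move=> i j; rewrite d6 ?ltn_ord.
apply: wp_seq; apply: (wp_violation eps0 n0 RK inj rN kN nN sN mN env6 d6') => // st7 ss7 g7 v7 V7.
have env7 : sink_env eps tape K st7 by apply: sink_env_same ss7 env6.
have LS : sink_state eps tape K rule [::] st7.
  split=> //; first by split=> //; apply: holds_mat_same ss7 d6'.
    by case: ss7 => -> //; case: ss6 => -> //.
  by move=> _; rewrite mod0n; case: ss7 => -> //; case: ss6 => -> //.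
apply: wp_seq; apply: (wp_sinkhorn_loop eps0 k0 n0 RK inj rN kN nN sN mN terminates LS) => // st8 s ls sz [env8 [d8 g8] _ _ _] tv.
apply: wp_seq; apply: (wp_round eps0 n0 RK inj rN kN nN sN mN env8 d8) => // st9 ss9 d9.
have env9 : sink_env eps tape K st9 by apply: sink_env_same ss9 env8.
apply: wp_seq; apply: (wp_marg_sink eps0 n0 RK inj rN kN nN sN mN env9 d9) => // st10 ss10 g10.
have env10 : sink_env eps tape K st10 by apply: sink_env_same ss10 env9.
apply: wp_seq; apply: (wp_residual eps0 k0 n0 rN kN nN sN mN env10 g10) => // st11 ss11 v11.
have env11 : sink_env eps tape K st11 by apply: sink_env_same ss11 env10.
have [ld11 _ _ _] := env11; have [e0' e1'] := loaded_nm ld11.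
set d := rounded _ _ _ _ in d9 g10 v11.
have d11 : holds_mat st11 5 d by apply: holds_mat_same ss11 (holds_mat_same _ ss10 d9).
apply: wp_seq; apply: (wp_copy2 (d := d)) => // st12 ss12 d12.
have v12 : holds_mat st12 12 (residual Ct mu eta d) by apply: holds_mat_same ss12 v11.
apply: (wp_copy2 (d := residual Ct mu eta d)) => //.
- by case: ss12 => ->.
- by case: ss12 => ->.
move=> st13 ss13 v13; exists s; split=> // i j; split; last exact: v13.
by case: ss13 => _ _ ->.
Qed.

End SinkhornMain.

(** * Multiplicative weights: analysis *)

Section Deltas.
Variables (R : realType) (n k : nat).
Implicit Types (P C : tensor R n k) (jj : midx n k) (a : R).

Lemma sum_delta (f : midx n k -> R) a jj :
  \sum_jj' f jj' * (a * (jj' == jj)%:R) = a * f jj.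
Proof.
rewrite (bigD1 jj) //= eqxx mulr1 big1 ?addr0 1?mulrC // => jj' /negPf ->.
by rewrite !mulr0.
Qed.

Lemma inner_add_delta C P a jj : inner C (add_delta P a jj) = inner C P + a * C jj.
Proof.
rewrite /inner /add_delta -sum_delta -big_split /=.
by apply: eq_bigr => jj' _; rewrite mulrDr.
Qed.

Lemma marg_add_delta P a jj i j :
  marg (add_delta P a jj) i j = marg P i j + a * (jj i == j)%:R.
Proof.
rewrite /marg /add_delta big_split /=; congr (_ + _).
rewrite -(sum_delta (fun jj => (jj i == j)%:R)) big_mkcond /=.
by apply: eq_bigr => jj' _; case: (jj' i == j); rewrite ?mul1r ?mul0r.
Qed.

Lemma mass_add_delta P a jj : mass (add_delta P a jj) = mass P + a.
Proof.
rewrite /mass /add_delta big_split /=; congr (_ + _).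
by rewrite -[RHS]mulr1 -(sum_delta (fun=> 1) a jj); apply: eq_bigr => jj' _; rewrite mul1r.
Qed.

End Deltas.

Lemma is_derive_sums (R : realType) (T : Type) (s : seq T) (p : pred T)
    (F : T -> R -> R) (dF : T -> R) (x : R) :
  (forall t, p t -> is_derive x 1 (F t) (dF t)) ->
  is_derive x 1 (fun h => \sum_(t <- s | p t) F t h) (\sum_(t <- s | p t) dF t).
Proof.
move=> dFt; elim: s => [|t s IH].
  rewrite big_nil (_ : (fun _ => _) = cst 0); first exact: is_derive_cst.
  by apply/funext => h; rewrite big_nil.
rewrite big_cons; case: ifP => pt; last first.
  by rewrite (_ : (fun _ => _) = (fun h => \sum_(t <- s | p t) F t h)) //;
    apply/funext => h; rewrite big_cons pt.
rewrite (_ : (fun _ => _) = F t + (fun h => \sum_(t <- s | p t) F t h)).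
  by apply: is_deriveD; exact: dFt.
by apply/funext => h; rewrite big_cons pt.
Qed.

Lemma is_derive_expM (R : realType) (a b : R) :
  is_derive (0 : R) 1 (fun h => a * expR (h * b)) (a * b).
Proof.
have d1 : is_derive (0 : R) 1 (fun h : R => h * b) b.
  rewrite (_ : (fun _ => _) = b \*: (id : R -> R)); last first.
    by apply/funext => h /=; rewrite mulrC.
  have := is_deriveZ b (@is_derive_id R R (0 : R) 1).
  by rewrite /GRing.scale /= mulr1.
have d2 := is_derive1_comp (is_derive_expR ((fun h : R => h * b) 0)) d1.
have := is_deriveZ a d2; rewrite mul0r expR0 mul1r; exact.
Qed.

Section MwuStep.
Variables (R : realType) (n k : nat) (C : tensor R n k) (mu : 'I_k -> 'I_n -> R).
Variables (eps lam : R).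
Hypotheses (k0 : (0 < k)%N) (mu1 : forall i, in_simplex (mu i)).
Hypothesis C12 : forall jj, 1 <= C jj <= 2.
Hypotheses (eps0 : 0 < eps) (eps1 : eps <= 1 / 10) (lam1 : 1 <= lam).
Implicit Types (P Q : tensor R n k) (jj : midx n k) (a : R) (i : 'I_k) (j : 'I_n).

Let mu0 i j : 0 <= mu i j. Proof. by case: (mu1 i). Qed.
Let lam0 : 0 < lam. Proof. exact: lt_le_trans lam1. Qed.

(** ** The potential *)

Definition wcost P : R := expR (inner C P / lam).
Definition wmarg P i j : R := expR (marg P i j / mu i j).
Definition wtotal P : R := wcost P + \sum_i \sum_(j | 0 < mu i j) wmarg P i j.

(** The directional derivative of the potential, in closed form. *)
Definition slope P jj : R :=
  (wcost P * (C jj / lam) + \sum_i wmarg P i (jj i) / mu i (jj i)) / wtotal P.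

Lemma wtotal_gt0 P : 0 < wtotal P.
Proof.
rewrite ltr_wpDr ?expR_gt0 //; apply: sumr_ge0 => i _; apply: sumr_ge0 => j _.
exact: expR_ge0.
Qed.

Lemma potentialE P : potential C mu lam P = ln (wtotal P).
Proof. by []. Qed.

Lemma wtotal_add P h jj : wtotal (add_delta P h jj) =
  wcost P * expR (h * (C jj / lam)) +
  \sum_i \sum_(j | 0 < mu i j) wmarg P i j * expR (h * ((jj i == j)%:R / mu i j)).
Proof.
rewrite /wtotal /wcost inner_add_delta mulrDl expRD mulrA; congr (_ + _).
apply: eq_bigr => i _; apply: eq_bigr => j _.
by rewrite /wmarg marg_add_delta mulrDl expRD mulrA.
Qed.

Lemma sum_chosen (f : 'I_k -> 'I_n -> R) jj : in_support mu jj ->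
  \sum_i \sum_(j | 0 < mu i j) f i j * ((jj i == j)%:R / mu i j) =
  \sum_i f i (jj i) / mu i (jj i).
Proof.
move=> js; apply: eq_bigr => i _; rewrite (bigD1 (jj i)) ?js //= eqxx mul1r.
by rewrite big1 ?addr0 // => j /andP[_ /negPf jn]; rewrite eq_sym jn mul0r mulr0.
Qed.

Lemma dpotentialE P jj : in_support mu jj -> dpotential C mu lam P jj = slope P jj.
Proof.
move=> js; rewrite /dpotential derive1E.
pose g h := wcost P * expR (h * (C jj / lam)) +
  \sum_i \sum_(j | 0 < mu i j) wmarg P i j * expR (h * ((jj i == j)%:R / mu i j)).
have -> : (fun h : R => potential C mu lam (add_delta P h jj)) = (@ln R) \o g.
  by apply/funext => h; rewrite potentialE wtotal_add.
have dg : is_derive (0 : R) 1 g (wcost P * (C jj / lam) +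
    \sum_i \sum_(j | 0 < mu i j) wmarg P i j * ((jj i == j)%:R / mu i j)).
  apply: is_deriveD; first exact: is_derive_expM.
  apply: is_derive_sums => i _; apply: is_derive_sums => j _; exact: is_derive_expM.
have g0 : g 0 = wtotal P.
  rewrite -[in RHS](_ : add_delta P 0 jj = P) ?wtotal_add //.
  by apply/funext => jj'; rewrite /add_delta mul0r addr0.
have gp : 0 < g 0 by rewrite g0 wtotal_gt0.
have d := is_derive1_comp (is_derive1_ln gp) dg.
by rewrite (@derive_val _ _ _ _ _ _ _ d) g0 mulrC sum_chosen.
Qed.

(** The slopes average to at most 1 under the weights of a plan of cost at most
  [lam], so they cannot all exceed 1. *)
Lemma null_infeasible P Q : oracle_null C mu lam P -> feasible mu Q -> lam < inner C Q.
Proof.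
move=> nul fQ; have [Q0 Qm] := fQ; rewrite ltNge; apply/negP => le.
have Qs jj : 0 < Q jj -> in_support mu jj.
  by move=> Qp i; rewrite -Qm; exact: lt_le_trans (entry_le_marg jj i Q0).
have mQ := feasible_mass (mu1 (Ordinal k0)) fQ.
have Zp := wtotal_gt0 P.
have avg : \sum_jj Q jj * (slope P jj * wtotal P) <= wtotal P.
  rewrite /slope; under eq_bigr => jj _ do rewrite divfK ?gt_eqF // mulrDr mulr_sumr.
  rewrite big_split /= exchange_big /=; apply: lerD.
    rewrite (_ : \sum_(jj : midx n k) _ = wcost P * (inner C Q / lam)); last first.
      rewrite /inner mulr_suml mulr_sumr; apply: eq_bigr => jj _; ring.
    rewrite -[leRHS]mulr1 ler_wpM2l ?expR_ge0 // ler_pdivrMr // mul1r //.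
  apply: ler_sum => i _; rewrite (sum_coord Q i (fun j => wmarg P i j / mu i j)).
  rewrite [leRHS]big_mkcond /=; apply: ler_sum => j _; rewrite Qm.
  have := mu0 i j; rewrite le_eqVlt => /predU1P[<-|mp]; first by rewrite mul0r ltxx.
  by rewrite mp mulrCA divff ?mulr1 // gt_eqF.
have low jj : Q jj * wtotal P <= Q jj * (slope P jj * wtotal P).
  have := Q0 jj; rewrite le_eqVlt => /predU1P[<-|Qp]; first by rewrite !mul0r.
  rewrite ler_pM2l // ler_peMl ?(ltW Zp) // ltW // -dpotentialE; last exact: Qs.
  exact: nul (Qs _ Qp).
have [jj0 Qjj0] : exists jj, 0 < Q jj.
  apply: contrapT => no; have : mass Q = 0.
    apply: big1 => jj _; apply/eqP; rewrite eq_le Q0 andbT leNgt; apply/negP => h.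
    by apply: no; exists jj.
  by rewrite mQ => /eqP; rewrite oner_eq0.
have : \sum_jj Q jj * wtotal P < \sum_jj Q jj * (slope P jj * wtotal P).
  rewrite (bigD1 jj0) //= [ltRHS](bigD1 jj0) //=; apply: ltr_leD.
    rewrite ltr_pM2l // ltr_pMl // -dpotentialE; last exact: Qs.
    exact: nul (Qs _ Qjj0).
  by apply: ler_sum => jj _; exact: low.
rewrite -mulr_suml -/(mass Q) mQ mul1r ltNge avg; by [].
Qed.

(** Chosen instead of a quadratic bound because it is linear in [x], which lets the
  increments of all exponents be added. *)
Lemma expR_le_chord (x : R) : 0 <= x -> x <= eps -> expR x <= 1 + x / (1 - eps).
Proof.
move=> x0 xe; have e1 := eps1; have h : 0 < 1 - x by lra.
have chord : expR x <= (1 - x)^-1.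
  rewrite -[expR x]invrK -expRN lef_pV2 ?posrE ?expR_gt0 //; exact: expR_ge1Dx.
apply: le_trans chord _; rewrite -[leLHS]mul1r ler_pdivrMr //.
have e2 : 0 < 1 - eps by have := eps1; lra.
have -> : (1 + x / (1 - eps)) * (1 - x) = 1 + x * (eps - x) / (1 - eps).
  by field; rewrite gt_eqF.
by rewrite lerDl divr_ge0 ?mulr_ge0 //; lra.
Qed.

Definition kappa : R := (1 + eps) / (1 - eps).

(** Each exponent moves by at most [eps], where the exponential is within
  [1 / (1 - eps)] of linear, and the slope is at most [1 + eps]; [kappa] is the
  product of both losses. *)
Lemma potential_step P h jj : 0 <= h -> oracle_answer C mu eps lam P jj ->
  h * (C jj / lam) <= eps -> (forall i, h / mu i (jj i) <= eps) ->
  ln (wtotal (add_delta P h jj)) <= ln (wtotal P) + kappa * h.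
Proof.
move=> h0 [js sl] hC hm; rewrite dpotentialE // in sl; have Zp := wtotal_gt0 P.
have e2 : 0 < 1 - eps by have := eps1; lra.
have Cj : 0 <= C jj / lam.
  by case/andP: (C12 jj) => c1 _; rewrite divr_ge0 ?(ltW lam0) // (le_trans _ c1).
have le : wtotal (add_delta P h jj) <= wtotal P * (1 + h * slope P jj / (1 - eps)).
  have -> : wtotal P * (1 + h * slope P jj / (1 - eps)) =
      wcost P * (1 + h * (C jj / lam) / (1 - eps)) +
      \sum_i \sum_(j | 0 < mu i j) wmarg P i j * (1 + h * ((jj i == j)%:R / mu i j) / (1 - eps)).
    have -> : \sum_i \sum_(j | 0 < mu i j)
         wmarg P i j * (1 + h * ((jj i == j)%:R / mu i j) / (1 - eps)) =
       \sum_i \sum_(j | 0 < mu i j) wmarg P i j +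
       h / (1 - eps) * \sum_i wmarg P i (jj i) / mu i (jj i).
      rewrite -sum_chosen // mulr_sumr -big_split /=; apply: eq_bigr => i _.
      rewrite mulr_sumr -big_split /=; apply: eq_bigr => j _.
      by rewrite mulrDr mulr1; congr (_ + _); ring.
    rewrite /slope mulrDr mulr1.
    have -> : wtotal P * (h * ((wcost P * (C jj / lam) +
        \sum_i wmarg P i (jj i) / mu i (jj i)) / wtotal P) / (1 - eps)) =
        h / (1 - eps) * (wcost P * (C jj / lam) + \sum_i wmarg P i (jj i) / mu i (jj i)).
      set S := _ + _; have Z0 : wtotal P != 0 by rewrite gt_eqF.
      have E0 : 1 - eps != 0 by rewrite gt_eqF.
      move: (wtotal P) Z0 => z z0; clearbody S; field; by rewrite E0 z0.
    rewrite /wtotal; set A := \sum_i \sum_(j | _) _; set B := \sum_i _ / _.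
    by clearbody A B; ring.
  rewrite wtotal_add; apply: lerD.
    rewrite ler_wpM2l ?expR_ge0 //; apply: expR_le_chord => //; exact: mulr_ge0.
  apply: ler_sum => i _; apply: ler_sum => j mp; rewrite ler_wpM2l ?expR_ge0 //.
  apply: expR_le_chord; first by rewrite mulr_ge0 // divr_ge0 ?ler0n // ltW.
  have [jE|_] := eqVneq (jj i) j; last by rewrite mul0r mulr0 ltW.
  by rewrite mul1r -jE; exact: hm.
have Zp' := wtotal_gt0 (add_delta P h jj).
apply: (@le_trans _ _ (ln (wtotal P * (1 + h * slope P jj / (1 - eps))))).
  by rewrite ler_ln ?posrE //; exact: lt_le_trans le.
have fp : 0 < 1 + h * slope P jj / (1 - eps).
  by rewrite -(pmulr_rgt0 _ Zp); exact: lt_le_trans le.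
rewrite lnM ?posrE // lerD2l; apply: le_trans (ln_le_sub1 fp) _.
have -> : kappa * h = h * (1 + eps) / (1 - eps) by rewrite /kappa; ring.
rewrite addrAC subrr add0r; apply: ler_wpM2r; first by rewrite invr_ge0 ltW.
exact: ler_wpM2l.
Qed.

Lemma inner_le_potential P : inner C P / lam <= ln (wtotal P).
Proof.
rewrite -ler_expR lnK ?posrE ?wtotal_gt0 // lerDl.
by apply: sumr_ge0 => i _; apply: sumr_ge0 => j _; exact: expR_ge0.
Qed.

Lemma marg_le_potential P i j : 0 < mu i j -> marg P i j / mu i j <= ln (wtotal P).
Proof.
move=> mp; rewrite -ler_expR lnK ?posrE ?wtotal_gt0 // -/(wmarg P i j).
rewrite /wtotal (bigD1 i) //= (bigD1 j) //= addrA addrA [X in X + _ + _]addrC -!addrA lerDl.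
rewrite !addr_ge0 ?expR_ge0 //.
  by apply: sumr_ge0 => ? _; exact: expR_ge0.
by apply: sumr_ge0 => ? _; apply: sumr_ge0 => ? _; exact: expR_ge0.
Qed.

End MwuStep.

Lemma bigmin_spec (R : realType) (T : Type) (s : seq T) (x : R) (F : T -> R) :
  let b := \big[Num.min/x]_(t <- s) F t in
  b <= x /\ (b = x \/ exists t, b = F t).
Proof.
elim: s => [|t s [IH1 IH2]] /=; first by rewrite big_nil; split=> //; left.
rewrite big_cons; split; first by rewrite ge_min IH1 orbT.
by case: leP => _; [right; exists t | exact: IH2].
Qed.

Lemma bigmin_le_term (R : realType) (k : nat) (x : R) (F : 'I_k -> R) i :
  \big[Num.min/x]_(i < k) F i <= F i.
Proof.
rewrite -big_enum /=; have : i \in enum 'I_k by rewrite mem_enum.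
elim: (enum _) => //= t s IH; rewrite inE big_cons ge_min => /predU1P[->|/IH ->].
  by rewrite lexx.
by rewrite orbT.
Qed.

Section MwuStep1.
Variables (R : realType) (n k : nat) (C : tensor R n k) (mu : 'I_k -> 'I_n -> R).
Variables (eps lam : R).
Hypotheses (k0 : (0 < k)%N) (mu1 : forall i, in_simplex (mu i)).
Hypothesis C12 : forall jj, 1 <= C jj <= 2.
Hypotheses (eps0 : 0 < eps) (eps1 : eps <= 1 / 10) (lam1 : 1 <= lam).
Implicit Types (P Q : tensor R n k) (jj : midx n k) (a : R) (i : 'I_k) (j : 'I_n).

Local Notation eta := (mwu_eta n k eps).
Local Notation kappa := (kappa eps).

Let mu0 i j : 0 <= mu i j. Proof. by case: (mu1 i). Qed.
Let lam0 : 0 < lam. Proof. exact: lt_le_trans lam1. Qed.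
Let Cpos jj : 0 < C jj. Proof. by case/andP: (C12 jj) => c _; exact: lt_le_trans c. Qed.

Let nk1 : (2 : R) <= (n * k + 1)%:R.
Proof.
have n0 := n_gt0 k0 mu1; rewrite ler_nat addn1 ltnS muln_gt0; by rewrite n0 k0.
Qed.

Lemma ln2_ge : 1 / 2 <= ln (2 : R).
Proof. have := @ln_le_sub1 R 2^-1 ltac:(by []); rewrite lnV ?posrE //; lra. Qed.

Lemma ln_nk : 1 / 2 <= ln ((n * k + 1)%:R : R).
Proof.
apply: le_trans ln2_ge _; rewrite ler_ln ?posrE //; try exact: lt_le_trans nk1.
Qed.

Lemma mwu_eta_ge : 1 <= eta * eps.
Proof. rewrite /mwu_eta divfK ?gt_eqF //; have := ln_nk; lra. Qed.

Lemma mwu_eta_gt0 : 0 < eta.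
Proof. by rewrite -(pmulr_lgt0 _ eps0); exact: lt_le_trans mwu_eta_ge. Qed.

Local Notation step := (mwu_stepsize C mu eps lam).

(** The minimum in the step size is attained, hence some exponent of the potential
  grows by exactly [eps] and none by more. *)
Lemma stepsize_spec jj : in_support mu jj ->
  [/\ 0 <= step jj, step jj <= eps, step jj * (C jj / lam) <= eps,
      forall i, step jj / mu i (jj i) <= eps &
      step jj * (C jj / lam) = eps \/ exists i, step jj / mu i (jj i) = eps].
Proof.
move=> js; rewrite /mwu_stepsize; set b := \big[Num.min/_]_(_ < k) _.
have [b1 b2] := bigmin_spec (index_enum 'I_k) (lam / C jj) (fun i => mu i (jj i)).
rewrite -/b in b1 b2.
have bi i : b <= mu i (jj i) by exact: bigmin_le_term.
have b0 : 0 < b by case: b2 => [->|[i ->]]; [rewrite divr_gt0 | exact: js].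
have cl : 0 < C jj / lam by rewrite divr_gt0.
split.
- by rewrite mulr_ge0 ?ltW.
- rewrite -[leRHS]mulr1 ler_wpM2l ?(ltW eps0) //; pose i := Ordinal k0.
  apply: le_trans (bi i) _; have [_ <-] := mu1 i.
  by rewrite (bigD1 (jj i)) //= lerDl sumr_ge0.
- rewrite -mulrA -[leRHS]mulr1 ler_wpM2l ?(ltW eps0) // -ler_pdivlMr // mul1r invf_div.
  exact: b1.
- move=> i; rewrite -mulrA -[leRHS]mulr1 ler_wpM2l ?(ltW eps0) // ler_pdivrMr ?mul1r //.
- case: b2 => [->|[i ->]]; [left | right; exists i].
    by rewrite -mulrA -[C jj / lam]invf_div mulfV ?mulr1 // gt_eqF // divr_gt0.
  by rewrite -mulrA divff ?mulr1 // gt_eqF.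
Qed.

Definition exponents P : R := inner C P / lam + \sum_i \sum_(j | 0 < mu i j) marg P i j / mu i j.

(** The sum of the exponents counts the iterations; the potential, which bounds each
  exponent, is itself bounded by the mass. *)
Definition mwu_inv P (N : nat) : Prop :=
  [/\ forall jj, 0 <= P jj,
      forall jj, ~ in_support mu jj -> P jj = 0,
      ln (wtotal C mu lam P) <= ln (n * k + 1)%:R + kappa * mass P,
      mass P <= eta + eps & N%:R * eps <= exponents P].

Lemma kappa_ge0 : 0 <= kappa.
Proof. by rewrite divr_ge0 //; have := eps0; have := eps1; lra. Qed.

Lemma mwu_inv0 : mwu_inv (fun=> 0) 0.
Proof.
have m0 : mass ((fun=> 0) : tensor R n k) = 0 by exact: big1.
have mg i j : marg ((fun=> 0) : tensor R n k) i j = 0 by exact: big1.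
have i0 : inner C (fun=> 0) = 0 by apply: big1 => jj _; rewrite mulr0.
split=> //.
- rewrite m0 mulr0 addr0 ler_ln ?posrE ?wtotal_gt0 ?(lt_le_trans _ nk1) //.
  rewrite /wtotal /wcost i0 mul0r expR0 addnC natrD lerD2l.
  apply: (@le_trans _ _ (\sum_(i < k) \sum_(j < n) (1 : R))).
    apply: ler_sum => i _; rewrite big_mkcond /=; apply: ler_sum => j _.
    by rewrite /wmarg mg mul0r expR0; case: ifP.
  by rewrite !sumr_const !card_ord -mulrnA.
- rewrite m0; apply: addr_ge0; [exact: ltW mwu_eta_gt0 | exact: ltW].
- rewrite /exponents i0 !mul0r add0r; apply: sumr_ge0 => i _; apply: sumr_ge0 => j _.
  by rewrite mg mul0r.
Qed.

Lemma exponents_add P h jj : in_support mu jj ->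
  exponents (add_delta P h jj) =
  exponents P + (h * (C jj / lam) + \sum_i h / mu i (jj i)).
Proof.
move=> js; rewrite /exponents inner_add_delta mulrDl -mulrA addrACA; congr (_ + _).
have <- : \sum_i \sum_(j | 0 < mu i j) h * ((jj i == j)%:R / mu i j) = \sum_i h / mu i (jj i).
  exact: (sum_chosen (fun _ _ => h) js).
rewrite -big_split /=; apply: eq_bigr => i _; rewrite -big_split /=; apply: eq_bigr => j _.
by rewrite marg_add_delta mulrDl mulrA.
Qed.

Lemma mwu_inv_step P N jj : mwu_inv P N -> mass P < eta -> oracle_answer C mu eps lam P jj ->
  mwu_inv (add_delta P (step jj) jj) N.+1.
Proof.
move=> [P0 Ps Pl Pm Pe] mP orc; have [js _] := orc.
have [h0 he hC hm hx] := stepsize_spec js; set h := step jj in h0 he hC hm hx *.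
split.
- by move=> jj'; rewrite addr_ge0 // mulr_ge0.
- move=> jj' njs; rewrite /add_delta Ps // add0r.
  have [jE|_] := eqVneq jj' jj; last by rewrite mulr0.
  by case: njs; rewrite jE.
- rewrite mass_add_delta mulrDr addrA.
  have st := potential_step mu1 C12 eps0 eps1 lam1 h0 orc hC hm.
  by apply: le_trans st _; rewrite lerD2r.
- by rewrite mass_add_delta lerD // ltW.
- rewrite exponents_add // -addn1 natrD mulrDl mul1r lerD //.
  have hC0 : 0 <= h * (C jj / lam) by rewrite mulr_ge0 // divr_ge0 // ltW.
  have hm0 i : 0 <= h / mu i (jj i) by rewrite divr_ge0.
  case: hx => [hx|[i hx]]; first by rewrite hx lerDl sumr_ge0.
  rewrite (bigD1 i) //= hx addrCA lerDl addr_ge0 // sumr_ge0 //.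
Qed.

(** Here the factor [(1 + eps) ^+ 4] of the normalisation comes from: [kappa], the
  overshoot [eps] of the mass and the initial potential [eta * eps / 2] fit into it
  when [eps <= 1 / 10]. *)
Lemma mwu_ceiling P N : mwu_inv P N -> ln (wtotal C mu lam P) <= eta * (1 + eps) ^+ 4.
Proof.
move=> [_ _ Pl Pm _]; apply: le_trans Pl _.
have e0 := eps0; have e1 := eps1; have h0 := mwu_eta_gt0; have h1 := mwu_eta_ge.
have -> : ln (n * k + 1)%:R = eta * (eps / 2) by rewrite /mwu_eta; field; rewrite gt_eqF.
have m1 : kappa * mass P <= kappa * (eta + eps) by rewrite ler_wpM2l // kappa_ge0.
have m2 : eps <= eta * eps ^+ 2 by rewrite expr2 mulrA -[leLHS]mul1r ler_wpM2r // ltW.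
have m3 : kappa * (eta + eps) <= eta * (kappa * (1 + eps ^+ 2)).
  by rewrite [leRHS]mulrCA ler_wpM2l ?kappa_ge0 // mulrDr mulr1 lerD2l.
have m4 : kappa * (1 + eps ^+ 2) + eps / 2 <= (1 + eps) ^+ 4.
  have d : 0 < 1 - eps by lra.
  rewrite -(ler_pM2r d) mulrDl /kappa.
  have -> : (1 + eps) / (1 - eps) * (1 + eps ^+ 2) * (1 - eps) = (1 + eps) * (1 + eps ^+ 2).
    by field; rewrite gt_eqF.
  have p2 : 0 <= eps ^+ 2 by exact: sqr_ge0.
  have p3 : eps ^+ 3 <= eps ^+ 2 / 10 by rewrite exprS; nra.
  have p4 : eps ^+ 4 <= eps ^+ 2 / 100 by rewrite exprS; nra.
  have p5 : eps ^+ 5 <= eps ^+ 2 / 1000 by rewrite exprS; nra.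
  have -> : (1 + eps) * (1 + eps ^+ 2) + eps / 2 * (1 - eps) =
     1 + eps + eps / 2 + eps ^+ 2 / 2 + eps ^+ 3 by field.
  have -> : (1 + eps) ^+ 4 * (1 - eps) =
     1 + 3 * eps + 2 * eps ^+ 2 - 2 * eps ^+ 3 - 3 * eps ^+ 4 - eps ^+ 5 by ring.
  lra.
have m5 : eta * (kappa * (1 + eps ^+ 2) + eps / 2) <= eta * (1 + eps) ^+ 4.
  by rewrite ler_wpM2l // ltW.
by move: m5; rewrite mulrDr; lra.
Qed.

Lemma mwu_count P N : mwu_inv P N -> N%:R * eps <= (n * k + 1)%:R * (eta * (1 + eps) ^+ 4).
Proof.
move=> inv; have [_ _ _ _ Pe] := inv; have ceil := mwu_ceiling inv.
set b := eta * _ in ceil *; apply: le_trans Pe _.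
have b0 : 0 <= b.
  by rewrite mulr_ge0 ?exprn_ge0 ?(ltW mwu_eta_gt0) //; have := eps0; lra.
rewrite natrD mulrDl mul1r addrC; apply: lerD.
  by apply: (le_trans _ ceil); exact: inner_le_potential.
apply: (@le_trans _ _ (\sum_(i < k) \sum_(j < n) b)).
  apply: ler_sum => i _; rewrite big_mkcond /=; apply: ler_sum => j _.
  case: ifP => // mp; apply: (le_trans _ ceil); exact: marg_le_potential.
by rewrite !sumr_const !card_ord -mulrnA -[leLHS]mulr_natl.
Qed.

Definition partial_plan P : Prop :=
  [/\ forall jj, 0 <= P jj, inner C P <= lam, forall i j, marg P i j <= mu i j &
      1 - 4 * eps <= mass P].

Lemma mwu_done P N : mwu_inv P N -> eta <= mass P ->
  partial_plan (fun jj => P jj / (eta * (1 + eps) ^+ 4)).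
Proof.
move=> inv mP; have [P0 Ps _ _ _] := inv; have ceil := mwu_ceiling inv.
have h0 := mwu_eta_gt0; have e0 := eps0; have e1 := eps1.
have f0 : 0 < (1 + eps) ^+ 4 by rewrite exprn_gt0 //; lra.
have b0 : 0 < eta * (1 + eps) ^+ 4 by rewrite mulr_gt0.
set b := eta * _ in ceil b0 *.
have mgE i j : marg (fun jj => P jj / b) i j = marg P i j / b by rewrite /marg mulr_suml.
split.
- by move=> jj; rewrite divr_ge0 // ltW.
- have -> : inner C (fun jj => P jj / b) = inner C P / b.
    by rewrite /inner mulr_suml; apply: eq_bigr => jj _; rewrite mulrA.
  rewrite ler_pdivrMr // mulrC -ler_pdivrMr //.
  apply: (le_trans _ ceil); exact: inner_le_potential.
- move=> i j; rewrite mgE ler_pdivrMr // mulrC.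
  have := mu0 i j; rewrite le_eqVlt => /predU1P[m0|mp].
    rewrite -m0 mulr0 /marg big1 // => jj /eqP jji; apply: Ps => js.
    by have := js i; rewrite jji -m0 ltxx.
  by rewrite -ler_pdivrMr //; apply: (le_trans _ ceil); exact: marg_le_potential.
- have -> : mass (fun jj => P jj / b) = mass P / b by rewrite /mass mulr_suml.
  rewrite ler_pdivlMr //; apply: le_trans mP.
  rewrite /b mulrCA -[leRHS]mulr1 ler_wpM2l ?(ltW h0) //.
  have p2 : 0 <= eps ^+ 2 by exact: sqr_ge0.
  have p3 : 0 <= eps ^+ 3 by rewrite exprn_ge0 // ltW.
  have p4 : 0 <= eps ^+ 4 by rewrite exprn_ge0 // ltW.
  have p5 : 0 <= eps ^+ 5 by rewrite exprn_ge0 // ltW.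
  have -> : (1 - 4 * eps) * (1 + eps) ^+ 4 =
     1 - 10 * eps ^+ 2 - 20 * eps ^+ 3 - 15 * eps ^+ 4 - 4 * eps ^+ 5 by ring.
  lra.
Qed.

(** ** The bottleneck oracle by sequential maximisation *)

Section Oracle.
Variables (D : 'I_k -> 'I_n -> R) (g : tensor R n k) (q : midx n k).
Hypotheses (D0 : forall i j, 0 <= D i j) (g0 : forall jj, 0 <= g jj).

(** The scalings that restrict a tensor to the multi-indices agreeing with [q] in the
  first [p] coordinates. *)
Definition fixed (p : nat) i j : R :=
  if (i < p)%N then (if j == q i then D i j else 0) else D i j.

Definition fixed_tensor p : tensor R n k := fun jj => \prod_i fixed p i (jj i) * g jj.

Hypothesis best : forall p (pk : (p < k)%N) j,
  marg (fixed_tensor p) (Ordinal pk) j <= marg (fixed_tensor p) (Ordinal pk) (q (Ordinal pk)).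

Lemma fixed_tensorS p (pk : (p < k)%N) :
  mass (fixed_tensor p.+1) = marg (fixed_tensor p) (Ordinal pk) (q (Ordinal pk)).
Proof.
rewrite /mass /marg [RHS]big_mkcond /=; apply: eq_bigr => jj _; rewrite /fixed_tensor.
set o := Ordinal pk; rewrite (bigD1 o) //= [in RHS](bigD1 o) //=.
rewrite {1}/fixed /= ltnSn {2}/fixed ltnn.
case: ifP => _; last by rewrite !mul0r.
congr (_ * _ * _); apply: eq_bigr => i io; rewrite /fixed ltnS leq_eqVlt.
by rewrite -[p]/(val o) (inj_eq val_inj) (negPf io).
Qed.

Lemma fixed_mass p : (p <= k)%N -> mass (fixed_tensor 0) <= n%:R ^+ p * mass (fixed_tensor p).
Proof.
elim: p => [|p IH] pk; first by rewrite mul1r.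
apply: le_trans (IH (ltnW pk)) _; rewrite exprSr -mulrA ler_wpM2l ?exprn_ge0 //.
rewrite (fixed_tensorS pk) -(sum_marg (fixed_tensor p) (Ordinal pk)).
apply: le_trans (ler_sum _ (fun j _ => best pk j)) _.
by rewrite sumr_const card_ord -[leLHS]mulr_natl.
Qed.

(** Fixing the coordinates one at a time, each to a maximal entry of the marginal of
  what is left, keeps at least a fraction [1 / n] of the mass every time. *)
Lemma oracle_best jj :
  \prod_i D i (jj i) * g jj <= n%:R ^+ k * (\prod_i D i (q i) * g q).
Proof.
have e0 : fixed_tensor 0 =1 fun jj => \prod_i D i (jj i) * g jj by [].
have ek : mass (fixed_tensor k) = \prod_i D i (q i) * g q.
  rewrite /mass (bigD1 q) //= big1 ?addr0.
    by rewrite /fixed_tensor; congr (_ * _); apply: eq_bigr => i _; rewrite /fixed ltn_ord eqxx.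
  move=> jj' ne; rewrite /fixed_tensor.
  have [i ii] : exists i, jj' i != q i.
    apply/existsP; rewrite -negb_forall; apply/negP => /forallP al.
    by case/eqP: ne; apply/ffunP => i; apply/eqP.
  by rewrite (bigD1 i) //= /fixed ltn_ord (negPf ii) !mul0r.
rewrite -ek; apply: le_trans (fixed_mass (leqnn k)).
rewrite -[leLHS]/(fixed_tensor 0 jj); apply: entry_le_mass => jj'.
by rewrite mulr_ge0 // prodr_ge0.
Qed.

End Oracle.

(** The slope is a sum of functions of one coordinate and a multiple of the cost.
  Hence [exp (- H * slope)] is, up to a constant factor, the tensor of scalings [D]
  times a Gibbs kernel, and a multi-index that maximises it up to [n ^ k] minimises
  the slope up to [k * ln n / H]. *)
Lemma oracle_slope (P c0 g : tensor R n k) (c H : R) (q : midx n k) :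
  let w i j := wmarg mu P i j / mu i j / wtotal C mu lam P in
  let D i j := if 0 < mu i j then expR (- (H * w i j)) else 0 in
  let th := H * wcost C lam P / (wtotal C mu lam P * lam * (2 * c)) in
  0 < c -> 0 < H -> (forall jj, C jj = (c0 jj + 3 * c) / (2 * c)) ->
  (forall jj, expR (- (th * c0 jj) - 1 / 8) <= g jj <= expR (- (th * c0 jj))) ->
  (forall jj, \prod_i D i (jj i) * g jj <= n%:R ^+ k * (\prod_i D i (q i) * g q)) ->
  in_support mu q /\
  forall jj, in_support mu jj ->
    slope C mu lam P q <= slope C mu lam P jj + (k%:R * ln n%:R + 1 / 8) / H.
Proof.
move=> w D th c1 H0 CE gE best; pose Z := wtotal C mu lam P.
have Z0 : 0 < Z by exact: wtotal_gt0.
have n0 := n_gt0 k0 mu1.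
have nk : 0 < (n%:R : R) ^+ k by rewrite exprn_gt0 // ltr0n.
have g0 jj : 0 < g jj by case/andP: (gE jj) => h _; exact: lt_le_trans (expR_gt0 _) h.
have Dp jj : in_support mu jj -> \prod_i D i (jj i) = expR (- (H * \sum_i w i (jj i))).
  move=> js; rewrite mulr_sumr -sumrN expR_sum; apply: eq_bigr => i _.
  by rewrite /D js.
have slopeE jj : H * slope C mu lam P jj =
    H * \sum_i w i (jj i) + th * c0 jj + 3 * H * wcost C lam P / (2 * Z * lam).
  have -> : \sum_i w i (jj i) = (\sum_i wmarg mu P i (jj i) / mu i (jj i)) / Z.
    by rewrite mulr_suml.
  have l : lam != 0 by rewrite gt_eqF.
  have cc : c != 0 by rewrite gt_eqF.
  have alg (z s u x : R) : z != 0 -> H * ((u * ((x + 3 * c) / (2 * c) / lam) + s) / z) =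
      H * (s / z) + H * u / (z * lam * (2 * c)) * x + 3 * H * u / (2 * z * lam).
    by move=> z0; field; rewrite z0 l cc.
  by rewrite /slope CE; apply: alg; rewrite gt_eqF.
pose j0 i := projT1 (sigW (support_point mu1 i)).
have j0P : in_support mu [ffun i => j0 i].
  by move=> i; rewrite ffunE /j0; case: sigW.
have qs : in_support mu q.
  have := best [ffun i => j0 i].
  have : 0 < \prod_i D i ([ffun i => j0 i] i) * g [ffun i => j0 i].
    by rewrite Dp // mulr_gt0 ?expR_gt0.
  move=> h1 /(lt_le_trans h1); rewrite pmulr_rgt0 // pmulr_lgt0 // => h2 i.
  rewrite ltNge; apply/negP => le; move: h2; rewrite (bigD1 i) //=.
  have -> : D i (q i) = 0 by rewrite /D ltNge le.
  by rewrite mul0r ltxx.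
split=> // jj js.
have lo : expR (- (H * slope C mu lam P jj) + 3 * H * wcost C lam P / (2 * Z * lam) - 1 / 8) <=
    \prod_i D i (jj i) * g jj.
  rewrite Dp // slopeE; set x := 3 * H * _ / _; set y := H * \sum_i _.
  have -> : - (y + th * c0 jj + x) + x - 1 / 8 = - y + (- (th * c0 jj) - 1 / 8) by ring.
  by rewrite expRD ler_wpM2l ?expR_ge0 //; case/andP: (gE jj).
have hi : \prod_i D i (q i) * g q <=
    expR (- (H * slope C mu lam P q) + 3 * H * wcost C lam P / (2 * Z * lam)).
  rewrite Dp // slopeE; set x := 3 * H * _ / _; set y := H * \sum_i _.
  have -> : - (y + th * c0 q + x) + x = - y + - (th * c0 q) by ring.
  by rewrite expRD ler_wpM2l ?expR_ge0 //; case/andP: (gE q).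
have nkE : (n%:R : R) ^+ k = expR (k%:R * ln n%:R).
  by rewrite expRM_natl lnK // posrE ltr0n.
have := le_trans lo (le_trans (best jj) (ler_wpM2l (ltW nk) hi)).
rewrite nkE -expRD ler_expR => h.
rewrite -(ler_pM2l H0) mulrDr [X in _ <= _ + X]mulrCA divff ?gt_eqF // mulr1.
by move: h; lra.
Qed.

End MwuStep1.

(** ** Completing a partial plan *)
Section Filling.
Variables (R : realType) (n k : nat) (C : tensor R n k) (mu : 'I_k -> 'I_n -> R).
Hypotheses (k0 : (0 < k)%N) (mu1 : forall i, in_simplex (mu i)).
Hypothesis C12 : forall jj, 1 <= C jj <= 2.
Implicit Types (P Q : tensor R n k) (jj : midx n k) (a : R) (i : 'I_k) (j : 'I_n).

Definition sub_plan P : Prop :=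
  (forall jj, 0 <= P jj) /\ (forall i j, marg P i j <= mu i j).

Definition open_cells P : {set 'I_k * 'I_n} := [set c | 0 < deficit mu P c.1 c.2].

Lemma sum_deficit P i : \sum_j deficit mu P i j = 1 - mass P.
Proof. exact: sum_residual. Qed.

Lemma max_deficit_gt0 P i j0 : mass P < 1 ->
  (forall j, deficit mu P i j <= deficit mu P i j0) -> 0 < deficit mu P i j0.
Proof.
move=> m1 mx; rewrite ltNge; apply/negP => le.
have : \sum_j deficit mu P i j <= 0 by apply: sumr_le0 => j _; exact: le_trans (mx j) le.
by rewrite sum_deficit; lra.
Qed.

(** A step closes a cell for good, so there are at most as many steps as cells; an
  entry costs at most 2 per unit of mass. *)
Lemma fill_step P jj a : sub_plan P -> mass P < 1 ->
  (forall i j, deficit mu P i j <= deficit mu P i (jj i)) ->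
  (exists i, a = deficit mu P i (jj i)) -> (forall i, a <= deficit mu P i (jj i)) ->
  let P' := add_delta P a jj in
  [/\ 0 < a, sub_plan P', (#|open_cells P'| < #|open_cells P|)%N &
      inner C P' <= inner C P + 2 * (mass P' - mass P)].
Proof.
move=> [P0 Pm] m1 mx [i aE] al P'.
have a0 : 0 < a by rewrite aE; exact: max_deficit_gt0.
have defE i' j : deficit mu P' i' j = deficit mu P i' j - a * (jj i' == j)%:R.
  by rewrite /deficit marg_add_delta opprD addrA.
have def_le i' j : deficit mu P' i' j <= deficit mu P i' j.
  by rewrite defE gerBl mulr_ge0 // ltW.
split=> //.
- split=> [jj'|i' j]; first by rewrite addr_ge0 // mulr_ge0 // ltW.
  rewrite -subr_ge0 -/(deficit mu P' i' j) defE; have [<-|_] := eqVneq (jj i') j.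
    by rewrite mulr1 subr_ge0.
  by rewrite mulr0 subr0 subr_ge0.
- apply: proper_card; apply/properP; split.
    by apply/fintype.subsetP => c; rewrite !inE => h; exact: lt_le_trans h (def_le _ _).
  exists (i, jj i); rewrite inE /=; first by rewrite -aE.
  by rewrite defE eqxx mulr1 -aE subrr ltxx.
- rewrite inner_add_delta mass_add_delta lerD2l addrAC subrr add0r mulrC.
  by rewrite ler_wpM2r ?(ltW a0) //; case/andP: (C12 jj).
Qed.

Lemma sub_plan_full P : sub_plan P -> 1 <= mass P -> feasible mu P.
Proof.
move=> [P0 Pm] m1; split=> // i j; apply/eqP; rewrite eq_sym -subr_eq0.
have h : \sum_j deficit mu P i j == 0.
  rewrite eq_le sum_deficit subr_le0 m1 -(sum_deficit P i).
  by apply: sumr_ge0 => j' _; rewrite subr_ge0.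
move: h; rewrite psumr_eq0; last by move=> j' _; rewrite subr_ge0.
by move/allP/(_ j); rewrite mem_index_enum => /(_ isT).
Qed.

End Filling.

(** ** Normalised costs *)
Section Normalisation.
Variables (R : realType) (n k : nat) (C : tensor R n k) (mu : 'I_k -> 'I_n -> R) (eps : R).
Hypotheses (k0 : (0 < k)%N) (mu1 : forall i, in_simplex (mu i)) (eps0 : 0 < eps).
Implicit Types (P Q : tensor R n k) (jj : midx n k).

Definition cost_scale : R := if tmax C == 0 then 1 else tmax C.

Lemma le_tmax jj : `|C jj| <= tmax C.
Proof. exact: (le_bigmax _ (fun jj => `|C jj|) jj). Qed.

Lemma tmax_ge0 : 0 <= tmax C.
Proof. by rewrite /tmax; elim/big_ind : _ => // x y x0 y0; rewrite le_max x0. Qed.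

Lemma cost_scale_gt0 : 0 < cost_scale.
Proof. by rewrite /cost_scale; case: eqP => // /eqP t0; rewrite lt_def t0 tmax_ge0. Qed.

Lemma cost_scale_ge jj : `|C jj| <= cost_scale.
Proof.
apply: le_trans (le_tmax jj) _; rewrite /cost_scale; case: eqP => // ->; exact: ler01.
Qed.

Lemma normalizedE jj : normalized_cost C jj = (C jj + 3 * cost_scale) / (2 * cost_scale).
Proof. by []. Qed.

Lemma normalized12 jj : 1 <= normalized_cost C jj <= 2.
Proof.
have c0 := cost_scale_gt0; have := cost_scale_ge jj; rewrite ler_norml => /andP[c1 c2].
have c2' : 0 < 2 * cost_scale by rewrite mulr_gt0.
rewrite normalizedE ler_pdivlMr // ler_pdivrMr //; apply/andP; split; lra.
Qed.

Lemma normalized_eps_bounds :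
  let e := normalized_eps C eps in [/\ 0 < e, e <= 1 / 10 & e * (20 * tmax C) <= eps].
Proof.
rewrite /normalized_eps /=; case: eqP => [->|/eqP t0].
  by split; [rewrite divr_gt0 | | rewrite !mulr0 ltW].
have tp : 0 < tmax C by rewrite lt_def t0 tmax_ge0.
have tp' : 0 < 20 * tmax C by rewrite mulr_gt0.
split.
- by rewrite lt_min divr_gt0 //= divr_gt0.
- by rewrite ge_min lexx.
- by rewrite -ler_pdivlMr // ge_min lexx orbT.
Qed.

(** Unless the cost vanishes, the normalised accuracy is at most [eps / (20 * Cmax)] and the normalised unit is
  [2 * Cmax], which leaves room for an error of ten times the accuracy. *)
Lemma normalized_mot P : feasible mu P ->
  (forall Q, feasible mu Q ->
     inner (normalized_cost C) P <= inner (normalized_cost C) Q + 9 * normalized_eps C eps) ->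
  mot_approx C mu eps P.
Proof.
move=> fP opt; split=> // Q fQ; have c0 := cost_scale_gt0.
have [e0 _ e2] := normalized_eps_bounds.
have innerE T : feasible mu T ->
    inner C T = 2 * cost_scale * inner (normalized_cost C) T - 3 * cost_scale.
  move=> fT; have mT := feasible_mass (mu1 (Ordinal k0)) fT.
  have -> : 3 * cost_scale = 3 * cost_scale * mass T by rewrite mT mulr1.
  rewrite /inner /mass !mulr_sumr -sumrB.
  have alg (x y c : R) : c != 0 -> x * y = 2 * c * ((x + 3 * c) / (2 * c) * y) - 3 * c * y.
    by move=> z; field.
  by apply: eq_bigr => jj _; rewrite normalizedE; apply: alg; rewrite gt_eqF.
have [t0|t0] := eqVneq (tmax C) 0.
  have C0 jj : C jj = 0.
    by apply/eqP; rewrite -normr_le0 -t0; exact: le_tmax.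
  have i0 T : inner C T = 0 by apply: big1 => jj _; rewrite C0 mul0r.
  by rewrite !i0 add0r ltW.
have cE : cost_scale = tmax C by rewrite /cost_scale (negPf t0).
rewrite !innerE // addrAC lerD2r.
apply: (@le_trans _ _ (2 * cost_scale * (inner (normalized_cost C) Q + 9 * normalized_eps C eps))).
  by rewrite ler_wpM2l ?opt // mulr_ge0 // ltW.
rewrite mulrDr lerD2l; rewrite -cE in e2.
move: (normalized_eps C eps) e0 e2 => e e0; rewrite mulrCA => e2.
have -> : 2 * cost_scale * (9 * e) = 18 * (e * cost_scale) by ring.
have : 0 <= e * cost_scale by rewrite mulr_ge0 // ltW.
by move: e2; lra.
Qed.

End Normalisation.

(** ** Sparse tensors as lists of weighted entries *)

Section SparseLists.
Variables (R : realType) (n k : nat).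
Implicit Types (L : seq (midx n k * R)) (jj : midx n k).

Definition of_list L : tensor R n k := fun jj => \sum_(p <- L) p.2 * (jj == p.1)%:R.

Lemma of_list_nil : of_list [::] = fun=> 0.
Proof. by apply/funext => jj; rewrite /of_list big_nil. Qed.

Lemma of_list_rcons L jj a : of_list (rcons L (jj, a)) = add_delta (of_list L) a jj.
Proof.
by apply/funext => jj'; rewrite /of_list /add_delta -cats1 big_cat big_seq1.
Qed.

Lemma of_list_scale L b : of_list [seq (p.1, p.2 / b) | p <- L] = fun jj => of_list L jj / b.
Proof.
apply/funext => jj; rewrite /of_list big_map mulr_suml; apply: eq_bigr => p _.
by rewrite mulrAC.
Qed.

Lemma inner_of_list (C : tensor R n k) L : inner C (of_list L) = \sum_(p <- L) C p.1 * p.2.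
Proof.
elim/last_ind: L => [|L [jj a] IH].
  by rewrite of_list_nil big_nil; apply: big1 => jj _; rewrite mulr0.
by rewrite of_list_rcons inner_add_delta IH -cats1 big_cat big_seq1 mulrC.
Qed.

Lemma marg_of_list L i j : marg (of_list L) i j = \sum_(p <- L) (if p.1 i == j then p.2 else 0).
Proof.
elim/last_ind: L => [|L [jj a] IH].
  by rewrite of_list_nil big_nil; exact: big1.
rewrite of_list_rcons marg_add_delta IH -cats1 big_cat big_seq1 /=.
by case: eqP; rewrite ?mulr1 ?mulr0.
Qed.

Lemma mass_of_list L : mass (of_list L) = \sum_(p <- L) p.2.
Proof.
elim/last_ind: L => [|L [jj a] IH].
  by rewrite of_list_nil big_nil; exact: big1.
by rewrite of_list_rcons mass_add_delta IH -cats1 big_cat big_seq1.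
Qed.

(** The list may repeat a multi-index, as MWU may choose it several times; its length
  still bounds the number of non-zero entries. *)
Lemma nnz_of_list L : (nnz (of_list L) <= size L)%N.
Proof.
apply: (@leq_trans #|[seq p.1 | p <- L]|); last first.
  by apply: leq_trans (card_size _) _; rewrite size_map.
apply: subset_leq_card.
apply/fintype.subsetP => jj; rewrite inE; apply: contraR => nin.
apply/eqP; apply: big1_seq => p /andP[_ pL]; case: eqP => [jE|_]; last by rewrite mulr0.
by case/negP: nin; rewrite jE; apply: map_f.
Qed.

End SparseLists.

(** * Multiplicative weights on low-rank plus sparse costs *)

(** The current tensor is a list of weighted multi-indices: positions in the
  natural array 3, values in the real array 13, length in variable 4.  The best
  plan found by the search is kept in the locations 4, 14 and 14.  Real cells: 15
  the cost scale, 16 the accuracy, 17 the threshold of the mass, 18 the bound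
  [lam], 19 the sharpness [H], 24 and 25 the ends of the search interval. *)

Lemma wp_fill1n (R : realType) N (st : store R) v x B a xs e (addr : nat -> seq nat) f Q :
  (x == v) = false -> nvar st x = B -> (B <= N)%N ->
  (forall i (st' : store R), nvar st' v = i -> (forall y, y != v -> nvar st' y = nvar st y) ->
     address st' xs = addr i) ->
  injective addr ->
  (forall i (st' : store R), (i < B)%N -> same [:: v] [:: a] [::] st st' -> nvar st' v = i ->
     neval st' e = f i) ->
  (forall st' : store R, same [:: v] [:: a] [::] st st' ->
     (forall i, (i < B)%N -> narr st' a (addr i) = f i) ->
     (forall l, (forall i, (i < B)%N -> l != addr i) -> narr st' a l = narr st a l) ->
     Q st') ->
  wp N (PFor v (NVar x) (PNatA a xs e)) Q st.
Proof.
move=> xv xB BN ad adI ev HQ.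
pose Inv p (st' : store R) := (forall i, (i < p)%N -> narr st' a (addr i) = f i) /\
     (forall l, (forall i, (i < p)%N -> l != addr i) -> narr st' a l = narr st a l).
apply: (wp_for (B := B) (Inv := Inv)) => //=.
- by move=> st' [s1 _ _]; rewrite s1 // inE xv.
- move=> p st' pB vp ss [I1 I2].
  have adE : address st' xs = addr p.
    by apply: ad => // y yv; case: ss => s1 _ _; apply: s1; rewrite inE yv.
  have e1 := ev p st' pB ss vp.
  rewrite e1 adE; split=> [i ip|l lp] /=; rewrite eqxx /=.
    case: eqP => [/adI ->//|ne]; apply: I1.
    have : i != p by apply/eqP => ip'; apply: ne; rewrite ip'.
    by lia.
  rewrite (negPf (lp p _)) //; apply: I2 => i ip; apply: lp; exact: ltnW.
- by move=> st' ss vB [I1 I2]; apply: HQ.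
Qed.

Definition PCopyList (pa va xa pb vb xb : nat) : prog :=
  PSeq (PFor 17 (NVar xa)
    (PSeq (PFor 18 (NVar 1) (PNatA pb [:: 17; 18]%N (NGet pa [:: 17; 18]%N)))
          (PReal vb [:: 17]%N (XA1 va 17))))
  (PNat xb (NVar xa)).

Definition CX (r : nat) (a : nexp) : xexp := XAdd (RX r a) (SX a).
Definition NCX (r : nat) (a : nexp) : xexp :=
  XDiv (XAdd (CX r a) (XMul (XN 3) (XC 15))) (XMul (XN 2) (XC 15)).

Definition LMARG : xexp :=
  XSum 25 (NVar 4) (XIfEq (NGet 3 [:: 25; 5]%N) (NVar 6) (XA1 13 25) X0).
Definition LINNER (r : nat) : xexp :=
  XSum 25 (NVar 4) (XMul (NCX r (NGet 3 [:: 25; 20]%N)) (XA1 13 25)).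
Definition LMASS : xexp := XSum 25 (NVar 4) (XA1 13 25).

Definition PFill2 (a : nat) (E : xexp) : prog :=
  PFor 5 (NVar 1) (PFor 6 (NVar 0) (PReal a [:: 5; 6]%N E)).

Definition PWeights (r : nat) : prog :=
  PSeq (PFill2 22 (XIfR (XA2 0 5 6) X0 X0 (XExp (XDiv LMARG (XA2 0 5 6)))))
  (PSeq (PReal 20 [::] (XExp (XDiv (LINNER r) (XC 18))))
  (PSeq (PReal 21 [::] (XAdd (XC 20) (XSum 20 (NVar 1) (XSum 21 (NVar 0) (XA2 22 20 21)))))
  (PSeq (PFill2 5 (XIfR (XA2 0 5 6) X0 X0
           (XExp (XSub X0 (XMul (XC 19) (XDiv (XDiv (XA2 22 5 6) (XA2 0 5 6)) (XC 21)))))))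
  (PReal 6 [::] (XDiv (XMul (XC 19) (XC 20))
     (XMul (XMul (XC 21) (XC 18)) (XMul (XN 2) (XC 15)))))))).

(** Rows of array 5 below the current coordinate are already reduced to their chosen
  entry, so the same marginal block serves for every conditional marginal. *)
Definition PPick (r : nat) : prog :=
  PFor 7 (NVar 1)
   (PSeq (PMARG r)
   (PSeq (PFor 6 (NVar 0) (PReal 8 [:: 6]%N (XA2 7 7 6)))
   (PSeq (PArgmax 9 11 0 8)
   (PSeq (PNatA 2 [:: 7]%N (NVar 9))
     (PFor 6 (NVar 0) (PReal 5 [:: 7; 6]%N (XIfEq (NVar 6) (NVar 9) (XA2 5 7 6) X0))))))).

Definition PSlope (r : nat) : prog :=
  PReal 23 [::] (XDiv (XAdd (XMul (XC 20) (XDiv (NCX r (NGet 2 [:: 20]%N)) (XC 18)))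
     (XSum 20 (NVar 1) (XDiv (XGet 22 [:: NVar 20; NGet 2 [:: 20]%N])
        (XGet 0 [:: NVar 20; NGet 2 [:: 20]%N])))) (XC 21)).

Definition PAppend (E : xexp) : prog :=
  PSeq (PReal 13 [:: 4]%N E)
  (PSeq (PFor 7 (NVar 1) (PNatA 3 [:: 4; 7]%N (NGet 2 [:: 7]%N)))
    (PNat 4 (NAdd (NVar 4) (NCst 1)))).

Section MwuBlocks.
Variables (R : realType) (r : nat) (I : instance R r) (eps : R) (N : nat).
Implicit Types (st : store R) (Q : store R -> Prop).
Local Notation n := (side I).
Local Notation k := (nmarg I).
Local Notation mu := (target I).
Local Notation C := (normalized_cost (cost I)).
Local Notation c := (cost_scale (cost I)).
Local Notation e := (normalized_eps (cost I) eps).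
Local Notation eta := (mwu_eta n k e).
Hypotheses (eps0 : 0 < eps) (k0 : (0 < k)%N) (n0 : (0 < n)%N).
Hypothesis mu1 : forall i, in_simplex (mu i).
Hypothesis inj : injective (spos I).
Hypotheses (rN : (r <= N)%N) (kN : (k <= N)%N) (nN : (n <= N)%N) (sN : (spars I <= N)%N).
Variables (K : nat).
Hypothesis RK : forall jj, `|low_rank_part I jj| <= K%:R * Cmax I.

(** With this sharpness the loss [k * ln n / H] of the oracle, and that of the
  kernel, stay within the accuracy. *)
Definition mwu_H : R := (k%:R * ln n%:R + 1) / e.
Definition mwu_degree : nat := degree_of (mwu_H * K%:R).
Hypothesis mN : (mwu_degree < N)%N.
Local Notation m := mwu_degree.

Definition jj0 : midx n k := [ffun=> Ordinal n0].

Definition list_at pa va x (L : seq (midx n k * R)) st : Prop :=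
  nvar st x = size L /\ forall t, (t < size L)%N ->
    (forall i, narr st pa [:: t; val i] = (nth (jj0, 0) L t).1 i) /\
    rarr st va [:: t] = (nth (jj0, 0) L t).2.

Lemma list_at_same xs bs rs st st' pa va x L :
  x \notin xs -> pa \notin bs -> va \notin rs ->
  same xs bs rs st st' -> list_at pa va x L st -> list_at pa va x L st'.
Proof.
move=> xn bn rn [s1 s2 s3] [h1 h2]; split; first by rewrite s1.
by move=> t tL; have [g1 g2] := h2 t tL; split=> [i|]; rewrite ?s2 ?s3.
Qed.

Lemma sum_list (L : seq (midx n k * R)) (F : midx n k * R -> R) :
  \sum_(t < size L) F (nth (jj0, 0) L t) = \sum_(p <- L) F p.
Proof. by rewrite (big_nth (jj0, 0)) big_mkord. Qed.

Lemma wp_copy_list pa va xa pb vb xb L st Q :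
  nvar st 1 = k -> (size L <= N)%N -> list_at pa va xa L st ->
  (xa == 17) || (xa == 18) || (pa == pb) || (va == vb) = false ->
  (forall st', same [:: 17; 18; xb]%N [:: pb] [:: vb] st st' -> list_at pb vb xb L st' -> Q st') ->
  wp N (PCopyList pa va xa pb vb xb) Q st.
Proof.
move=> k1 LN LA /norP[/norP[/norP[x17 x18] pab] vab] HQ; have [hM hL] := LA.
pose Inv p st' := forall t, (t < p)%N ->
    (forall i : 'I_k, narr st' pb [:: t; val i] = (nth (jj0, 0) L t).1 i) /\
    rarr st' vb [:: t] = (nth (jj0, 0) L t).2.
apply: wp_seq; apply: (wp_for (B := size L) (Inv := Inv)) => //.
- by move=> st' [s1 _ _]; rewrite /= s1 //= !inE !negb_or x17 x18.
- move=> p st1 pL vp ss1 I1; have [s1 s2 s3] := ss1; have [hp1 hp2] := hL p pL.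
  pose F (i : nat) : nat := if insub i is Some i' then (nth (jj0, 0) L p).1 (i' : 'I_k) else 0%N.
  apply: wp_seq; apply: (wp_fill1n (B := k) (addr := fun i => [:: p; i]) (f := F)) => //.
  + by rewrite s1.
  + by move=> i st' vi h; rewrite /address /= vi h // vp.
  + by move=> i j [].
  + move=> i st2 ik ss2 vi; have [t1 t2 t3] := ss2.
    have pbp : pa \notin [:: pb] by rewrite inE pab.
    have aE : address st2 [:: 17; 18]%N = [:: p; i] by rewrite /address /= vi t1 // vp.
    change (narr st2 pa (address st2 [:: 17; 18]%N) = F i).
    by rewrite aE t2 // (s2 pa pbp) /F insubT (hp1 (Sub i ik)).
  + move=> st2 ss2 F1 F2; have [t1 t2 t3] := ss2.
    have v2 : nvar st2 17 = p by rewrite t1.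
    apply: (wp_real (x := (nth (jj0, 0) L p).2)).
      apply: xval_get; first by rewrite /= v2.
      have vbp : va \notin [:: vb] by rewrite inE vab.
      by rewrite t3 // (s3 va vbp) hp2.
    move=> t; rewrite /= ltnS leq_eqVlt => /predU1P[->|tp].
      split; first by move=> i; have := F1 i (ltn_ord i); rewrite /F valK.
      by rewrite /address /= v2 !eqxx.
    have [g1 g2] := I1 t tp; split.
      move=> i; rewrite F2; first exact: g1.
      by move=> j _; apply/eqP => -[tE _]; lia.
    rewrite /address /= v2 eqxx /=; case: eqP => [[tE]|_]; first by lia.
    by rewrite t3.
- move=> st1 ss1 v1 I1; apply: wp_nat; have [s1 s2 s3] := ss1.
  apply: HQ.
    apply: (same_comp ss1 (same_nvar st1 xb _)).
    by rewrite /= !inE !eqxx ?orbT.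
  by split; first by rewrite /= eqxx s1 //= !inE !negb_or x17 x18.
Qed.

(** ** Evaluation of the weights *)

Definition mwu_env st : Prop :=
  [/\ loaded I eps [::] st, nvar st 3 = m, rarr st 15 [::] = c, rarr st 16 [::] = e &
      rarr st 17 [::] = eta /\ rarr st 19 [::] = mwu_H].

Lemma mwu_env_same xs bs rs st st' :
  [&& 0%N \notin xs, 1%N \notin xs, 2%N \notin xs & 3%N \notin xs] ->
  (0%N \notin bs) && (1%N \notin bs) ->
  [&& 0%N \notin rs, 1%N \notin rs, 2%N \notin rs, 3%N \notin rs & 4%N \notin rs] ->
  [&& 15 \notin rs, 16 \notin rs, 17 \notin rs & 19 \notin rs]%N ->
  same xs bs rs st st' -> mwu_env st -> mwu_env st'.
Proof.
move=> /and4P[x0 x1 x2 x3] b r' /and4P[r5 r6 r7 r9] ss [ld m3 h5 h6 [h7 h9]].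
have [s1 s2 s3] := ss.
split; rewrite ?s1 ?s3 //.
by apply: loaded_same ss ld => //; rewrite x0 x1 x2.
Qed.

Lemma env_nm st : mwu_env st -> nvar st 0 = n /\ nvar st 1 = k.
Proof. by move=> [ld _ _ _ _]; exact: loaded_nm ld. Qed.

Lemma env_mu st (i : 'I_k) (j : 'I_n) :
  loaded I eps [::] st -> rarr st 0 [:: val i; val j] = mu i j.
Proof. by case=> _ [_ [_ [_ [_ [h _]]]]]; exact: h. Qed.

Lemma xval_NCX st a (jj : midx n k) :
  loaded I eps [::] st -> rarr st 15 [::] = c ->
  (forall (i : 'I_k) l, neval (set_nvar (set_nvar st 23 l) 20 i) a = jj i) ->
  (forall (i : 'I_k) l, neval (set_nvar (set_nvar st 24 l) 20 i) a = jj i) ->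
  xval N st (NCX r a) (C jj).
Proof.
move=> ld h5 a1 a2; apply: xval_eq.
  apply: xval_bin.
    apply: xval_bin; last by apply: xval_bin; [exact: xval_nat | apply: xval_get].
    by apply: xval_bin; [apply: xval_RX ld rN kN a1 | apply: xval_SX ld sN kN a2].
  by apply: xval_bin; [exact: xval_nat | apply: xval_get].
by rewrite h5.
Qed.

Lemma xval_LMARG L st (i : 'I_k) (j : 'I_n) : (size L <= N)%N -> list_at 3 13 4 L st ->
  nvar st 5 = i -> nvar st 6 = j -> xval N st LMARG (marg (of_list L) i j).
Proof.
move=> LN [hM hL] h5 h6; apply: xval_eq.
  apply: (@xval_sum _ _ _ _ _ _ (size L)) => [//|//|t].
  have [p1 p2] := hL t (ltn_ord t).
  apply: xval_ifeq; last exact: xval_nat.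
  by apply: xval_get; last exact: p2.
rewrite marg_of_list -sum_list; apply: eq_bigr => t _ /=.
have [p1 p2] := hL t (ltn_ord t).
by rewrite /address /= h5 h6 p1.
Qed.

Lemma xval_LINNER L st : (size L <= N)%N -> list_at 3 13 4 L st ->
  loaded I eps [::] st -> rarr st 15 [::] = c ->
  xval N st (LINNER r) (inner C (of_list L)).
Proof.
move=> LN [hM hL] ld h5; rewrite inner_of_list -sum_list.
apply: (@xval_sum _ _ _ _ _ _ (size L)) => [//|//|t].
have [p1 p2] := hL t (ltn_ord t).
apply: xval_bin; last by apply: xval_get; last exact: p2.
by apply: xval_NCX => // i l; exact: p1.
Qed.

Lemma xval_LMASS L st : (size L <= N)%N -> list_at 3 13 4 L st ->
  xval N st LMASS (mass (of_list L)).
Proof.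
move=> LN [hM hL]; rewrite mass_of_list -sum_list.
apply: (@xval_sum _ _ _ _ _ _ (size L)) => [//|//|t].
have [p1 p2] := hL t (ltn_ord t).
by apply: xval_get; last exact: p2.
Qed.

Lemma wp_fill2m a E (f : 'I_k -> 'I_n -> R) st Q : nvar st 0 = n -> nvar st 1 = k ->
  (forall i j st', same [:: 5; 6]%N [::] [:: a] st st' -> nvar st' 5 = val i ->
     nvar st' 6 = val j -> rarr st' a [:: val i; val j] = rarr st a [:: val i; val j] ->
     xval N st' E (f i j)) ->
  (forall st', same [:: 5; 6]%N [::] [:: a] st st' -> holds_mat st' a f -> Q st') ->
  wp N (PFill2 a E) Q st.
Proof.
move=> e0 e1 ev HQ.
pose F (i j : nat) : R := if insub i is Some i' then if insub j is Some j' then f i' j' else 0 else 0.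
apply: (wp_fill2 (Bx := k) (By := n) (f := F)) => //.
  move=> i j st' iB jB ss vi vj; rewrite /F !insubT => h.
  by apply: ev.
move=> st' ss h; apply: HQ => // i j.
by have := h i j (ltn_ord i) (ltn_ord j); rewrite /F !valK.
Qed.

Definition weight_mat (P : tensor R n k) (i : 'I_k) (j : 'I_n) : R :=
  if 0 < mu i j then wmarg mu P i j else 0.
Definition scale_mat (lam : R) (P : tensor R n k) (i : 'I_k) (j : 'I_n) : R :=
  if 0 < mu i j then expR (- (mwu_H * (wmarg mu P i j / mu i j / wtotal C mu lam P))) else 0.
(** The coefficient of the cost in [H] times the slope, hence the inverse temperature
  of the kernel. *)
Definition temperature (lam : R) (P : tensor R n k) : R :=
  mwu_H * wcost C lam P / (wtotal C mu lam P * lam * (2 * c)).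

Lemma wp_weights lam L st Q : mwu_env st -> (size L <= N)%N -> list_at 3 13 4 L st ->
  rarr st 18 [::] = lam ->
  (forall st', same [:: 5; 6]%N [::] [:: 5; 6; 20; 21; 22]%N st st' ->
     holds_mat st' 22 (weight_mat (of_list L)) ->
     rarr st' 20 [::] = wcost C lam (of_list L) ->
     rarr st' 21 [::] = wtotal C mu lam (of_list L) ->
     holds_mat st' 5 (scale_mat lam (of_list L)) ->
     rarr st' 6 [::] = temperature lam (of_list L) -> Q st') ->
  wp N (PWeights r) Q st.
Proof.
move=> env LN LA hl HQ; set P := of_list L in HQ *.
have [e0 e1] := env_nm env; have [ld _ _ _ _] := env.
apply: wp_seq; apply: (wp_fill2m (f := weight_mat P)) => //.
  move=> i j st' ss h5 h6 _; have ld' : loaded I eps [::] st' by apply: loaded_same ss ld.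
  have muE : xval N st' (XA2 0 5 6) (mu i j).
    by apply: xval_get; last exact: (env_mu i j ld'); rewrite /= h5 h6.
  apply: xval_eq.
    apply: xval_ifR; [exact: muE|exact: xval_nat|exact: xval_nat|].
    apply: xval_exp; apply: xval_bin; last exact: muE.
    by apply: (@xval_LMARG L st' i j) => //; apply: list_at_same ss LA.
  by rewrite /weight_mat /= ltNge; case: (_ <= _).
move=> st1 ss1 W1; have env1 : mwu_env st1 by apply: mwu_env_same ss1 env.
have LA1 : list_at 3 13 4 L st1 by apply: list_at_same ss1 LA.
have [ld1 _ c1 _ [_ H1]] := env1; have [e01 e11] := env_nm env1.
have hl1 : rarr st1 18 [::] = lam by case: ss1 => _ _ ->.
apply: wp_seq; apply: (wp_real (x := wcost C lam P)).
  apply: xval_exp; apply: xval_bin; last by apply: xval_get.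
  exact: xval_LINNER.
set st2 := set_rarr _ _ _ _.
apply: wp_seq; apply: (wp_real (x := wtotal C mu lam P)).
  apply: xval_bin; first by apply: xval_get.
  apply: (@xval_sum _ _ _ _ _ _ k) => [//|//|i].
  apply: xval_eq.
    apply: (@xval_sum _ _ _ _ _ _ n) => [//|//|j].
    by apply: xval_get; last exact: (W1 i j).
  by rewrite [RHS]big_mkcond.
set st3 := set_rarr _ _ _ _.
have ss3 : same [::] [::] [:: 20; 21]%N st1 st3.
  by apply: (same_comp (same_rarr st1 20 [::] _) (same_rarr st2 21 [::] _)).
have env3 : mwu_env st3 by apply: mwu_env_same ss3 env1.
have [e03 e13] := env_nm env3; have [ld3 _ c3 _ [_ H3]] := env3.
have W3 : holds_mat st3 22 (weight_mat P) by apply: holds_mat_same ss3 W1.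
apply: wp_seq; apply: (wp_fill2m (f := scale_mat lam P)) => //.
  move=> i j st' ss h5 h6 _; have ld' : loaded I eps [::] st' by apply: loaded_same ss ld3.
  have [s1 s2 s3] := ss.
  have muE : xval N st' (XA2 0 5 6) (mu i j).
    by apply: xval_get; last exact: (env_mu i j ld'); rewrite /= h5 h6.
  apply: xval_eq.
    apply: xval_ifR; [exact: muE|exact: xval_nat|exact: xval_nat|].
    apply: xval_exp; apply: xval_bin; first exact: xval_nat.
    apply: xval_bin; first by apply: xval_get => //; rewrite s3.
    apply: xval_bin; last by apply: xval_get => //; rewrite s3.
    apply: xval_bin; last exact: muE.
    by apply: xval_get; last (by rewrite s3 //; exact: (W3 i j)); rewrite /= h5 h6.
  rewrite /scale_mat /weight_mat /= mulr0n sub0r; case: (lerP (mu i j) 0) => // h.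
  by rewrite !s3 // H3.
move=> st4 ss4 D4; have env4 : mwu_env st4 by apply: mwu_env_same ss4 env3.
have [_ _ c4 _ [_ H4]] := env4; have [s41 s42 s43] := ss4.
have ss14 : same [:: 5; 6]%N [::] [:: 5; 20; 21; 22]%N st st4.
  by apply: (same_comp (same_comp (xs := [:: 5; 6]%N) (bs := [::]) (rs := [:: 20; 21; 22]%N) ss1 ss3 isT) ss4).
have w4 : rarr st4 20 [::] = wcost C lam P by rewrite s43.
have z4 : rarr st4 21 [::] = wtotal C mu lam P by rewrite s43.
apply: (wp_real (x := temperature lam P)).
  apply: xval_bin; first by apply: xval_bin; apply: xval_get.
  apply: xval_bin; last by apply: xval_bin; [exact: xval_nat | apply: xval_get].
  by apply: xval_bin; apply: xval_get => //; case: ss14 => _ _ ->.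
apply: HQ => //.
- by apply: (same_comp ss14 (same_rarr st4 6 [::] _)).
- by apply: holds_mat_same (same_rarr st4 6 [::] _) (holds_mat_same _ ss4 W3).
Qed.

End MwuBlocks.
Arguments scale_mat {R r} I eps lam P i j.
Arguments temperature {R r} I eps lam P.

(** ** Step 1 *)

(** Variable 13 tells whether the loop goes on, variable 15 whether the run ended with
  a partial plan. *)
Definition PStep1 (r : nat) : prog :=
  PSeq (PNat 4 (NCst 0)) (PSeq (PNat 13 (NCst 1)) (PSeq (PNat 15 (NCst 1))
  (PSeq (PWhile (NCst 1) (NVar 13)
    (PSeq (PWeights r) (PSeq (PPick r) (PSeq (PSlope r)
      (PIf (XC 23) (XAdd X1 (XC 16))
        (PSeq (PAppend (XMul (XC 16) (XBig OMin (XDiv (XC 18) (NCX r (NGet 2 [:: 20]%N)))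
                  20 (NVar 1) (XGet 0 [:: NVar 20; NGet 2 [:: 20]%N]))))
              (PIf (XC 17) LMASS (PNat 13 (NCst 0)) PSkip))
        (PSeq (PNat 13 (NCst 0)) (PNat 15 (NCst 0))))))))
    (PIf X1 (XV 15)
      (PFor 17 (NVar 4) (PReal 13 [:: 17]%N (XDiv (XA1 13 17)
          (XMul (XC 17) (XProd 22 (NCst 4) (XAdd X1 (XC 16)))))))
      PSkip)))).

Section MwuStep1Program.
Variables (R : realType) (r : nat) (I : instance R r) (eps : R) (N : nat).
Implicit Types (st : store R) (Q : store R -> Prop).
Local Notation n := (side I).
Local Notation k := (nmarg I).
Local Notation mu := (target I).
Local Notation C := (normalized_cost (cost I)).
Local Notation c := (cost_scale (cost I)).
Local Notation e := (normalized_eps (cost I) eps).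
Local Notation eta := (mwu_eta n k e).
Hypotheses (eps0 : 0 < eps) (k0 : (0 < k)%N) (n0 : (0 < n)%N).
Hypothesis mu1 : forall i, in_simplex (mu i).
Hypothesis inj : injective (spos I).
Hypotheses (rN : (r <= N)%N) (kN : (k <= N)%N) (nN : (n <= N)%N) (sN : (spars I <= N)%N).
Variables (K : nat).
Hypothesis RK : forall jj, `|low_rank_part I jj| <= K%:R * Cmax I.
Local Notation m := (mwu_degree I eps K).
Local Notation H := (mwu_H I eps).
Hypothesis mN : (m < N)%N.
Local Notation env := (mwu_env I eps K).
Local Notation listed := (list_at n0 3 13 4).

Lemma queried_same xs bs rs st st' (q : midx n k) :
  (2 \notin bs)%N -> same xs bs rs st st' -> queried q st -> queried q st'.
Proof. by move=> h [_ s2 _] hq i; rewrite s2. Qed.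

Lemma wp_argmax_row a i b v (G : 'I_k -> 'I_n -> R) (i0 : 'I_k) st Q :
  env st -> holds_mat st a G -> nvar st i = i0 -> (i == 6) || (i == 9) || (i == 11) = false ->
  (a == 8) = false -> b = 9%N -> v = 11%N ->
  (forall st' (j0 : 'I_n), same [:: 6; 9; 11]%N [::] [:: 8]%N st st' ->
     nvar st' 9 = j0 -> (forall j, G i0 j <= G i0 j0) -> Q st') ->
  wp N (PSeq (PFor 6 (NVar 0) (PReal 8 [:: 6]%N (XA2 a i 6))) (PArgmax b v 0 8)) Q st.
Proof.
move=> ev hG hi /norP[/norP[i6 i9] i11] a8 -> -> HQ; have [e0 e1] := env_nm ev.
pose F (j : nat) : R := if insub j is Some j' then G i0 j' else 0.
apply: wp_seq; apply: (wp_fill1 (B := n) (addr := fun j => [:: j]) (f := F)) => //.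
- by move=> j st' vj _; rewrite /address /= vj.
- by move=> ? ? [].
- move=> j st' jB ss vj _; have [s1 s2 s3] := ss; rewrite /F insubT.
  have aE : map (neval st') [:: NVar i; NVar 6] = [:: val i0; val (Sub j jB : 'I_n)].
    by rewrite /= vj s1 ?inE ?i6 // hi.
  by apply: xval_get aE _; rewrite s3 ?inE ?a8 //; exact: (hG i0 (Sub j jB)).
move=> st1 ss1 h8 _; have [s1 s2 s3] := ss1.
apply: (wp_argmax (B := n)) => //; first by rewrite s1.
move=> st2 b9 ss2 hb bn mx.
apply: (HQ _ (Ordinal bn)) => //; first by apply: (same_comp ss1 ss2).
move=> j; have := mx j (ltn_ord j); rewrite !h8 ?ltn_ord //.
by rewrite /F valK -[b9]/(val (Ordinal bn)) valK.
Qed.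

Lemma wp_pick D th st Q : env st -> holds_mat st 5 D -> rarr st 6 [::] = th ->
  (forall st' (q : midx n k), same [:: 5; 6; 7; 9; 11]%N [:: 2]%N [:: 5; 7; 8]%N st st' ->
     queried q st' ->
     (forall p (pk : (p < k)%N) j,
        marg (fixed_tensor D (gibbs I m th) q p) (Ordinal pk) j <=
        marg (fixed_tensor D (gibbs I m th) q p) (Ordinal pk) (q (Ordinal pk))) -> Q st') ->
  wp N (PPick r) Q st.
Proof.
move=> ev hD hth HQ; have [e0 e1] := env_nm ev; set g := gibbs I m th in HQ *.
pose good p (q : midx n k) := forall p' (pk : (p' < k)%N) j, (p' < p)%N ->
        marg (fixed_tensor D g q p') (Ordinal pk) j <=
        marg (fixed_tensor D g q p') (Ordinal pk) (q (Ordinal pk)).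
pose Inv p st' := exists q : midx n k, [/\ forall i : 'I_k, (i < p)%N -> narr st' 2 [:: val i] = q i,
   holds_mat st' 5 (fixed D q p) & good p q].
apply: (wp_for (B := k) (Inv := Inv)) => //.
- by move=> st' [s1 _ _]; rewrite /= s1.
- by exists (jj0 (I := I) n0); split.
- move=> p st1 pk vp ss1 [q [hq h5 gq]]; pose i0 := Ordinal pk.
  have ev1 : env st1 by apply: mwu_env_same ss1 ev.
  have [ld1 m1 _ _ _] := ev1.
  have th1 : rarr st1 6 [::] = th by case: ss1 => _ _ ->.
  apply: wp_seq; apply: (@wp_marg R r I eps [::] N rN kN nN sN inj m th _ st1) (ld1) (m1) (mN) (th1) (h5) _.
  move=> st2 ss2 h7; have ev2 : env st2 by apply: mwu_env_same ss2 ev1.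
  have v2 : nvar st2 7 = i0 by case: ss2 => ->.
  apply: (wp_argmax_row (a := 7) (i := 7) (i0 := i0)
     (Q := wp N (PSeq (PNatA 2 [:: 7]%N (NVar 9))
       (PFor 6 (NVar 0) (PReal 5 [:: 7; 6]%N (XIfEq (NVar 6) (NVar 9) (XA2 5 7 6) X0)))) _)
     ev2 h7 v2) => // st3 j0 ss3 v9 mx.
  have ss23 := same_comp (xs := [:: 5; 6; 9; 11]%N) (bs := [::]) (rs := [:: 7; 8]%N) ss2 ss3 isT.
  have [s1 s2 s3] := ss23.
  apply: wp_seq; rewrite /=; set st4 := set_narr _ _ _ _.
  pose q' : midx n k := [ffun i => if i == i0 then j0 else q i].
  have q'0 : q' i0 = j0 by rewrite ffunE eqxx.
  have q'lt (i : 'I_k) : (i < p)%N -> q' i = q i.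
    by move=> ip; rewrite ffunE; case: eqP => // ii; move: ip; rewrite ii /= ltnn.
  have fixE p' : (p' <= p)%N -> fixed D q' p' = fixed D q p'.
    move=> pp; apply/funext => i; apply/funext => j; rewrite /fixed; case: ifP => // ip.
    by rewrite q'lt //; exact: leq_trans ip pp.
  have h54 : holds_mat st4 5 (fixed D q p) by move=> i j; rewrite /= s3 //; exact: h5.
  have v74 : nvar st4 7 = p by rewrite /= s1.
  have [n2 _] := env_nm ev2.
  have n4 : nvar st4 0 = n by case: ss3 => t1 _ _; rewrite /= t1.
  pose F (j : nat) : R := if insub j is Some j' then fixed D q' p.+1 i0 j' else 0.
  change (wp N (PFor 6 (NVar 0) (PReal 5 [:: 7; 6]%N (XIfEq (NVar 6) (NVar 9) (XA2 5 7 6) X0)))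
    (fun st'' => Inv p.+1 (set_nvar st'' 7 p.+1)) st4).
  apply: (wp_fill1 (B := n) (addr := fun j => [:: p; j]) (f := F)) => //.
  + by move=> j st' vj h; rewrite /address /= vj h // v74.
  + by move=> ? ? [].
  + move=> j st' jB ss vj rE; have [t1 t2 t3] := ss; rewrite /F insubT.
    apply: xval_eq.
      apply: xval_ifeq; last exact: xval_nat.
      apply: (@xval_get _ _ _ _ _ [:: p; j] (fixed D q p i0 (Sub j jB))); first by rewrite /= vj t1 // v74.
      by rewrite rE; exact: (h54 i0 (Sub j jB)).
    rewrite /= vj t1 // [nvar st4 9]v9 /fixed /= ltnSn ltnn q'0.
    by rewrite -[j in LHS]/(val (Sub j jB : 'I_n)) (inj_eq val_inj).
  move=> st5 ss5 F1 F2; exists q'; split.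
  + move=> i; rewrite ltnS leq_eqVlt => ip; have [_ t2 _] := ss5; rewrite /= t2 //=.
    rewrite /address /= s1 //; have [ii|ne] := eqVneq i i0.
      by rewrite ii vp /= !eqxx v9 q'0.
    have ip' : (i < p)%N.
      by case/orP: ip => // /eqP ii; case/eqP: ne; apply: val_inj.
    rewrite vp; case: eqP => [[ii]|_]; first by move: ip'; rewrite ii ltnn.
    by rewrite s2 // hq // q'lt.
  + move=> i j; rewrite -[LHS]/(rarr st5 5 [:: val i; val j]).
    have [ii|ne] := eqVneq i i0.
      by rewrite ii; have := F1 j (ltn_ord j); rewrite /F valK.
    rewrite F2; last by move=> j' _; apply/eqP => -[ii _]; case/eqP: ne; apply: val_inj.
    rewrite h54 /fixed ltnS [(i <= p)%N]leq_eqVlt.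
    have -> : (i == p :> nat) = false by apply/eqP => ii; case/eqP: ne; apply: val_inj.
    by rewrite /=; case: ifP => // ip; rewrite q'lt.
  + move=> p' pk' j; rewrite ltnS leq_eqVlt => /predU1P[pE|pp].
      subst p'; rewrite (bool_irrelevance pk' pk) -/i0 q'0 /fixed_tensor fixE //.
    rewrite /fixed_tensor fixE ?(ltnW pp) // q'lt //; exact: gq.
- move=> st' ss v7 [q [hq h5 gq]]; apply: (HQ _ q).
  + by apply: same_incl ss.
  + by move=> i; exact: hq.
  + by move=> p pk j; exact: gq.
Qed.

Lemma xval_query st (q : midx n k) : env st -> queried q st -> xval N st (NCX r (NGet 2 [:: 20]%N)) (C q).
Proof.
move=> [ld _ c5 _ _] hq.
by apply: (xval_NCX rN kN sN ld c5) => i l; exact: hq.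
Qed.

Lemma wp_slope lam P st (q : midx n k) Q : env st -> queried q st -> in_support mu q ->
  rarr st 18 [::] = lam -> holds_mat st 22 (weight_mat P) ->
  rarr st 20 [::] = wcost C lam P -> rarr st 21 [::] = wtotal C mu lam P ->
  (forall st', same [::] [::] [:: 23]%N st st' -> rarr st' 23 [::] = slope C mu lam P q -> Q st') ->
  wp N (PSlope r) Q st.
Proof.
move=> ev hq qs hl W hw hz HQ; have [e0 e1] := env_nm ev; have [ld _ _ _ _] := ev.
apply: (wp_real (x := slope C mu lam P q)); last by apply: HQ => //; exact: same_rarr.
apply: xval_bin; last by apply: xval_get.
apply: xval_bin.
  apply: xval_bin; first by apply: xval_get.
  by apply: xval_bin; [exact: xval_query | apply: xval_get].
apply: (@xval_sum _ _ _ _ _ _ k) => [//|//|i].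
have qi : map (neval (set_nvar st 20 i)) [:: NVar 20; NGet 2 [:: 20]%N] = [:: val i; val (q i)].
  by rewrite /= hq.
apply: xval_bin; apply: xval_get qi _; last exact: (env_mu i (q i) ld).
by rewrite (W i (q i)) /weight_mat qs.
Qed.

Lemma wp_append E L a st (q : midx n k) Q : nvar st 1 = k -> xval N st E a ->
  listed L st -> queried q st ->
  (forall st', same [:: 4; 7]%N [:: 3]%N [:: 13]%N st st' ->
     listed (rcons L (q, a)) st' -> Q st') ->
  wp N (PAppend E) Q st.
Proof.
move=> k1 vE LA hq HQ; have [hM hL] := LA.
apply: wp_seq; apply: (wp_real vE); set st1 := set_rarr _ _ _ _.
have M1 : nvar st1 4 = size L by [].
pose F (i : nat) : nat := if insub i is Some i' then q (i' : 'I_k) else 0%N.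
apply: wp_seq; apply: (wp_fill1n (B := k) (addr := fun i => [:: size L; i]) (f := F)) => //.
- by move=> i st' vi h; rewrite /address /= vi h // M1.
- by move=> ? ? [].
- by move=> i st' ik ss vi; have [_ s2 _] := ss; rewrite /= s2 //= vi /F insubT (hq (Sub i ik)).
move=> st2 ss2 F1 F2; apply: wp_nat; have [s1 s2 s3] := ss2; set st3 := set_nvar _ _ _.
have ss : same [:: 4; 7]%N [:: 3]%N [:: 13]%N st st3.
  by apply: (same_comp (same_comp (xs := [:: 7]%N) (bs := [:: 3]%N) (rs := [:: 13]%N)
    (same_rarr st 13 _ _) ss2 isT) (same_nvar st2 4 _)).
apply: HQ => //; split; first by rewrite /= s1 // M1 addn1 size_rcons.
move=> t; rewrite size_rcons ltnS leq_eqVlt => /predU1P[->|tL].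
  rewrite nth_rcons ltnn eqxx /=; split.
    by move=> i; have := F1 i (ltn_ord i); rewrite /F valK.
  by rewrite s3 //= /address /= hM !eqxx.
rewrite nth_rcons tL; have [g1 g2] := hL t tL; split.
  move=> i; rewrite -[LHS]/(narr st2 3 [:: t; val i]) F2; first exact: g1.
  by move=> j _; apply/eqP => -[tE _]; move: tL; rewrite tE ltnn.
rewrite -[LHS]/(rarr st2 13 [:: t]) s3 // /st1 /= /address /= hM.
by case: eqP => [[tE]|_] //; move: tL; rewrite tE ltnn.
Qed.

End MwuStep1Program.

Lemma xval_var (R : realType) N (st : store R) x p : nvar st x = p -> xval N st (XV x) p%:R.
Proof. by move=> <-. Qed.

Section MwuStep1Loop.
Variables (R : realType) (r : nat) (I : instance R r) (eps : R) (N N1 : nat).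
Implicit Types (st : store R) (Q : store R -> Prop).
Local Notation n := (side I).
Local Notation k := (nmarg I).
Local Notation mu := (target I).
Local Notation C := (normalized_cost (cost I)).
Local Notation c := (cost_scale (cost I)).
Local Notation e := (normalized_eps (cost I) eps).
Local Notation eta := (mwu_eta n k e).
Hypotheses (eps0 : 0 < eps) (k0 : (0 < k)%N) (n0 : (0 < n)%N).
Hypothesis mu1 : forall i, in_simplex (mu i).
Hypothesis inj : injective (spos I).
Hypotheses (rN : (r <= N)%N) (kN : (k <= N)%N) (nN : (n <= N)%N) (sN : (spars I <= N)%N).
Variables (K : nat).
Hypothesis RK : forall jj, `|low_rank_part I jj| <= K%:R * Cmax I.
Local Notation m := (mwu_degree I eps K).
Local Notation H := (mwu_H I eps).
Hypothesis mN : (m < N)%N.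
Hypothesis count_N1 : (n * k + 1)%:R * (eta * (1 + e) ^+ 4) < N1%:R * e.
Hypotheses (N1N : (N1 <= N)%N) (N4 : (4 <= N)%N).
Local Notation env := (mwu_env I eps K).
Local Notation listed := (list_at n0 3 13 4).

Let e0 : 0 < e. Proof. by have [] := normalized_eps_bounds (cost I) eps0. Qed.
Let e1 : e <= 1 / 10. Proof. by have [] := normalized_eps_bounds (cost I) eps0. Qed.
Let C12 := normalized12 (cost I).
Let c0 : 0 < c. Proof. exact: cost_scale_gt0. Qed.

Lemma mwu_H_gt0 : 0 < H.
Proof.
rewrite divr_gt0 // ltr_wpDl // mulr_ge0 // ln_ge0 // ler1n //.
Qed.

Section FixedLambda.
Variables (lam : R).
Hypothesis lam1 : 1 <= lam.

Let lam0 : 0 < lam. Proof. exact: lt_le_trans lam1. Qed.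

Lemma temperature_ge0 P : 0 <= temperature I eps lam P.
Proof.
apply: divr_ge0; first by apply: mulr_ge0; [exact: ltW mwu_H_gt0 | exact: expR_ge0].
by rewrite ltW // !mulr_gt0 // wtotal_gt0.
Qed.

(** The cost term is only one part of the total weight, so the inverse temperature is
  at most [H / (2 * c)] throughout the run and a single degree serves for all calls
  of the oracle. *)
Lemma temperature_bound P jj :
  `|temperature I eps lam P * low_rank_part I jj| <= H * K%:R.
Proof.
have Z0 := wtotal_gt0 C mu lam P; have H0 := mwu_H_gt0.
have wZ : wcost C lam P <= wtotal C mu lam P.
  by rewrite lerDl; apply: sumr_ge0 => i _; apply: sumr_ge0 => j _; exact: expR_ge0.
have th : temperature I eps lam P <= H / (2 * c).
  have d0 : 0 < wtotal C mu lam P * lam * (2 * c) by rewrite !mulr_gt0.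
  rewrite /temperature ler_pdivrMr //.
  have -> : H / (2 * c) * (wtotal C mu lam P * lam * (2 * c)) = H * (wtotal C mu lam P * lam).
    by move: (wtotal C mu lam P) => z; field; rewrite gt_eqF.
  rewrite ler_wpM2l ?(ltW H0) //; apply: le_trans wZ _.
  by rewrite ler_peMr ?(ltW Z0).
rewrite normrM ger0_norm ?temperature_ge0 //.
apply: (@le_trans _ _ (H / (2 * c) * (K%:R * c))).
  apply: ler_pM => //; first exact: temperature_ge0.
  apply: le_trans (RK jj) _; rewrite ler_wpM2l // /Cmax /cost_scale.
  by case: eqP => // ->; exact: ler01.
have -> : H / (2 * c) * (K%:R * c) = H * K%:R / 2 by field; rewrite gt_eqF.
have h : 0 <= H * K%:R by apply: mulr_ge0; [exact: ltW | ].
by move: (H * K%:R) h => x h; lra.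
Qed.

Lemma pick_slope P (q : midx n k) :
  let D := scale_mat I eps lam P in
  let g := gibbs I m (temperature I eps lam P) in
  (forall p (pk : (p < k)%N) j,
     marg (fixed_tensor D g q p) (Ordinal pk) j <=
     marg (fixed_tensor D g q p) (Ordinal pk) (q (Ordinal pk))) ->
  in_support mu q /\
  forall jj, in_support mu jj -> slope C mu lam P q <= slope C mu lam P jj + e.
Proof.
move=> D g best; have H0 := mwu_H_gt0.
have gE jj : expR (- (temperature I eps lam P * cost I jj) - 1 / 8) <= g jj <=
    expR (- (temperature I eps lam P * cost I jj)).
  exact: gibbs_bounds (temperature_bound P jj).
have g0 jj : 0 <= g jj.
  by case/andP: (gE jj) => h _; apply: le_trans h; exact: expR_ge0.
have D0 i j : 0 <= D i j by rewrite /D /scale_mat; case: ifP => // _; exact: expR_ge0.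
have [qs qb] := oracle_slope k0 mu1 lam1 c0 H0 (normalizedE (cost I)) gE (oracle_best D0 g0 best).
split=> // jj js; apply: le_trans (qb jj js) _; rewrite lerD2l ler_pdivrMr //.
rewrite /mwu_H mulrCA divff ?mulr1 ?gt_eqF // lerD2l; lra.
Qed.

(** The relation [mwu_step1] unfolds from the front, while the program appends steps
  at the end; the last clause composes the steps already made with any continuation. *)
Definition running t L st : Prop :=
  [/\ env st, listed L st, rarr st 18 [::] = lam, size L = t &
      mwu_inv C mu e lam (of_list L) t /\
      forall cnt out, mwu_step1 C mu e lam (of_list L) cnt out ->
        mwu_step1 C mu e lam (fun=> 0) (t + cnt) out].

Lemma running_lt t L st : running t L st -> (t < N1)%N.
Proof.
move=> [_ _ _ _ [inv _]]; have := mwu_count k0 mu1 e0 e1 inv.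
move=> h; have := le_lt_trans h count_N1; rewrite ltr_pM2r // ltr_nat; exact.
Qed.

Definition step1_inv t st : Prop := exists L,
  [/\ running t L st, nvar st 13 = 1%N, nvar st 15 = 1%N & mass (of_list L) < eta] \/
  [/\ running t L st, nvar st 13 = 0%N, nvar st 15 = 1%N & eta <= mass (of_list L)] \/
  [/\ env st, nvar st 13 = 0%N, nvar st 15 = 0%N, (t <= N1)%N &
      mwu_step1 C mu e lam (fun=> 0) t None /\
      forall X : tensor R n k, feasible mu X -> lam < inner C X].

Definition PStep1Body : prog :=
  PSeq (PWeights r) (PSeq (PPick r) (PSeq (PSlope r)
      (PIf (XC 23) (XAdd X1 (XC 16))
        (PSeq (PAppend (XMul (XC 16) (XBig OMin (XDiv (XC 18) (NCX r (NGet 2 [:: 20]%N)))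
                  20 (NVar 1) (XGet 0 [:: NVar 20; NGet 2 [:: 20]%N]))))
              (PIf (XC 17) LMASS (PNat 13 (NCst 0)) PSkip))
        (PSeq (PNat 13 (NCst 0)) (PNat 15 (NCst 0)))))).

Lemma wp_step1_body t L st : running t L st -> nvar st 13 = 1%N -> nvar st 15 = 1%N ->
  mass (of_list L) < eta -> wp N PStep1Body (step1_inv t.+1) st.
Proof.
move=> run h13 h15 mP; have tN1 := running_lt run.
have [ev LA hl sL [inv chain]] := run; set P := of_list L in mP inv chain *.
have LN : (size L <= N)%N by rewrite sL; apply: leq_trans N1N; exact: ltnW.
apply: wp_seq; apply: (wp_weights rN kN nN sN ev LN LA hl) => //.
move=> st1 ss1 W1 w1 z1 D1 th1.
have ev1 : env st1 by apply: mwu_env_same ss1 ev.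
apply: wp_seq; apply: (wp_pick n0 inj rN kN nN sN mN ev1 D1 th1) => //.
move=> st2 q ss2 hq best; have [qs qb] := pick_slope best.
have ev2 : env st2 by apply: mwu_env_same ss2 ev1.
have ss12 : same [:: 5; 6; 7; 9; 11]%N [:: 2]%N [:: 5; 6; 7; 8; 20; 21; 22]%N st st2.
  by apply: (same_comp ss1 ss2).
have W2 : holds_mat st2 22 (weight_mat P) by apply: holds_mat_same ss2 W1.
have hl2 : rarr st2 18 [::] = lam by case: ss12 => _ _ ->.
have w2 : rarr st2 20 [::] = wcost C lam P by case: ss2 => _ _ ->.
have z2 : rarr st2 21 [::] = wtotal C mu lam P by case: ss2 => _ _ ->.
apply: wp_seq; apply: (wp_slope rN kN sN ev2 hq qs hl2 W2 w2 z2) => // st3 ss3 V3.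
have ev3 : env st3 by apply: mwu_env_same ss3 ev2.
have ss13 : same [:: 5; 6; 7; 9; 11]%N [:: 2]%N [:: 5; 6; 7; 8; 20; 21; 22; 23]%N st st3.
  by apply: (same_comp ss12 ss3).
have [s1 s2 s3] := ss13; have [ld3 _ c3 e3 [eta3 _]] := ev3.
have LA3 : listed L st3 by apply: list_at_same ss13 LA.
have hq3 : queried q st3 by apply: queried_same ss3 hq.
have [n3 k3] := env_nm ev3.
have hl3 : rarr st3 18 [::] = lam by rewrite s3.
apply: (wp_if (x := slope C mu lam P q) (y := 1 + e)).
- exact: xval_get.
- by apply: xval_bin; [exact: xval_nat | exact: xval_get].
case: ifP => cmp; last first.
  exists L; right; right; split.
  - by apply: mwu_env_same (same_comp (xs := [:: 13; 15]%N) (bs := [::]) (rs := [::])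
      (same_nvar st3 13 0) (same_nvar _ 15 0) _) ev3.
  - by [].
  - by [].
  - exact: tN1.
  have nul : oracle_null C mu lam P.
    move=> jj js; rewrite dpotentialE //; have := qb jj js.
    by move/negbT: cmp; rewrite -ltNge; lra.
  split; last by move=> Q fQ; exact: (null_infeasible k0 mu1 lam1 nul fQ).
  by rewrite -addn1; apply: chain; exact: MwuNull.
have ans : oracle_answer C mu e lam P q by split=> //; rewrite dpotentialE.
apply: wp_seq; apply: (wp_append (a := mwu_stepsize C mu e lam q) kN _ _ LA3 hq3) => //.
  apply: xval_bin; first exact: xval_get.
  apply: (@xval_big _ _ _ _ _ _ _ _ k) => //.
    by apply: xval_bin; [exact: xval_get | exact: (xval_query rN kN sN ev3)].
  move=> i; apply: (@xval_get _ _ _ _ _ [:: val i; val (q i)]); last exact: (env_mu i (q i) ld3).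
  by rewrite /= hq3.
move=> st4 ss4 LA4; have ev4 : env st4 by apply: mwu_env_same ss4 ev3.
have [s41 s42 s43] := ss4.
set a := mwu_stepsize _ _ _ _ _ in LA4.
have run4 : running t.+1 (rcons L (q, a)) st4.
  split=> //; first by rewrite s43.
    by rewrite size_rcons sL.
  rewrite of_list_rcons; split; first exact: (mwu_inv_step k0 mu1 C12 e0 e1 lam1 inv mP ans).
  by move=> cnt out h; rewrite addSn -addnS; apply: chain; exact: MwuStep ans h.
have [_ _ _ e4 [eta4 _]] := ev4.
apply: (wp_if (x := eta) (y := mass (of_list (rcons L (q, a))))).
- exact: xval_get.
- by apply: (xval_LMASS (n0 := n0)) LA4; rewrite size_rcons sL; exact: leq_trans N1N.
have v13 : nvar st4 13 = 1%N by rewrite s41 // s1.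
have v15 : nvar st4 15 = 1%N by rewrite s41 // s1.
have [ev' LA' hl' sL' rest] := run4.
case: ifP => h; exists (rcons L (q, a)).
  by right; left; split.
by left; split=> //; rewrite ltNge h.
Qed.

Definition step1_post st : Prop := env st /\
  ((nvar st 15 = 1%N /\ exists cnt L, [/\ listed L st, (cnt <= N1)%N, (size L <= N1)%N,
     mwu_step1 C mu e lam (fun=> 0) cnt (Some (of_list L)) &
     partial_plan C mu e lam (of_list L)]) \/
   (nvar st 15 = 0%N /\ exists cnt, [/\ (cnt <= N1)%N,
     mwu_step1 C mu e lam (fun=> 0) cnt None &
     forall X : tensor R n k, feasible mu X -> lam < inner C X])).

Lemma wp_step1 st Q : env st -> rarr st 18 [::] = lam ->
  (forall st', same (pmodn (PStep1 r)) (pmoda (PStep1 r)) (pmodr (PStep1 r)) st st' ->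
     step1_post st' -> Q st') ->
  wp N (PStep1 r) Q st.
Proof.
move=> ev hl HQ; apply: (@wp_conj _ _ _ step1_post) => //.
apply: wp_seq; apply: wp_nat; set st1 := set_nvar _ _ _.
apply: wp_seq; apply: wp_nat; set st2 := set_nvar _ _ _.
apply: wp_seq; apply: wp_nat; set st3 := set_nvar _ _ _.
have ss3 : same [:: 4; 13; 15]%N [::] [::] st st3.
  by apply: (same_comp (same_comp (xs := [:: 4; 13]%N) (bs := [::]) (rs := [::])
    (same_nvar st 4 _) (same_nvar st1 13 _) isT) (same_nvar st2 15 _)).
have ev3 : env st3 by apply: mwu_env_same ss3 ev.
have run0 : running 0 [::] st3.
  split=> //; rewrite of_list_nil; split; last by [].
  exact: (mwu_inv0 C lam k0 mu1 e0).
have m0 : mass (of_list ([::] : seq (midx n k * R))) < eta.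
  by rewrite mass_of_list big_nil (mwu_eta_gt0 k0 mu1 e0).
apply: wp_seq; apply: (wp_while (Inv := step1_inv)).
- by exists [::]; left.
- move=> t st' [L [[run h13 h15 mP]|[[_ h13 _ _]|[_ h13 _ _ _]]]]; rewrite /= h13 // => _.
  split; first exact: leq_trans (running_lt run) N1N.
  exact: wp_step1_body run h13 h15 mP.
move=> t st4 [L [[_ h13 _ _]|[[run h13 h15 mP]|[ev4 h13 h15 tN [nul inf]]]]] tN'; first by rewrite /= h13.
- move=> _; have [ev4 LA4 hl4 sL [inv chain]] := run.
  have tN1 : (t <= N1)%N := ltnW (running_lt run).
  pose b := eta * (1 + e) ^+ 4; pose L' := [seq (p.1, p.2 / b) | p <- L].
  have [n4 k4] := env_nm ev4; have [hM hL] := LA4.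
  apply: (wp_if (x := 1) (y := 1)); [exact: xval_nat | exact: (@xval_var _ N st4 15 1) |].
  rewrite lexx; pose F (t : nat) : R := (nth (jj0 n0, 0) L' t).2.
  apply: (wp_fill1 (B := size L) (addr := fun t => [:: t]) (f := F)) => //.
  + by rewrite sL; exact: leq_trans tN1 N1N.
  + by move=> i st' vi _; rewrite /address /= vi.
  + by move=> ? ? [].
  + move=> i st' iL ss vi rE; have [s1 s2 s3] := ss; have [_ _ _ e4 [eta4 _]] := ev4.
    rewrite /F (nth_map (jj0 n0, 0)) //=; apply: xval_bin.
      apply: (@xval_get _ _ _ _ _ [:: i]); first by rewrite /= vi.
      by rewrite rE; case: (hL i iL).
    apply: xval_bin; first by apply: xval_get => //; rewrite s3.
    apply: xval_eq.
      apply: (@xval_prod _ _ _ _ _ _ 4 (fun=> 1 + e)) => // z.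
      by apply: xval_bin; [exact: xval_nat | apply: xval_get => //; rewrite s3].
    by rewrite prodr_const card_ord.
  move=> st5 ss5 F1 F2; have [s1 s2 s3] := ss5.
  have ev5 : env st5 by apply: mwu_env_same ss5 ev4.
  split=> //; left; split; first by rewrite s1.
  exists t, L'; split=> //.
  + split; first by rewrite s1 // size_map.
    move=> i; rewrite size_map => iL; split; last by rewrite F1.
    by move=> i0; rewrite s2 // (nth_map (jj0 n0, 0)) //; have [-> _] := hL i iL.
  + by rewrite size_map sL.
  + rewrite of_list_scale -[t]addn0; apply: chain; exact: MwuDone.
  + rewrite of_list_scale; exact: (mwu_done k0 mu1 e0 e1 lam1 inv mP).
- move=> _; apply: (wp_if (x := 1) (y := 0)); [exact: xval_nat | exact: (@xval_var _ N st4 15 0) |].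
  rewrite leNgt ltr01 /=; split=> //; right; split=> //; exists t; split=> //.
Qed.

End FixedLambda.
End MwuStep1Loop.

Lemma wp_narr (R : realType) N a xs e Q (st : store R) :
  Q (set_narr st a (address st xs) (neval st e)) -> wp N (PNatA a xs e) Q st.
Proof. by []. Qed.

(** ** The complete program *)

(** The accuracy, the threshold, the sharpness and the degree of the kernel. *)
Definition PMwuSetup (K : nat) : prog :=
  PSeq (PReal 15 [::] (XIfR (XC 3) X0 X1 (XC 3)))
  (PSeq (PReal 16 [::] (XIfR (XC 3) X0 (XDiv X1 (XN 10))
      (XBin OMin (XDiv X1 (XN 10)) (XDiv (XC 4) (XMul (XN 20) (XC 3))))))
  (PSeq (PReal 17 [::] (XDiv (XMul (XN 2) (XLn (XAdd (XMul (XV 0) (XV 1)) X1))) (XC 16)))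
  (PSeq (PReal 19 [::] (XDiv (XAdd (XMul (XV 1) (XLn (XV 0))) X1) (XC 16)))
  (PSeq (PReal 11 [::] (XMul (XN 16) (XMul (XAdd (XMul (XC 19) (XN K)) X1)
      (XAdd (XMul (XC 19) (XN K)) X1))))
    (PCeil 3 10 11))))).

Definition PSearchBody (r : nat) : prog :=
  PIf (XSub (XC 25) (XC 24)) (XC 16) (PNat 16 (NCst 0))
    (PSeq (PReal 18 [::] (XDiv (XAdd (XC 24) (XC 25)) (XN 2)))
    (PSeq (PStep1 r)
      (PIf X1 (XV 15) (PSeq (PReal 25 [::] (XC 18)) (PCopyList 3 13 4 4 14 14))
        (PReal 24 [::] (XC 18))))).

Definition PSearch (r : nat) : prog :=
  PSeq (PReal 18 [::] (XN 2)) (PSeq (PStep1 r) (PSeq (PCopyList 3 13 4 4 14 14)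
  (PSeq (PReal 24 [::] X1) (PSeq (PReal 25 [::] (XN 2)) (PSeq (PNat 16 (NCst 1))
    (PWhile (NCst 1) (NVar 16) (PSearchBody r))))))).

Definition PFillBody : prog :=
  PSeq (PReal 26 [::] LMASS) (PIf X1 (XC 26) (PNat 16 (NCst 0))
    (PSeq (PFill2 22 (XSub (XA2 0 5 6) LMARG))
    (PSeq (PFor 7 (NVar 1) (PSeq (PSeq (PFor 6 (NVar 0) (PReal 8 [:: 6]%N (XA2 22 7 6)))
             (PArgmax 9 11 0 8)) (PNatA 2 [:: 7]%N (NVar 9))))
      (PAppend (XBig OMin (XN 2) 20 (NVar 1) (XGet 22 [:: NVar 20; NGet 2 [:: 20]%N])))))).

Definition PMwu (r K : nat) : prog :=
  PSeq (PMwuSetup K) (PSeq (PSearch r) (PSeq (PCopyList 4 14 14 3 13 4)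
  (PSeq (PNat 16 (NCst 1)) (PSeq (PWhile (NCst 1) (NVar 16) PFillBody)
    (PCopyList 3 13 4 0 0 0))))).

Lemma pok_mwu r K : pok (fresh r) (PMwu r K).
Proof.
by rewrite /PMwu /PMwuSetup /PSearch /PSearchBody /PFillBody /PStep1 /PWeights /PPick /PSlope
  /PMARG /PCeil /PFill2 /PCopyList /PAppend /= !xok_LRX.
Qed.

Section MwuMain.
Variables (R : realType) (r : nat) (I : instance R r) (eps : R) (N N1 N2 : nat).
Implicit Types (st : store R) (Q : store R -> Prop).
Local Notation n := (side I).
Local Notation k := (nmarg I).
Local Notation mu := (target I).
Local Notation C := (normalized_cost (cost I)).
Local Notation c := (cost_scale (cost I)).
Local Notation e := (normalized_eps (cost I) eps).
Local Notation eta := (mwu_eta n k e).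
Hypotheses (eps0 : 0 < eps) (k0 : (0 < k)%N) (n0 : (0 < n)%N).
Hypothesis mu1 : forall i, in_simplex (mu i).
Hypothesis inj : injective (spos I).
Hypotheses (rN : (r <= N)%N) (kN : (k <= N)%N) (nN : (n <= N)%N) (sN : (spars I <= N)%N).
Variables (K : nat).
Hypothesis RK : forall jj, `|low_rank_part I jj| <= K%:R * Cmax I.
Local Notation m := (mwu_degree I eps K).
Local Notation H := (mwu_H I eps).
Hypothesis mN : (m < N)%N.
Hypothesis count_N1 : (n * k + 1)%:R * (eta * (1 + e) ^+ 4) < N1%:R * e.
Hypothesis count_N2 : 1 <= N2%:R * e.
Hypotheses (N4 : (4 <= N)%N) (NN : (N1 + N2 + n * k < N)%N).
Local Notation env := (mwu_env I eps K).
Local Notation listed := (list_at n0 3 13 4).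
Local Notation best := (list_at n0 4 14 14).

Let N1N : (N1 <= N)%N. Proof. by have := NN; lia. Qed.
Let e0 : 0 < e. Proof. by have [] := normalized_eps_bounds (cost I) eps0. Qed.
Let e1 : e <= 1 / 10. Proof. by have [] := normalized_eps_bounds (cost I) eps0. Qed.
Let C12 := normalized12 (cost I).

Lemma wp_mwu_setup st Q : loaded I eps [::] st ->
  (forall st', env st' -> Q st') -> wp N (PMwuSetup K) Q st.
Proof.
move=> ld HQ; have [h0 h1] := loaded_nm ld.
have [c3 c4] : rarr st 3 [::] = Cmax I /\ rarr st 4 [::] = eps.
  by case: ld => _ [_ [_ [_ [_ [_ [_ [_ []]]]]]]].
have t0 : (Cmax I <= 0) = (tmax (cost I) == 0).
  by rewrite eq_le tmax_ge0 andbT.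
apply: wp_seq; apply: (wp_real (x := c)).
  apply: xval_eq.
    by apply: xval_ifR; [exact: xval_get|exact: xval_nat|exact: xval_nat|exact: xval_get].
  by rewrite /= c3 t0.
set st1 := set_rarr _ _ _ _.
apply: wp_seq; apply: (wp_real (x := e)).
  apply: xval_eq.
    apply: xval_ifR; [exact: xval_get|exact: xval_nat| |].
      by apply: xval_bin; exact: xval_nat.
    apply: xval_bin; first by apply: xval_bin; exact: xval_nat.
    apply: xval_bin; first exact: xval_get.
    by apply: xval_bin; [exact: xval_nat | exact: xval_get].
  by rewrite /= c3 c4 t0.
set st2 := set_rarr _ _ _ _.
apply: wp_seq; apply: (wp_real (x := eta)).
  apply: xval_eq.
    apply: xval_bin; last exact: xval_get.
    apply: xval_bin; first exact: xval_nat.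
    apply: xval_ln; apply: xval_bin; last exact: xval_nat.
    by apply: xval_bin; exact: xval_nat.
  by rewrite /= h0 h1 /mwu_eta natrD natrM.
set st3 := set_rarr _ _ _ _.
apply: wp_seq; apply: (wp_real (x := H)).
  apply: xval_eq.
    apply: xval_bin; last exact: xval_get.
    apply: xval_bin; last exact: xval_nat.
    by apply: xval_bin; [exact: xval_nat | apply: xval_ln; exact: xval_nat].
  by rewrite /= h0 h1.
set st4 := set_rarr _ _ _ _.
apply: wp_seq; apply: (wp_real (x := degree_bound (H * K%:R))).
  apply: xval_bin; first exact: xval_nat.
  by apply: xval_bin; (apply: xval_bin; last exact: xval_nat);
    (apply: xval_bin; last exact: xval_nat); exact: xval_get.
set st5 := set_rarr _ _ _ _.
apply: (wp_ceil (x := degree_bound (H * K%:R))) => //.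
  by apply: degree_bound_ge0; rewrite mulr_ge0 // ltW // mwu_H_gt0.
move=> st6 ss6 m3; have [s1 s2 s3] := ss6; apply: HQ; split=> //; rewrite ?s3 //.
have ss5 : same [::] [::] [:: 11; 15; 16; 17; 19]%N st st5.
  by split=> // a; rewrite !inE !negb_or => /and5P[/negPf a1 /negPf a2 /negPf a3 /negPf a4 /negPf a5] l;
    rewrite /= a1 a2 a3 a4 a5.
have ss : same [:: 3; 10]%N [::] [:: 11; 15; 16; 17; 19]%N st st6.
  by apply: (same_comp ss5 ss6).
by apply: loaded_same ss ld.
Qed.

(** The locations listed leave out those of the search, which therefore survive a run
  of Step 1. *)
Lemma wp_step1_at lam st Q : 1 <= lam -> env st -> rarr st 18 [::] = lam ->
  (forall st', same [:: 4; 5; 6; 7; 9; 11; 13; 15; 17]%N [:: 2; 3]%N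
       [:: 5; 6; 7; 8; 13; 20; 21; 22; 23]%N st st' ->
     step1_post eps N1 n0 K lam st' -> Q st') ->
  wp N (PStep1 r) Q st.
Proof.
move=> l1 ev hl HQ.
apply: (wp_step1 eps0 k0 mu1 inj rN kN nN sN RK mN count_N1 N1N N4 l1 ev hl).
by move=> st' ss; apply: HQ; apply: same_incl ss.
Qed.

(** The lower end is a bound on every plan, by infeasibility certificates, and the
  upper end bounds the cost of the stored partial plan. *)
Definition bracket lo hi (L : seq (midx n k * R)) (P0 : tensor R n k) cnt : Prop :=
  [/\ 1 <= lo, forall X : tensor R n k, feasible mu X -> lo <= inner C X,
      partial_plan C mu e hi (of_list L), (size L <= N1)%N &
      forall cnt' out, mwu_search C mu e lo hi (of_list L) cnt' out ->
        mwu_search C mu e 1 2 P0 (cnt + cnt') out].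

(** The width of the interval is the power [2 ^ - t], and [t <= 2 ^ t] already gives a
  polynomial number of bisections. *)
Definition search_inv P0 t st : Prop := exists lo hi L cnt,
  [/\ env st, rarr st 24 [::] = lo, rarr st 25 [::] = hi, best L st &
      bracket lo hi L P0 cnt] /\
  ([/\ nvar st 16 = 1%N, (hi - lo) * 2 ^+ t = 1, (t <= N2)%N & (cnt <= t * N1)%N] \/
   [/\ nvar st 16 = 0%N, hi - lo <= e & (cnt <= N2 * N1)%N]).

Lemma wp_search_body P0 t st : search_inv P0 t st -> nvar st 16 = 1%N ->
  wp N (PSearchBody r) (search_inv P0 t.+1) st.
Proof.
move=> [lo [hi [L [cnt [[ev h24 h25 LA br]]]]]] [[_ w tN ct]|[-> //]] h16.
have [_ _ _ h_e _] := ev; have [lo1 low pp sL chain] := br.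
apply: (wp_if (x := hi - lo) (y := e)).
- by apply: xval_bin; exact: xval_get.
- exact: xval_get.
case: ifP => [stop|/negbT].
  exists lo, hi, L, cnt; split.
    by split.
  right; split=> //; apply: leq_trans ct _; exact: leq_mul.
rewrite -ltNge => go.
have w0 : 0 < hi - lo by exact: lt_trans go.
have tN2 : (t < N2)%N.
  rewrite -(ltr_nat R); have tp : t%:R <= 2 ^+ t :> R.
    by rewrite -natrX ler_nat ltnW // ltn_expl.
  have q0 : (0 : R) < 2 ^+ t by rewrite exprn_gt0.
  have : e * 2 ^+ t < (hi - lo) * 2 ^+ t by rewrite ltr_pM2r.
  rewrite w.
  have : t%:R * e <= e * 2 ^+ t by rewrite mulrC ler_wpM2l // ltW.
  have := count_N2 => h1 h2 h3; rewrite -(ltr_pM2r e0).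
  by apply: le_lt_trans h2 (lt_le_trans h3 h1).
set lam := (lo + hi) / 2.
have lam1 : 1 <= lam by rewrite /lam; lra.
apply: wp_seq; apply: (wp_real (x := lam)).
  apply: xval_bin; last exact: xval_nat.
  by apply: xval_bin; exact: xval_get.
set st1 := set_rarr _ _ _ _.
have ev1 : env st1 by apply: mwu_env_same (same_rarr st 18 [::] lam) ev.
apply: wp_seq; apply: (wp_step1_at lam1 ev1) => // st2 ss2 [ev2 res].
have [s1 s2 s3] := ss2.
have LA2 : best L st2.
  by apply: list_at_same ss2 (list_at_same _ _ _ (same_rarr st 18 [::] lam) LA).
have g16 : nvar st2 16 = 1%N by rewrite s1.
have g18 : rarr st2 18 [::] = lam by rewrite s3.
have g24 : rarr st2 24 [::] = lo by rewrite s3.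
have g25 : rarr st2 25 [::] = hi by rewrite s3.
have [_ k2] := env_nm ev2.
case: res => [[h15 [c1 [L' [LA' c1N sL' run pp']]]]|[h15 [c1 [c1N run inf]]]].
  apply: (wp_if (x := 1) (y := 1)); [exact: xval_nat | exact: (xval_var N h15) |].
  rewrite lexx; apply: wp_seq; apply: (wp_real (x := lam)); first exact: xval_get.
  set st3 := set_rarr _ _ _ _.
  have ev3 : env st3 by apply: mwu_env_same (same_rarr st2 25 [::] lam) ev2.
  have LA3 : listed L' st3 by apply: list_at_same (same_rarr st2 25 [::] lam) LA'.
  apply: (wp_copy_list eps0 k0 rN kN nN sN mN _ _ LA3) => //; first exact: leq_trans sL' N1N.
  move=> st4 ss4 LA4; have [t1 t2 t3] := ss4.
  exists lo, lam, L', (cnt + c1)%N; split.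
    split; rewrite ?t3 //; first by apply: mwu_env_same ss4 ev3.
    split=> // cnt' out h; rewrite -addnA; apply: chain.
    exact: SearchFeasible go run h.
  left; split=> //; rewrite ?t1 //.
    by rewrite exprS mulrA -[RHS]w; congr (_ * _); rewrite /lam; field.
  by rewrite mulSn addnC leq_add.
apply: (wp_if (x := 1) (y := 0)); [exact: xval_nat | exact: (xval_var N h15) |].
rewrite ler10; apply: (wp_real (x := lam)); first exact: xval_get.
set st3 := set_rarr _ _ _ _.
exists lam, hi, L, (cnt + c1)%N; split.
  split=> //; split=> //; first by move=> X /inf /ltW.
  move=> cnt' out h; rewrite -addnA; apply: chain.
  exact: SearchInfeasible go run h.
left; split=> //.
  by rewrite exprS mulrA -[RHS]w; congr (_ * _); rewrite /lam; field.
by rewrite mulSn addnC leq_add.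
Qed.

Lemma inner_normalized X : feasible mu X -> 1 <= inner C X <= 2.
Proof.
move=> fX; have mX := feasible_mass (mu1 (Ordinal k0)) fX; have [X0 _] := fX.
have -> : (2 : R) = 2 * mass X by rewrite mX mulr1.
rewrite -{1}mX /inner /mass mulr_sumr; apply/andP; split; apply: ler_sum => jj _.
  by rewrite ler_peMl //; case/andP: (C12 jj).
by rewrite ler_wpM2r //; case/andP: (C12 jj).
Qed.

(** The first run, at the bound 2, succeeds because the product plan costs at most 2. *)
Lemma wp_search st Q : env st ->
  (forall st' lo hi L P0 c0 c1, env st' -> best L st' ->
     mwu_step1 C mu e 2 (fun=> 0) c0 (Some P0) -> (c0 <= N1)%N ->
     bracket lo hi L P0 c1 -> hi - lo <= e -> (c1 <= N2 * N1)%N -> Q st') ->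
  wp N (PSearch r) Q st.
Proof.
move=> ev HQ.
apply: wp_seq; apply: (wp_real (x := 2)); first exact: xval_nat.
set st1 := set_rarr _ _ _ _.
have ev1 : env st1 by apply: mwu_env_same (same_rarr st 18 [::] 2) ev.
apply: wp_seq; apply: (wp_step1_at (lam := 2) _ ev1) => //; first by rewrite ler1n.
move=> st2 ss2 [ev2 [[_ [c0 [L [LA2 c0N sL run pp]]]]|[_ [c0 [_ _ inf]]]]]; last first.
  have fX := feasible_prod mu1.
  by have := inf _ fX; have /andP[_ h] := inner_normalized fX; rewrite ltNge h.
have [_ k2] := env_nm ev2.
apply: wp_seq; apply: (wp_copy_list eps0 k0 rN kN nN sN mN k2 _ LA2) => //; first exact: leq_trans sL N1N.
move=> st3 ss3 LA3; have ev3 : env st3 by apply: mwu_env_same ss3 ev2.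
apply: wp_seq; apply: (wp_real (x := 1)); first exact: xval_nat.
set st4 := set_rarr _ _ _ _.
apply: wp_seq; apply: (wp_real (x := 2)); first exact: xval_nat.
set st5 := set_rarr _ _ _ _.
apply: wp_seq; apply: wp_nat; set st6 := set_nvar _ _ _.
have ss6 : same [:: 16]%N [::] [:: 24; 25]%N st3 st6.
  by apply: (same_comp (same_comp (xs := [::]) (bs := [::]) (rs := [:: 24; 25]%N)
    (same_rarr st3 24 [::] 1) (same_rarr st4 25 [::] 2) isT) (same_nvar st5 16 _)).
apply: (wp_while (Inv := search_inv (of_list L))).
- exists 1, 2, L, 0%N; split.
    by split=> //; split=> // X /inner_normalized /andP[].
  by left; split=> //; rewrite expr0 mulr1 (_ : 2 = 1 + 1) // addrK.
- move=> t st' inv; rewrite /= => h16.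
  have f1 : nvar st' 16 = 1%N.
    by case: inv => [? [? [? [? [_ [[]|[f0]]]]]]] //; rewrite f0 in h16.
  split; last exact: wp_search_body.
  case: inv => [? [? [? [? [_ [[_ _ tN _]|[f0]]]]]]]; last by rewrite f0 in h16.
  by have := NN; lia.
move=> t st' [lo [hi [L' [c1 [[ev' _ _ LA' br] [[f1]|[_ stop cN]]]]]]] _; first by rewrite /= f1.
by move=> _; exact: (HQ _ lo hi L' (of_list L) c0 c1).
Qed.

Definition fill_inv P1 t st : Prop := exists L t',
  [/\ env st, listed L st, (size L <= N1 + t')%N, sub_plan mu (of_list L) &
   [/\ (#|open_cells mu (of_list L)| + t' <= n * k)%N,
       inner C (of_list L) <= inner C P1 + 2 * (mass (of_list L) - mass P1),
       forall cnt out, mwu_step2 mu (of_list L) cnt out -> mwu_step2 mu P1 (t' + cnt) out &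
       (nvar st 16 = 1%N /\ t' = t) \/ (nvar st 16 = 0%N /\ 1 <= mass (of_list L))]].

Lemma wp_pick_deficits D st Q : env st -> holds_mat st 22 D ->
  (forall st' (q : midx n k), same [:: 6; 7; 9; 11]%N [:: 2]%N [:: 8]%N st st' ->
     queried q st' -> (forall i j, D i j <= D i (q i)) -> Q st') ->
  wp N (PFor 7 (NVar 1) (PSeq (PSeq (PFor 6 (NVar 0) (PReal 8 [:: 6]%N (XA2 22 7 6)))
     (PArgmax 9 11 0 8)) (PNatA 2 [:: 7]%N (NVar 9)))) Q st.
Proof.
move=> ev hD HQ; have [h0 h1] := env_nm ev.
pose Inv p st' := exists q : midx n k,
  (forall i : 'I_k, (i < p)%N -> narr st' 2 [:: val i] = q i) /\
  (forall i : 'I_k, (i < p)%N -> forall j, D i j <= D i (q i)).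
apply: (wp_for (B := k) (Inv := Inv)) => //.
- by move=> st' [s1 _ _]; rewrite /= s1.
- by exists (jj0 (I := I) n0); split.
- move=> p st1 pk vp ss1 [q [hq mq]]; pose i0 := Ordinal pk.
  have ev1 : env st1 by apply: mwu_env_same ss1 ev.
  have hD1 : holds_mat st1 22 D by apply: holds_mat_same ss1 hD.
  have v1 : nvar st1 7 = i0 by [].
  apply: wp_seq; apply: (wp_argmax_row n0 nN ev1 hD1 v1) => // st2 j0 ss2 v9 mx.
  have [s1 s2 s3] := ss2; apply: wp_narr.
  exists [ffun i => if i == i0 then j0 else q i]; split=> i; rewrite ltnS leq_eqVlt => ip.
    rewrite ffunE /= /address /= s1 // vp; have [ii|ne] := eqVneq i i0.
      by rewrite ii /= !eqxx.
    have ip' : (i < p)%N.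
      by case/orP: ip => // /eqP ii; case/eqP: ne; apply: val_inj.
    by case: eqP => [[ii]|_]; [move: ip'; rewrite ii ltnn | rewrite s2 // hq].
  move=> j; rewrite ffunE; have [->//|ne] := eqVneq i i0.
  by case/orP: ip => [/eqP ii|ip]; [case/eqP: ne; apply: val_inj | exact: mq].
move=> st' ss _ [q [hq mq]]; apply: (HQ _ q); first by apply: same_incl ss.
  by move=> i; exact: hq.
by move=> i; exact: mq.
Qed.

Lemma wp_fill_body P1 t st : fill_inv P1 t st -> nvar st 16 = 1%N ->
  wp N PFillBody (fill_inv P1 t.+1) st.
Proof.
move=> [L [t' [ev LA sL sp [op ic chain fl]]]] h16.
case: fl => [[_ tt]|[f0]]; last by rewrite f0 in h16.
subst t'; have tnk : (t <= n * k)%N by apply: leq_trans op; exact: leq_addl.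
have LN : (size L <= N)%N by have := NN; lia.
set P := of_list L in sp op ic chain.
apply: wp_seq; apply: (wp_real (x := mass P)); first exact: xval_LMASS LN LA.
set st1 := set_rarr _ _ _ _.
have ev1 : env st1 by apply: mwu_env_same (same_rarr st 26 [::] _) ev.
have LA1 : listed L st1 by apply: list_at_same (same_rarr st 26 [::] _) LA.
apply: (wp_if (x := 1) (y := mass P)); [exact: xval_nat | exact: xval_get |].
case: lerP => m1.
  exists L, t; split=> //; split=> //; right; split=> //.
have [h0 h1] := env_nm ev1.
apply: wp_seq; apply: (wp_fill2m kN nN (f := deficit mu P)) => //.
  move=> i j st' ss v5 v6 _; have ld' : loaded I eps [::] st'.
    by have [ld1 _ _ _ _] := ev1; apply: loaded_same ss ld1.
  apply: xval_bin; first by apply: xval_get; last exact: (env_mu i j ld'); rewrite /= v5 v6.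
  by apply: (xval_LMARG (n0 := n0)) => //; apply: list_at_same ss LA1.
move=> st2 ss2 D2; have ev2 : env st2 by apply: mwu_env_same ss2 ev1.
have LA2 : listed L st2 by apply: list_at_same ss2 LA1.
apply: wp_seq; apply: (wp_pick_deficits ev2 D2) => st3 q ss3 hq mx.
have ev3 : env st3 by apply: mwu_env_same ss3 ev2.
have LA3 : listed L st3 by apply: list_at_same ss3 LA2.
have D3 : holds_mat st3 22 (deficit mu P) by apply: holds_mat_same ss3 D2.
have [_ k3] := env_nm ev3.
set a := \big[Num.min/2]_(i < k) deficit mu P i (q i).
have al i : a <= deficit mu P i (q i) by exact: bigmin_le_term.
have [_ aE] := bigmin_spec (index_enum 'I_k) 2 (fun i => deficit mu P i (q i)).
have {}aE : exists i, a = deficit mu P i (q i).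
  case: aE => // a2; have := al (Ordinal k0); rewrite -/a in a2; rewrite a2 leNgt.
  case/negP; have [mu0 ms] := mu1 (Ordinal k0); have [P0 _] := sp.
  apply: (@le_lt_trans _ _ 1); last by rewrite ltr1n.
  apply: (@le_trans _ _ (mu (Ordinal k0) (q (Ordinal k0)))).
    by rewrite gerBl sumr_ge0.
  by rewrite -ms (bigD1 (q (Ordinal k0))) //= lerDl sumr_ge0.
have [a0 sp' op' ic'] := fill_step mu1 C12 sp m1 mx aE al.
apply: (wp_append (a := a) kN k3 _ LA3 hq).
  apply: (@xval_big _ _ _ _ _ _ _ _ k) => //.
  move=> i; apply: (@xval_get _ _ _ _ _ [:: val i; val (q i)]); last exact: (D3 i (q i)).
  by rewrite /= hq.
move=> st4 ss4 LA4; exists (rcons L (q, a)), t.+1; rewrite of_list_rcons -/P.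
have g16 : nvar st4 16 = 1%N.
  by case: ss4 => -> //; case: ss3 => -> //; case: ss2 => ->.
split=> //.
- by apply: mwu_env_same ss4 ev3.
- by rewrite size_rcons addnS ltnS.
split.
- by apply: leq_trans op; rewrite addnS -addSn leq_add2r.
- by apply: le_trans ic' _; move: ic; lra.
- by move=> cnt out h; rewrite addSnnS; apply: chain; exact: FillStep m1 mx aE al h.
- by left.
Qed.

Lemma wp_mwu st : loaded I eps [::] st ->
  wp N (PMwu r K) (fun st' => exists cnt (L : seq (midx n k * R)),
    [/\ mwu (cost I) mu eps cnt (of_list L), outputs_sparse (of_list L) (size L) st',
        mot_approx (cost I) mu eps (of_list L),
        (cnt <= N1 + N2 * N1 + n * k)%N & (size L <= N)%N]) st.
Proof.
move=> ld; apply: wp_seq; apply: (wp_mwu_setup ld) => st1 ev1.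
apply: wp_seq; apply: (wp_search ev1) => st2 lo hi L1 P0 c0 c1 ev2 LA2 run0 c0N br stop c1N.
have [lo1 low [P1_0 P1_hi P1_mu P1_m] sL1 chain1] := br.
have [_ k2] := env_nm ev2.
apply: wp_seq; apply: (wp_copy_list eps0 k0 rN kN nN sN mN k2 _ LA2) => //.
  exact: leq_trans sL1 N1N.
move=> st3 ss3 LA3; have ev3 : env st3 by apply: mwu_env_same ss3 ev2.
apply: wp_seq; apply: wp_nat; set st4 := set_nvar _ _ _.
set P1 := of_list L1 in P1_0 P1_hi P1_mu P1_m chain1.
apply: wp_seq; apply: (wp_while (Inv := fill_inv P1)).
- exists L1, 0%N; split=> //; first by rewrite addn0.
  split; [| by rewrite subrr mulr0 addr0 | by [] | by left].
  by rewrite addn0; apply: leq_trans (max_card _) _; rewrite card_prod !card_ord mulnC.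
- move=> t st' inv; rewrite /= => h.
  have [L [t' [_ _ _ _ [op _ _ [[f1 tt]|[f0 _]]]]]] := inv; last by rewrite f0 in h.
  split; last exact: wp_fill_body.
  by apply: leq_ltn_trans NN; apply: leq_trans (leq_addl _ _); rewrite -tt;
    apply: leq_trans op; exact: leq_addl.
move=> t st' [L [t' [ev' LA' sL sp [op ic chain fl]]]] _ h; rewrite /= in h.
case: fl => [[f1]|[_ m1]]; first by rewrite f1 in h.
have LN : (size L <= N)%N.
  apply: leq_trans sL _; apply: leq_trans (ltnW NN); rewrite addnAC.
  by apply: leq_trans (leq_addr _ _); rewrite leq_add2l; apply: leq_trans op; exact: leq_addl.
have [_ k'] := env_nm ev'.
apply: (wp_copy_list eps0 k0 rN kN nN sN mN k' LN LA') => // st5 _ [h5 L5].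
have fP := sub_plan_full mu1 sp m1.
have mP := feasible_mass (mu1 (Ordinal k0)) fP.
exists (c0 + c1 + t')%N, L; split=> //.
- exists c0, c1, t', P0, P1; split=> //.
    by rewrite -[c1]addn0; apply: chain1; exact: SearchDone.
  by rewrite -[t']addn0; apply: chain; exact: FillDone.
- split=> // jj; rewrite /of_list [RHS]big_mkcond /= -[LHS](sum_list n0 L (fun p => p.2 * (jj == p.1)%:R)).
  apply: eq_bigr => t0 _; have [g1 g2] := L5 t0 (ltn_ord t0).
  have -> : [forall i, narr st5 0 [:: val t0; val i] == jj i] = (jj == (nth (jj0 n0, 0) L t0).1).
    apply/forallP/eqP => [h'|-> i]; last by rewrite g1.
    by apply/ffunP => i; apply: val_inj; apply: etrans (g1 i); apply/esym/eqP.
  by rewrite g2; case: eqP => _; rewrite ?mulr1 ?mulr0.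
- apply: (normalized_mot k0 mu1 eps0) => // X fX; have := low X fX.
  by move: ic P1_hi P1_m stop; rewrite mP; lra.
- by rewrite leq_add // ?leq_add //; apply: leq_trans op; exact: leq_addl.
Qed.

End MwuMain.

(** * Correctness of the Sinkhorn program *)
Section SinkhornCorrect.
Variables (R : realType) (r : nat) (I : instance R r) (eps : R) (K : nat).
Local Notation n := (side I).
Local Notation k := (nmarg I).
Local Notation eta := (sinkhorn_eta n k (eps / 2)).
Local Notation mu := (target I).
Local Notation Ct := (surrogate I eps K).
Local Notation iter := (sinkhorn_iter Ct mu eta).
Local Notation thr := (sink_thr I eps).
Local Notation total := (total_violation Ct mu eta).
Hypotheses (eps0 : 0 < eps) (k0 : (0 < k)%N) (mu1 : forall i, in_simplex (mu i)).
Hypothesis RK : forall jj, `|low_rank_part I jj| <= K%:R * Cmax I.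

Let n0 : (0 < n)%N. Proof. exact: n_gt0 k0 mu1. Qed.
Let close := surrogate_close eps0 k0 n0 RK.

Lemma Cmax_ge0 : 0 <= Cmax I.
Proof. by rewrite /Cmax /tmax; elim/big_ind : _ => // x y x0 y0; rewrite le_max x0. Qed.

Lemma Cmax_eps_gt0 : 0 < Cmax I + eps.
Proof. by rewrite ltr_wpDl ?Cmax_ge0. Qed.

Lemma sink_thr_gt0 : 0 < thr.
Proof. by rewrite divr_gt0 // mulr_gt0 // Cmax_eps_gt0. Qed.

Lemma surrogate_le jj : `|Ct jj| <= Cmax I + eps / 8.
Proof.
have -> : Ct jj = cost I jj - (cost I jj - Ct jj) by rewrite subKr.
apply: le_trans (ler_normB _ _) _; apply: lerD; last exact: close.
exact: (le_bigmax _ (fun jj => `|cost I jj|) jj).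
Qed.

Lemma admissible_run s : admissible mu (iter s).
Proof.
elim/last_ind: s => // s i IH; rewrite /sinkhorn_iter foldl_rcons; exact: admissible_upd.
Qed.

Lemma mass_run s : (0 < size s)%N -> mass (scaled Ct (iter s) eta) = 1.
Proof.
elim/last_ind: s => // s i _ _; rewrite /sinkhorn_iter foldl_rcons; apply: mass_upd => //.
exact: admissible_run.
Qed.

(** The error is the sum of the regularisation bias [eps / 4], the rounding
    error [eps / 2] and twice the distance [eps / 8] of the surrogate cost. *)
Lemma run_accuracy s : (0 < size s)%N -> total (iter s) <= thr ->
  let d := rounded Ct mu eta (iter s) in
  let v := residual Ct mu eta d in
  let P := implicit_tensor Ct eta d v in
  [/\ forall i j, 0 <= d i j /\ 0 <= v i j, mot_approx (cost I) mu eps P &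
      forall jj, in_support mu jj -> 0 < P jj].
Proof.
move=> s0 tv d v P.
have [fP dv Pp acc] := sinkhorn_accuracy k0 mu1 surrogate_le (admissible_run s) (mass_run s0) tv.
split=> //; split=> // Q fQ; have [P0 _] := fP; have [Q0 _] := fQ.
have mP := feasible_mass (mu1 (Ordinal k0)) fP.
have mQ := feasible_mass (mu1 (Ordinal k0)) fQ.
have [n1|n1] := leqP n 1.
  have one (jj : midx n k) : jj = [ffun=> Ordinal n0].
    apply/ffunP => i; apply: val_inj; rewrite ffunE /=.
    by apply/eqP; rewrite -leqn0 -ltnS; apply: leq_trans n1.
  have innerE X : inner (cost I) X = cost I [ffun=> Ordinal n0] * mass X.
    by rewrite /inner /mass mulr_sumr; apply: eq_bigr => jj _; rewrite -(one jj).
  by rewrite !innerE -/P mP mQ lerDl ltW.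
have ee := eta_gt0 eps0 k0 n0 n1.
have eta0 : 0 < eta by rewrite -(pmulr_lgt0 _ eps0); exact: lt_le_trans ee.
have i1 : inner (cost I) P <= inner Ct P + eps / 8.
  have -> : eps / 8 = eps / 8 * mass P by rewrite mP mulr1.
  rewrite /inner /mass mulr_sumr -big_split /=; apply: ler_sum => jj _.
  rewrite -mulrDl; apply: ler_wpM2r => //; have := close jj.
  by rewrite ler_norml => /andP[h1 h2]; lra.
have i2 : inner Ct Q <= inner (cost I) Q + eps / 8.
  have -> : eps / 8 = eps / 8 * mass Q by rewrite mQ mulr1.
  rewrite /inner /mass mulr_sumr -big_split /=; apply: ler_sum => jj _.
  rewrite -mulrDl; apply: ler_wpM2r => //; have := close jj.
  by rewrite ler_norml => /andP[h1 h2]; lra.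
have h1 : k%:R * ln n%:R / eta = eps / 4.
  move: eta0; rewrite eta_eq // => eta0'.
  have z0 : k%:R * ln n%:R != 0 :> R.
    by apply: contraTneq eta0' => ->; rewrite mulr0 mul0r ltxx.
  by move: (k%:R * ln n%:R) z0 => z z0; field; rewrite z0 gt_eqF.
have h2 : 4 * (Cmax I + eps / 8) * thr <= eps / 2.
  have ce := Cmax_eps_gt0.
  rewrite /sink_thr mulrA ler_pdivrMr ?mulr_gt0 //.
  have : 0 <= eps * eps by rewrite mulr_ge0 ?(ltW eps0).
  have : 0 <= eps * Cmax I by rewrite mulr_ge0 ?(ltW eps0) ?Cmax_ge0.
  by move=> a b; lra.
have := acc eta0 Q fQ; rewrite -/d -/v -/P h1.
by move: i1 i2 h2; lra.
Qed.

Variable B : R.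
Hypothesis etaC : forall jj, `|eta * Ct jj| <= B.

(** A longer run would pass through the small violation whose existence the
  convergence theorem asserts, and would have stopped there. *)
Lemma deterministic_termination rule s Nit : rule <> Random ->
  k%:R * ln n%:R + 2 * B < Nit%:R * (thr ^+ 2 / (4 * k%:R ^+ 4)) ->
  follows_rule Ct mu rule eta [::] s -> unstopped_run eps K s -> (size s <= k * Nit)%N.
Proof.
move=> nR big leg uns; rewrite leqNgt; apply/negP => sN.
pose i0 := Ordinal k0; pose sigma := nth i0 s.
have itE t : (t <= size s)%N -> iterate Ct mu eta sigma t = iter (take t s).
  move=> ts; rewrite /iterate; congr sinkhorn_iter; apply: (@eq_from_nth _ i0).
    by rewrite size_mkseq size_takel.
  by move=> i; rewrite size_mkseq => it; rewrite nth_mkseq // nth_take.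
have prog t : (t + k <= k * Nit)%N -> thr < total (iterate Ct mu eta sigma t.+1) ->
  exists2 q, (q < k)%N & thr / k%:R ^+ 2 <=
    violation Ct mu eta (iterate Ct mu eta sigma (t.+1 + q)) (sigma (t.+1 + q)%N).
  move=> tk; have ts : (t.+1 < size s)%N.
    by apply: leq_ltn_trans sN; apply: leq_trans tk; rewrite -addn1 leq_add2l.
  case: rule nR leg => // _ leg.
  - apply: (round_robin_progress k0 mu1 sink_thr_gt0) => q qt.
    have qs : (q < size s)%N by apply: leq_ltn_trans sN; exact: leq_trans tk.
    rewrite -[LHS]/(val (nth i0 s q)) -(nth_map i0 0%N val qs) leg.
    by rewrite (nth_map 0%N) ?size_iota // nth_iota.
  - apply: (greedy_progress k0 sink_thr_gt0) => i.
    have := leg (take t.+1 s) (sigma t.+1) (drop t.+2 s).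
    rewrite itE 1?ltnW // => h; apply: h.
    by rewrite -drop_nth // cat_take_drop.
have [t [tN tt]] := deterministic_convergence k0 mu1 etaC sink_thr_gt0 prog big.
have ts : (t < size s)%N by exact: leq_ltn_trans sN.
have := uns t ts; rewrite ltNge => /negP; apply; rewrite -itE //.
Qed.

Lemma random_termination s w t0 :
  total (iter (take t0.+1 w)) <= thr -> (t0 < size w)%N ->
  follows_rule Ct mu Random eta w s -> unstopped_run eps K s -> (size s <= t0)%N.
Proof.
move=> tt tw /prefixP[s' wE] uns; rewrite leqNgt; apply/negP => sN.
have := uns t0 sN; rewrite ltNge => /negP; apply; move: tt; rewrite wE take_cat.
case: ltnP => // h; have -> : t0.+1 = size s by apply/eqP; rewrite eqn_leq sN h.
by rewrite subnn take0 cats0 take_size.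
Qed.

Section Program.
Variables (rule : update_rule) (tape : seq 'I_k) (N : nat).
Hypothesis inj : injective (spos I).
Hypotheses (rN : (r <= N)%N) (kN : (k <= N)%N) (nN : (n <= N)%N) (sN : (spars I <= N)%N).
Hypothesis mN : (sink_degree I eps K < N)%N.

Lemma sinkhorn_program (X : R) :
  (forall s, follows_rule Ct mu rule eta tape s -> unstopped_run eps K s ->
     (size s < N)%N /\ (rule = Random -> (size s < size tape)%N)) ->
  (ptime N (PSinkhorn r K rule))%:R <= X -> N%:R <= X ->
  sinkhorn_succeeds rule (prog_com (fresh r) (PSinkhorn r K rule)) eps Ct tape X.
Proof.
move=> term tX NX st ld.
have W := wp_sinkhorn eps0 k0 n0 RK inj rN kN nN sN mN term ld.
have [t [st0 [st' [ex tN [_ _ ag] [s [leg sz tv out]]]]]] :=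
  exec_prog_com (pok_sinkhorn r K rule) W (agree_refl _ 0 st).
have /andP[s0 sN'] := sz; have [dv acc pos] := run_accuracy s0 tv.
exists t, st0, (size s), (rounded Ct mu eta (iter s)), (residual Ct mu eta (rounded Ct mu eta (iter s))).
split=> //; first by apply: le_trans tX; rewrite ler_nat.
  by move=> i j; rewrite !ag ?addn0 //; exact: out.
split=> //; first by exists s.
by apply: le_trans NX; rewrite ler_nat.
Qed.

Lemma evaluate_program (X : R) : (ptime N (PEvaluate r K))%:R <= X ->
  evaluates (prog_com (fresh r) (PEvaluate r K)) eps Ct X.
Proof.
move=> tX jj st ld qu.
have W := wp_evaluate eps0 n0 RK rN kN sN mN ld qu.
have [t [st0 [st' [ex tN [_ _ ag] out]]]] := exec_prog_com (pok_evaluate r K) W (agree_refl _ 0 st).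
exists t, st0; split=> //; first by apply: le_trans tX; rewrite ler_nat.
by rewrite ag.
Qed.

End Program.
End SinkhornCorrect.

(** * Polynomial bounds *)
Lemma poly_growth_exp f m : poly_growth f -> poly_growth (fun N => f N ^ m)%N.
Proof.
move=> pf; elim: m => [|m IH]; first exact: poly_growth_cst.
have [c [e h]] := poly_growth_mul pf IH.
by exists c, e => N; rewrite expnS.
Qed.

Lemma poly_growth_comp f g : poly_growth f -> poly_growth g -> poly_growth (fun N => f (g N)).
Proof.
move=> [c [e h]] pg.
have [c' [e' h']] := poly_growth_mul (poly_growth_cst c) (poly_growth_exp e (poly_growth_add (poly_growth_cst 1) pg)).
by exists c', e' => N; apply: leq_trans (h _) _.
Qed.

(** A natural above [1 + x], through which real size parameters enter the counts. *)
Definition size_ceil (R : realType) (x : R) : nat := (Num.truncn x).+2.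

Lemma size_ceil_ge (R : realType) (x : R) : 1 + x <= (size_ceil x)%:R.
Proof. by rewrite -[(size_ceil x)]add1n natrD lerD2l ltW // truncnS_gt. Qed.

Lemma poly_growth_bound (R : realType) f : poly_growth f -> exists c e : nat, forall x : R, 0 <= x ->
  (f (size_ceil x))%:R <= poly_bound c e x.
Proof.
move=> [c [e h]]; exists (c * 3 ^ e)%N, e => x x0.
apply: (@le_trans _ _ (c * (1 + size_ceil x) ^ e)%:R); first by rewrite ler_nat.
rewrite /poly_bound !natrM !natrX -mulrA ler_wpM2l // -exprMn.
apply: lerXn2r; rewrite ?nnegrE //; first by rewrite mulr_ge0 // addr_ge0.
have := truncn_le x; rewrite x0 => t0; rewrite natrD /size_ceil -addn2 natrD; lra.
Qed.

(** One bound for the loop counts, degrees and array sizes of all programs on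
  instances of size parameter below [Y], with one summand for each kind of bound. *)
Definition fuel (r K a b Y : nat) : nat :=
  (r + 10 + 3 * Y ^ 1 + a * Y ^ b + 16 * (40 * Y ^ 3 * K + 1) ^ 2 +
   (3200 * Y ^ 6 + 20 * Y ^ 1 + 1 * Y ^ 2) + 2304 * Y ^ 10)%N.

Lemma poly_growth_fuel r K a b : poly_growth (fuel r K a b).
Proof.
have mono d m : poly_growth (fun Y => d * Y ^ m)%N.
  by apply: poly_growth_mul; [exact: poly_growth_cst | apply: poly_growth_exp; exact: poly_growth_id].
have sum f g : poly_growth f -> poly_growth g -> poly_growth (fun Y => f Y + g Y)%N.
  exact: poly_growth_add.
have sq : poly_growth (fun Y => 16 * (40 * Y ^ 3 * K + 1) ^ 2)%N.
  apply: (poly_growth_mul (poly_growth_cst _)); apply: (@poly_growth_exp (fun Y => 40 * Y ^ 3 * K + 1)%N).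
  by apply: (sum _ (fun=> 1%N)); [exact: (poly_growth_mul (mono _ _) (poly_growth_cst K)) | exact: poly_growth_cst].
exact: (sum _ _ (sum _ _ (sum _ _ (sum _ _ (sum _ _ (poly_growth_cst (r + 10)) (mono 3 1)) (mono a b)) sq)
  (sum _ _ (sum _ _ (mono 3200 6) (mono 20 1)) (mono 1 2))) (mono 2304 10))%N.
Qed.

Lemma degree_of_le (R : realType) (x : R) (X : nat) : 0 <= x -> x <= X%:R ->
  (degree_of x <= 16 * (X + 1) ^ 2 + 1)%N.
Proof.
move=> x0 xX; rewrite /degree_of addn1 ltnS -(ler_nat R).
have := truncn_le (degree_bound x); rewrite degree_bound_ge0 // => t.
apply: le_trans t _; rewrite /degree_bound natrM natrX natrD ler_wpM2l // expr2.
by apply: ler_pM; rewrite ?addr_ge0 // lerD2r.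
Qed.

Section Bounds.
Variables (R : realType) (r : nat) (I : instance R r) (eps : R) (K Y : nat).
Local Notation n := (side I).
Local Notation k := (nmarg I).
Local Notation mu := (target I).
Local Notation e := (normalized_eps (cost I) eps).
Local Notation y := (Y%:R : R).
Hypotheses (eps0 : 0 < eps) (k0 : (0 < k)%N) (n0 : (0 < n)%N).
Hypothesis K0 : (0 < K)%N.
Hypothesis RK : forall jj, `|low_rank_part I jj| <= K%:R * Cmax I.
Hypothesis Y_ge : 1 + size_param I eps <= y.

Let ratio0 : 0 <= Cmax I / eps.
Proof. by rewrite divr_ge0 ?Cmax_ge0 // ltW. Qed.

Lemma nk_le : (n + k <= Y)%N.
Proof. by rewrite -(ler_nat R) natrD; move: Y_ge ratio0; rewrite /size_param; lra. Qed.

Let y1 : 1 <= y.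
Proof. by move: Y_ge ratio0 (ler0n R n) (ler0n R k); rewrite /size_param; lra. Qed.
Let nY : n%:R <= y.
Proof. by rewrite ler_nat; apply: leq_trans nk_le; exact: leq_addr. Qed.
Let kY : k%:R <= y.
Proof. by rewrite ler_nat; apply: leq_trans nk_le; exact: leq_addl. Qed.

Lemma ratio_le : Cmax I / eps + 1 <= y.
Proof. by move: Y_ge (ler0n R n) (ler0n R k); rewrite /size_param; lra. Qed.

Lemma kln_ge0 : 0 <= k%:R * ln (n%:R : R).
Proof. by rewrite mulr_ge0 // ln_ge0 // ler1n. Qed.

Lemma kln_le : k%:R * ln n%:R <= y ^+ 2.
Proof.
rewrite expr2; apply: ler_pM => //; first by rewrite ln_ge0 // ler1n.
apply: le_trans (ln_le_sub1 _) _; first by rewrite ltr0n.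
by move: nY; lra.
Qed.

(** ** Multiplicative weights *)

Let e0 : 0 < e. Proof. by have [] := normalized_eps_bounds (cost I) eps0. Qed.
Let e1 : e <= 1 / 10. Proof. by have [] := normalized_eps_bounds (cost I) eps0. Qed.

Lemma normalized_eps_ge : 1 <= 20 * y * e.
Proof.
rewrite /normalized_eps; case: eqP => [_|/eqP t0]; first by move: y1; lra.
have c0 : 0 < Cmax I by rewrite lt_def t0 Cmax_ge0.
have h : 1 <= 20 * y * (eps / (20 * Cmax I)).
  have -> : 20 * y * (eps / (20 * Cmax I)) = y / (Cmax I / eps).
    by move: (Cmax I) c0 eps0 => z z0 ee; field; rewrite !gt_eqF.
  rewrite ler_pdivlMr ?divr_gt0 // mul1r; move: ratio_le; lra.
by rewrite /Num.min; case: ifP => // _; move: y1; lra.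
Qed.

Lemma inv_e_le z w : 0 <= w -> z <= w -> z / e <= w * (20 * y).
Proof.
move=> w0 zw; rewrite ler_pdivrMr // -mulrA; apply: le_trans zw _.
by rewrite ler_peMr // normalized_eps_ge.
Qed.

Lemma mwu_eta_le : mwu_eta n k e <= 40 * y ^+ 3.
Proof.
rewrite /mwu_eta; have -> : 40 * y ^+ 3 = 2 * y ^+ 2 * (20 * y) by rewrite !exprS; ring.
apply: inv_e_le; first by rewrite mulr_ge0 // exprn_ge0.
rewrite ler_wpM2l //; apply: le_trans (ln_le_sub1 _) _; first by rewrite ltr0n addn1.
by rewrite natrD addrK natrM expr2 ler_pM.
Qed.

Lemma mwu_count_le :
  (n * k + 1)%:R * (mwu_eta n k e * (1 + e) ^+ 4) < (3200 * Y ^ 6 + 1)%N%:R * e.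
Proof.
have nk : (n * k + 1)%:R <= 2 * y ^+ 2.
  have h : (n * k)%:R <= y ^+ 2 by rewrite natrM expr2 ler_pM.
  have : 1 <= y ^+ 2 by rewrite exprn_ege1.
  by rewrite natrD; move: h; lra.
have eta0 : 0 <= mwu_eta n k e.
  by rewrite /mwu_eta divr_ge0 ?(ltW e0) // mulr_ge0 // ln_ge0 // ler1n addn1.
have f2 : (1 + e) ^+ 4 <= 2.
  have h : (1 + e) ^+ 2 <= 13 / 10 by rewrite expr2; move: e0 e1; nra.
  have h' : 0 <= (1 + e) ^+ 2 by exact: sqr_ge0.
  by rewrite -[4%N]/(2 * 2)%N exprM expr2; move: ((1 + e) ^+ 2) h h' => z; nra.
have f0 : 0 <= (1 + e) ^+ 4 by rewrite exprn_ge0 // addr_ge0 // ltW.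
apply: (@le_lt_trans _ _ (2 * y ^+ 2 * (40 * y ^+ 3 * 2))).
  apply: ler_pM => //; first exact: mulr_ge0.
  by apply: ler_pM => //; exact: mwu_eta_le.
have y5 : 0 <= y ^+ 5 by rewrite exprn_ge0.
have -> : 2 * y ^+ 2 * (40 * y ^+ 3 * 2) = 160 * y ^+ 5 by rewrite !exprS; ring.
rewrite [X in _ < X](_ : _ = 160 * y ^+ 5 * (20 * y * e) + e); last first.
  by rewrite natrD natrM natrX; ring.
apply: ltr_pwDr => //; rewrite ler_peMr ?normalized_eps_ge // mulr_ge0 //.
Qed.

Lemma mwu_degree_le : (mwu_degree I eps K <= 16 * (40 * Y ^ 3 * K + 1) ^ 2 + 1)%N.
Proof.
have H0 : 0 <= mwu_H I eps.
  by rewrite divr_ge0 ?(ltW e0) // addr_ge0 // kln_ge0.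
apply: degree_of_le; first by rewrite mulr_ge0.
rewrite natrM ler_wpM2r // natrM natrX.
have -> : 40%:R * y ^+ 3 = 2 * y ^+ 2 * (20 * y) by rewrite !exprS; ring.
apply: inv_e_le; first by rewrite mulr_ge0 // exprn_ge0.
have : 1 <= y ^+ 2 by rewrite exprn_ege1.
by move: kln_le; lra.
Qed.

(** ** Sinkhorn *)

Local Notation eta := (sinkhorn_eta n k (eps / 2)).

Lemma sink_degree_le : (sink_degree I eps K <= 16 * (40 * Y ^ 3 * K + 1) ^ 2 + 1)%N.
Proof.
apply: degree_of_le.
  by rewrite mulr_ge0 ?eta_ge0 // mulr_ge0 // Cmax_ge0.
rewrite /sink_range eta_eq //.
have -> : 4 * (k%:R * ln n%:R) / eps * (K%:R * Cmax I) =
    4 * (k%:R * ln n%:R) * (Cmax I / eps) * K%:R.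
  by move: (Cmax I) (ln _) eps0 => z l ee; field; rewrite gt_eqF.
rewrite natrM ler_wpM2r // natrM natrX.
apply: (@le_trans _ _ (4 * y ^+ 2 * y)).
  apply: ler_pM => //; first by rewrite mulr_ge0 // kln_ge0.
    by rewrite ler_wpM2l // kln_le.
  by move: ratio_le; lra.
by rewrite -mulrA -exprSr ler_wpM2r ?exprn_ge0 // ler_nat.
Qed.

(** The accuracy enters only through [Cmax / eps]: [eta] itself is not bounded by the
  size parameter, but its product with the cost is. *)
Lemma eta_surrogate_le jj : `|eta * surrogate I eps K jj| <= 4 * y ^+ 3.
Proof.
have mu1' := surrogate_close eps0 k0 n0 RK jj.
have sl : `|surrogate I eps K jj| <= Cmax I + eps / 8.
  have -> : surrogate I eps K jj = cost I jj - (cost I jj - surrogate I eps K jj) by rewrite subKr.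
  apply: le_trans (ler_normB _ _) _; apply: lerD => //.
  exact: (le_bigmax _ (fun jj => `|cost I jj|) jj).
rewrite normrM ger0_norm ?eta_ge0 //.
apply: (@le_trans _ _ (eta * (Cmax I + eps / 8))); first by rewrite ler_wpM2l ?eta_ge0.
rewrite eta_eq //.
have -> : 4 * (k%:R * ln n%:R) / eps * (Cmax I + eps / 8) =
    4 * (k%:R * ln n%:R) * (Cmax I / eps + 1 / 8).
  by move: (Cmax I) (ln _) eps0 => z l ee; field; rewrite gt_eqF.
rewrite [y ^+ 3]exprSr [X in _ <= X]mulrA; apply: ler_pM.
- by rewrite mulr_ge0 // kln_ge0.
- by rewrite addr_ge0.
- by rewrite ler_wpM2l // kln_le.
- by move: ratio_le; lra.
Qed.

Lemma sink_thr_ge : 1 <= 8 * y * sink_thr I eps.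
Proof.
rewrite /sink_thr; have ce := Cmax_eps_gt0 I eps0.
have -> : 8 * y * (eps / (8 * (Cmax I + eps))) = y / (Cmax I / eps + 1).
  have ce' : Cmax I + eps != 0 by rewrite gt_eqF.
  by move: (Cmax I) eps0 ce' => z ee zz; field; rewrite zz gt_eqF.
rewrite ler_pdivlMr ?mul1r ?ratio_le //; move: ratio0; lra.
Qed.

Lemma sinkhorn_range_le : k%:R * ln n%:R + 2 * (4 * y ^+ 3) <= 9 * y ^+ 3.
Proof.
have : y ^+ 2 <= y ^+ 3 by rewrite ler_weXn2l.
by move: kln_le; lra.
Qed.

Lemma thr_power_ge m : (m <= 4)%N -> 1 <= 256 * y ^+ 6 * (sink_thr I eps ^+ 2 / (4 * k%:R ^+ m)).
Proof.
move=> m4; have t1 := sink_thr_ge.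
have kp : (0 : R) < k%:R ^+ m by rewrite exprn_gt0 // ltr0n.
have ky : k%:R ^+ m <= y ^+ 4.
  apply: (@le_trans _ _ (y ^+ m)); first by apply: lerXn2r; rewrite ?nnegrE.
  by rewrite ler_weXn2l.
have -> : 256 * y ^+ 6 * (sink_thr I eps ^+ 2 / (4 * k%:R ^+ m)) =
    (8 * y * sink_thr I eps) ^+ 2 * (y ^+ 4 / k%:R ^+ m).
  by move: (k%:R ^+ m) kp => z zz; rewrite !exprS; field; rewrite gt_eqF.
apply: mulr_ege1; first exact: exprn_ege1.
by rewrite ler_pdivlMr // mul1r.
Qed.

Lemma deterministic_count : k%:R * ln n%:R + 2 * (4 * y ^+ 3) <
  (2304 * Y ^ 9 + 1)%N%:R * (sink_thr I eps ^+ 2 / (4 * k%:R ^+ 4)).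
Proof.
apply: le_lt_trans sinkhorn_range_le _.
have := thr_power_ge (leqnn 4); set z := _ / _ => h.
have z0 : 0 < z by rewrite divr_gt0 // ?exprn_gt0 ?sink_thr_gt0 // mulr_gt0 // exprn_gt0 // ltr0n.
rewrite [X in _ < X](_ : _ = 9 * y ^+ 3 * (256 * y ^+ 6 * z) + z); last first.
  by rewrite natrD natrM natrX; ring.
by apply: ltr_pwDr => //; rewrite ler_peMr // mulr_ge0 // exprn_ge0.
Qed.

Lemma random_count delta : 0 < delta -> delta^-1 <= y -> k%:R * ln n%:R + 2 * (4 * y ^+ 3) <=
  (2304 * Y ^ 10)%N%:R * (sink_thr I eps ^+ 2 / (4 * k%:R ^+ 3)) * delta.
Proof.
move=> d0 dy; apply: le_trans sinkhorn_range_le _.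
have := thr_power_ge (leqnSn 3); set z := _ / _ => h.
have dy' : 1 <= y * delta by rewrite -ler_pdivrMr // mul1r.
rewrite [X in _ <= X](_ : _ = 9 * y ^+ 3 * ((256 * y ^+ 6 * z) * (y * delta))); last first.
  by rewrite natrM natrX; ring.
rewrite ler_peMr // ?mulr_ge0 // ?exprn_ge0 //.
exact: mulr_ege1.
Qed.

End Bounds.

(** * Both algorithms succeed in polynomial time *)
Lemma fuel_bounds r K a b Y : let N := fuel r K a b Y in
  [/\ (r <= N)%N, (4 <= N)%N, (Y <= N)%N & (a * Y ^ b <= N)%N] /\
  [/\ (16 * (40 * Y ^ 3 * K + 1) ^ 2 + 1 < N)%N,
      ((3200 * Y ^ 6 + 1) + 20 * Y + Y * Y < N)%N,
      (Y * (2304 * Y ^ 9 + 1) < N)%N & ((2304 * Y ^ 10).+1 < N)%N].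
Proof.
have e10 : (Y * (2304 * Y ^ 9 + 1) = 2304 * Y ^ 10 + Y)%N by rewrite mulnDr muln1 mulnCA -expnS.
rewrite e10 /fuel expn1 mul1n -[(Y ^ 2)%N]mulnn; clear e10.
move: (a * _)%N (16 * _)%N (3200 * _)%N (2304 * _)%N (Y * Y)%N => A D G S Q.
by split; split; lia.
Qed.

Section Instances.
Variables (R : realType) (r : nat) (K : R) (a b : nat).

(** Programs contain no real constants, so [K] is replaced by a natural above it. *)
Definition nat_above : nat := (Num.truncn `|K|).+1.

Lemma nat_above_ge : K <= nat_above%:R.
Proof. by apply: le_trans (ler_norm K) _; rewrite ltW // truncnS_gt. Qed.

Variables (I : instance R r) (eps : R).
Hypotheses (val : valid K a b I) (eps0 : 0 < eps).
Local Notation n := (side I).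
Local Notation k := (nmarg I).
Local Notation mu := (target I).
Local Notation Kn := nat_above.

Let k0 : (0 < k)%N. Proof. by case: val. Qed.
Let mu1 : forall i, in_simplex (mu i). Proof. by case: val => _ []. Qed.
Let n0 : (0 < n)%N. Proof. exact: n_gt0 k0 mu1. Qed.
Let inj : injective (spos I). Proof. by case: val => _ [_ [_ []]]. Qed.

Let RK jj : `|low_rank_part I jj| <= Kn%:R * Cmax I.
Proof.
case: val => _ [_ [_ [_ [_ [_ [h _]]]]]]; apply: le_trans (h jj) _.
by rewrite ler_wpM2r ?Cmax_ge0 // nat_above_ge.
Qed.

Lemma size_param_ge0 : 0 <= size_param I eps.
Proof. by rewrite !addr_ge0 // divr_ge0 ?Cmax_ge0 // ltW. Qed.

Section Size.
Variable Y : nat.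
Hypothesis Y_ge : 1 + size_param I eps <= Y%:R.
Local Notation N := (fuel r Kn a b Y).

Lemma instance_fits : [/\ (r <= N)%N, (k <= N)%N, (n <= N)%N & (spars I <= N)%N].
Proof.
have [[rN _ YN aN] _] := fuel_bounds r Kn a b Y; have nkY := nk_le eps0 Y_ge.
split=> //.
- by apply: leq_trans YN; apply: leq_trans nkY; exact: leq_addl.
- by apply: leq_trans YN; apply: leq_trans nkY; exact: leq_addr.
- case: val => _ [_ [_ [_ [_ [h _]]]]]; apply: leq_trans h (leq_trans _ aN).
  by rewrite leq_mul2l; apply/orP; right; case: (b) => // b1; rewrite leq_exp2r.
Qed.

Lemma mwu_correct (X : R) : (ptime N (PMwu r Kn) + (N + N * N))%:R <= X ->
  mwu_succeeds (prog_com (fresh r) (PMwu r Kn)) I eps X.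
Proof.
move=> BX st ld; have [rN kN nN sN] := instance_fits.
have [[_ N4 _ _] [mN NN _ _]] := fuel_bounds r Kn a b Y.
have nkY : (n * k <= Y * Y)%N.
  have := nk_le eps0 Y_ge => h; apply: leq_mul; apply: leq_trans h; [exact: leq_addr | exact: leq_addl].
have mN' : (mwu_degree I eps Kn < N)%N.
  by apply: leq_ltn_trans mN; apply: (mwu_degree_le _ eps0 n0).
have c1 := mwu_count_le eps0 Y_ge.
have c2 : 1 <= (20 * Y)%N%:R * normalized_eps (cost I) eps.
  by rewrite natrM; exact: normalized_eps_ge.
have NN' : ((3200 * Y ^ 6 + 1) + 20 * Y + n * k < N)%N.
  by apply: leq_ltn_trans NN; rewrite leq_add2l.
have W := wp_mwu eps0 k0 n0 mu1 inj rN kN nN sN RK mN' c1 c2 N4 NN' ld.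
have [t [st0 [st' [ex tN [ag1 ag2 ag3] [cnt [L [run out acc cN LN]]]]]]] :=
  exec_prog_com (pok_mwu r Kn) W (agree_refl _ 0 st).
have le_X z : (z <= ptime N (PMwu r Kn) + (N + N * N))%N -> z%:R <= X.
  by move=> h; apply: le_trans BX; rewrite ler_nat.
have N_X z : (z <= N)%N -> z%:R <= X.
  move=> h; apply: le_X; apply: leq_trans h _; rewrite addnCA; exact: leq_addr.
exists t, st0, (of_list L), cnt, (size L); split.
- exact: ex.
- by apply: le_X; apply: leq_trans tN _; exact: leq_addr.
- case: out => h1 h2; split; first by rewrite ag1 ?addn0.
  move=> jj; rewrite h2; apply: eq_big => [t0|t0 _]; last by rewrite ag3 ?addn0.
  by apply: eq_forallb => i; rewrite ag2 ?addn0.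
split=> //; last 2 first.
- exact: N_X.
- by apply: N_X; apply: leq_trans LN; exact: nnz_of_list.
apply: le_X; apply: leq_trans cN _; apply: leq_trans (leq_addl _ _).
rewrite addnAC; apply: leq_add.
  by apply: leq_trans (ltnW NN'); rewrite leq_add2r leq_addr.
apply: leq_mul; apply: leq_trans (ltnW NN'); apply: leq_trans (leq_addr _ _).
  exact: leq_addl.
exact: leq_addr.
Qed.

Local Notation Ct := (surrogate I eps Kn).
Local Notation eta := (sinkhorn_eta n k (eps / 2)).

Let mN : (sink_degree I eps Kn < N)%N.
Proof.
have [_ [mN _ _ _]] := fuel_bounds r Kn a b Y.
by apply: leq_ltn_trans mN; apply: (sink_degree_le _ eps0 n0).
Qed.

Lemma evaluate_correct (X : R) : (ptime N (PEvaluate r Kn))%:R <= X ->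
  evaluates (prog_com (fresh r) (PEvaluate r Kn)) eps Ct X.
Proof.
by move=> hX; have [rN kN nN sN] := instance_fits; exact: (evaluate_program eps0 k0 mu1 RK rN kN sN mN hX).
Qed.

Lemma sinkhorn_correct rule (X : R) : rule <> Random ->
  (ptime N (PSinkhorn r Kn rule))%:R <= X -> N%:R <= X ->
  sinkhorn_succeeds rule (prog_com (fresh r) (PSinkhorn r Kn rule)) eps Ct [::] X.
Proof.
move=> nR tX NX; have [rN kN nN sN] := instance_fits.
apply: (sinkhorn_program eps0 k0 mu1 RK inj rN kN nN sN mN _ tX NX) => s leg uns.
split=> // ; have [_ [_ _ dN _]] := fuel_bounds r Kn a b Y.
apply: leq_ltn_trans dN.
have etaC := eta_surrogate_le eps0 k0 n0 RK Y_ge.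
have cnt := deterministic_count eps0 k0 n0 Y_ge.
apply: leq_trans (deterministic_termination eps0 k0 mu1 etaC nR cnt leg uns) _.
rewrite leq_mul2r; apply/orP; right; apply: leq_trans (nk_le eps0 Y_ge); exact: leq_addl.
Qed.

Lemma sinkhorn_random_correct (X delta : R) : 0 < delta -> delta^-1 <= Y%:R ->
  (ptime N (PSinkhorn r Kn Random))%:R <= X -> N%:R <= X ->
  exists T, (1 - delta) * k%:R ^+ T <= #|[set w : T.-tuple 'I_k | `[< sinkhorn_succeeds Random
      (prog_com (fresh r) (PSinkhorn r Kn Random)) eps Ct (tval w) X >]]|%:R.
Proof.
move=> d0 dY tX NX; have [rN kN nN sN] := instance_fits.
have [_ [_ _ _ TN]] := fuel_bounds r Kn a b Y.
have etaC := eta_surrogate_le eps0 k0 n0 RK Y_ge.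
have cnt := random_count eps0 k0 n0 Y_ge d0 dY.
have Y0 : (0 < Y)%N.
  by rewrite -(ltr_nat R); apply: lt_le_trans Y_ge; have := size_param_ge0; lra.
have T0 : (0 < 2304 * Y ^ 10)%N by rewrite muln_gt0 expn_gt0 Y0.
exists (2304 * Y ^ 10).+1.
apply: le_trans (random_convergence k0 mu1 etaC (sink_thr_gt0 I eps0) d0 cnt T0) _.
rewrite ler_nat; apply: subset_leq_card; apply/fintype.subsetP => w; rewrite !inE => -[t tT tt].
apply: (sinkhorn_program eps0 k0 mu1 RK inj rN kN nN sN mN _ tX NX) => s leg uns.
have tw : (t < size (tval w))%N by rewrite size_tuple.
have st := random_termination tt tw leg uns.
split; first by apply: leq_ltn_trans TN; apply: leq_trans st (leqW tT).
by move=> _; exact: leq_ltn_trans st tw.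
Qed.

End Size.

Lemma surrogate_half jj : `|cost I jj - surrogate I eps Kn jj| <= eps / 2.
Proof.
by apply: le_trans (surrogate_close eps0 k0 n0 RK jj) _; move: eps0; lra.
Qed.

End Instances.

Theorem corollary7p5 (R : realType) (r : nat) (K : R) :
  (exists p : com, forall a b : nat, exists c e : nat,
     forall I : instance R r, valid K a b I ->
     forall eps : R, 0 < eps ->
     mwu_succeeds p I eps (poly_bound c e (size_param I eps)))
  /\
  (forall rule : update_rule,
     exists p q : com, forall a b : nat, exists c e : nat,
     forall I : instance R r, valid K a b I ->
     forall eps : R, 0 < eps ->
     exists Ct : tensor R (side I) (nmarg I),
       (forall jj, `|cost I jj - Ct jj| <= eps / 2) /\
       evaluates q eps Ct (poly_bound c e (size_param I eps)) /\
       match rule with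
       | RoundRobin | Greedy =>
           sinkhorn_succeeds rule p eps Ct [::]
             (poly_bound c e (size_param I eps))
       | Random =>
           forall delta : R, 0 < delta -> delta < 1 ->
           exists T : nat,
             (1 - delta) * (nmarg I)%:R ^+ T <=
             #|[set w : T.-tuple 'I_(nmarg I) |
                  `[< sinkhorn_succeeds rule p eps Ct (tval w)
                        (poly_bound c e (size_param I eps + delta^-1)) >]]|%:R
       end).
Proof.
pose Kn := nat_above K; split.
  exists (prog_com (fresh r) (PMwu r Kn)) => a b.
  pose f Y := let N := fuel r Kn a b Y in (ptime N (PMwu r Kn) + (N + N * N))%N.
  have fG : poly_growth f.
    apply: poly_growth_add; last apply: poly_growth_add; last apply: poly_growth_mul;
      try exact: poly_growth_fuel.
    exact: poly_growth_comp (poly_growth_ptime _) (poly_growth_fuel _ _ _ _).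
  have [c [e h]] := poly_growth_bound R fG; exists c, e => I vI eps eps0.
  apply: (mwu_correct vI eps0 (size_ceil_ge _)); apply: h; exact: size_param_ge0.
move=> rule; exists (prog_com (fresh r) (PSinkhorn r Kn rule)), (prog_com (fresh r) (PEvaluate r Kn)) => a b.
pose f Y := let N := fuel r Kn a b Y in
  (ptime N (PSinkhorn r Kn rule) + (ptime N (PEvaluate r Kn) + N))%N.
have fG : poly_growth f.
  have pc g := poly_growth_comp (poly_growth_ptime g) (poly_growth_fuel r Kn a b).
  apply: poly_growth_add; last apply: poly_growth_add; [exact: pc | exact: pc | exact: poly_growth_fuel].
have [c [e h]] := poly_growth_bound R fG; exists c, e => I vI eps eps0.
have x0 := size_param_ge0 I eps0.
have bounds (x : R) : 0 <= x -> let N := fuel r Kn a b (size_ceil x) in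
    [/\ (ptime N (PSinkhorn r Kn rule))%:R <= poly_bound c e x,
        (ptime N (PEvaluate r Kn))%:R <= poly_bound c e x & N%:R <= poly_bound c e x].
  move=> x0' N; have hx := h x x0'; rewrite /f -/N in hx.
  split; apply: le_trans hx; rewrite ler_nat; first exact: leq_addr.
    by rewrite addnCA leq_addr.
  by rewrite addnA leq_addl.
have [b1 b2 b3] := bounds _ x0; have Yx := size_ceil_ge (size_param I eps).
exists (surrogate I eps Kn); split; first exact: surrogate_half vI eps0.
split; first exact: (evaluate_correct vI eps0 Yx).
clear h fG f; case: rule bounds b1 => bounds b1.
- exact: (sinkhorn_correct vI eps0 Yx).
- exact: (sinkhorn_correct vI eps0 Yx).
move=> delta d0 d1; pose x := size_param I eps + delta^-1.
have i0 : 0 < delta^-1 by rewrite invr_gt0.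
have [c1 _ c3] := bounds x (addr_ge0 x0 (ltW i0)).
have Yx' := size_ceil_ge x.
have Y1 : 1 + size_param I eps <= (size_ceil x)%:R.
  by apply: le_trans Yx'; rewrite lerD2l lerDl ltW.
have Y2 : delta^-1 <= (size_ceil x)%:R.
  by apply: le_trans Yx'; rewrite /x addrA lerDr addr_ge0.
exact: (sinkhorn_random_correct vI eps0 Y1 d0 Y2 c1 c3).
Qed.
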